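(* Let $\sigma=\bar\sigma$, $b=\bar b$, and let $(\mathscr P_0,\mathscr A)$ be a pair with property (P). If the coupled Fokker-Planck equation $$\partial_t\mu_t=L^*_{t,\mu_t}\mu_t,\qquad\partial_t\nu_t=L^*_{t,\mu_t}\nu_t\qquad(\mathrm{FP})$$ is well-posed in $\big((\mathscr P_0,\mathscr A),(\mathscr P_0,\mathscr A)\big)$, then the McKean-Vlasov SDE $$dX_t=b(t,X_t,\mathscr L_{X_t})dt+\sigma(t,X_t,\mathscr L_{X_t})dW_t\qquad(\mathrm{MV})$$ is weakly well-posed in $(\mathscr P_0,\mathscr A)$.
   Context: Let $d,m\in\mathbb N$. $\mathscr P$ is the set of Borel probability measures on $\mathbb R^d$ with the weak topology and Borel $\sigma$-algebra $\mathscr B(\mathscr P)$; $C([s,\infty)\to\mathscr P_0)$ denotes weakly continuous paths in $\mathscr P_0\subset\mathscr P$. $\mathscr L_X$ is the law of $X$. $b:[0,\infty)\times\mathbb R^d\times\mathscr P\to\mathbb R^d$ and $\sigma:[0,\infty)\times\mathbb R^d\times\mathscr P\to\mathbb R^d\otimes\mathbb R^m$ are Borel measurable and $L_{t,\mu}h(x)=\frac12\sum_{i,j}(\sigma\sigma^* )_{ij}(t,x,\mu)\partial_i\partial_jh(x)+\sum_ib_i(t,x,\mu)\partial_ih(x)$. (In the paper the second equation may in general have coefficients $\bar b,\bar\sigma$; here they equal $b,\sigma$.) Property (P) for $(\mathscr P_0,\mathscr A)$ with $\mathscr P_0\in\mathscr B(\mathscr P)$, $\mathscr A\subset C([0,\infty)\to\mathscr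 P_0)$: if $\tilde\mu\in\mathscr P$ with $\tilde\mu\le C\mu$ for some $\mu\in\mathscr P_0$, $C\in(0,\infty)$, then $\tilde\mu\in\mathscr P_0$; if $(\lambda_t)_{t\ge0}\in\mathscr A$, then $(\lambda_{s+t})_{t\ge0}\in\mathscr A$ for all $s\ge0$, and $(\tilde\lambda_t)_{t\ge0}\in\mathscr A$ whenever $(\tilde\lambda_t)_{t\ge0}\in C([0,\infty)\to\mathscr P_0)$ and $\tilde\lambda_t\le C\lambda_t$ for all $t\ge0$ and some $C\in(0,\infty)$. Solutions (from time $s$): $(\mu_t)_{t\ge s}\in C([s,\infty)\to\mathscr P)$ solves the first equation if for all $t\ge s$, $\int_s^tdr\int(|b|+\|\sigma\|^2)(r,x,\mu_r)\mu_r(dx)<\infty$ and $\int h\,d\mu_t=\int h\,d\mu_s+\int_s^tdr\int L_{r,\mu_r}h\,d\mu_r$ for all $h\in C_0^\infty(\mathbb R^d)$. Given $(\mu_t)_{t\ge s}$, $(\nu_t)_{t\ge s}\in C([s,\infty)\to\mathscr P)$ solves the second equation if for all $t\ge s$, $\int_s^tdr\int(|b|+\|\sigma\|^2)(r,x,\mu_r)\nu_r(dx)<\infty$ and $\int h\,d\nu_t=\int h\,d\nu_s+\int_s^tdr\int L_{r,\mu_r}h\,d\nu_r$ for all $h\in C_0^\infty(\mathbb R^d)$. (FP) is well-posed in $((\mathscr P_0,\mathscr A),(\mathscr P_0,\mathscr A))$ if: (a) for every $(s,\zeta)\in[0,\infty)\times\mathscr P_0$ there is a unique solution $(\mu_{s,t}^\zeta)_{t\ge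 s}$ of the first equation from time $s$ with $\mu_{s,s}^\zeta=\zeta$ and $(\mu_{s,s+t}^\zeta)_{t\ge0}\in\mathscr A$, and $\zeta\mapsto\mu_{s,t}^\zeta$ is Borel measurable for all $t\ge s$; (b) for every $(s,\theta,\zeta)\in[0,\infty)\times\mathscr P_0\times\mathscr P_0$ there is a unique solution $(\nu_{s,t}^{\zeta,\theta})_{t\ge s}$ from time $s$ of the second equation with $\mu_{s,r}^\zeta$ in place of $\mu_r$, with $\nu_{s,s}^{\zeta,\theta}=\theta$ and $(\nu_{s,s+t}^{\zeta,\theta})_{t\ge0}\in\mathscr A$, and $(\theta,\zeta)\mapsto\nu_{s,t}^{\zeta,\theta}$ is Borel measurable for all $t\ge s$. A weak solution of (MV) starting from $s$ with time marginal law $\zeta$ is a continuous adapted $\mathbb R^d$-valued process $(X_t)_{t\ge s}$ on some probability space with normal filtration carrying an $\mathbb R^m$-valued Brownian motion $W$, such that $\mathscr L_{X_s}=\zeta$, $\int_s^tdr\int(|b|+\|\sigma\|^2)(r,x,\mathscr L_{X_r})\mathscr L_{X_r}(dx)<\infty$ for $t\ge s$, and a.s. $X_t=X_s+\int_s^tb(r,X_r,\mathscr L_{X_r})dr+\int_s^t\sigma(r,X_r,\mathscr L_{X_r})dW_r$ for $t\ge s$. (MV) is weakly well-posed in $(\mathscr P_0,\mathscr A)$ if for every $(s,\zeta)\in[0,\infty)\times\mathscr P_0$ and any two weak solutions $X,\tilde X$ starting from $s$ with $\mathscr L_{X_s}=\mathscr L_{\tilde X_s}=\zeta$ and time marginal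 laws $(\mathscr L_{X_{s+t}})_{t\ge0},(\mathscr L_{\tilde X_{s+t}})_{t\ge0}\in\mathscr A$, the laws of $X$ and $\tilde X$ on $C([s,\infty)\to\mathbb R^d)$ coincide. *)

(* Defs.v *)
From HB Require Import structures.
From mathcomp Require Import all_boot all_order all_algebra.
From mathcomp Require Import all_classical all_reals all_analysis.

Set Implicit Arguments.
Unset Strict Implicit.
Unset Printing Implicit Defensive.

Import Order.TTheory GRing.Theory Num.Theory.
Import numFieldNormedType.Exports.

Local Open Scope classical_set_scope.
Local Open Scope ring_scope.

HB.instance Definition _ (R : realType) (p q : nat) :=
  Measurable.copy 'M[R]_(p, q) (g_sigma_algebraType (@open 'M[R]_(p, q))).

(* The norm of the library on matrices is the sup norm. *)
Definition eucl_norm (R : realType) (d : nat) (x : 'rV[R]_d) : R :=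
  Num.sqrt (\sum_(i < d) x 0 i ^+ 2).

Definition hs_norm2 (R : realType) (p q : nat) (a : 'M[R]_(p, q)) : R :=
  \sum_(i < p) \sum_(j < q) a i j ^+ 2.

Section Measures.
Context (R : realType) (d : nat).

Definition Pr : Type := probability 'rV[R]_d R.

Definition Cb : Type := {f : 'rV[R]_d -> R | continuous f /\ bounded_fun f}.

Definition integrate (mu : Pr) : {ptws Cb -> R} :=
  fun f => \int[mu]_x (sval f x).

HB.instance Definition _ := Pointed.copy Pr (probability 'rV[R]_d R).
HB.instance Definition _ := Topological.copy Pr (initial_topology integrate).
HB.instance Definition _ :=
  Measurable.copy Pr (g_sigma_algebraType (@open Pr)).

Definition measure_le (mu : Pr) (C : R) (nu : Pr) : Prop :=
  forall B : set 'rV[R]_d, measurable B -> (mu B <= C%:E * nu B)%E.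

(* The library's measures are functions on all subsets, so that Leibniz
   equality also compares their irrelevant values on nonmeasurable sets:
   equality in the set of Borel probability measures is [measure_eq]. *)
Definition measure_eq (mu nu : Pr) : Prop :=
  forall B : set 'rV[R]_d, measurable B -> mu B = nu B.

End Measures.

(* A path on [s, +oo[ is given by a function on R of which only the values
   on [s, +oo[ matter; [from s f] is its restriction to [s, +oo[. *)
Definition from (R : realType) (s : R) (E : Type) (f : R -> E) :
  `[s, +oo[%classic -> E := sigL `[s, +oo[%classic f.
Arguments from {R} s%_R {E} f.

Definition cpath (R : realType) (d : nat) (s : R) (P0 : set (Pr R d))
    (mu : R -> Pr R d) : Prop :=
  {within `[s, +oo[, continuous mu} /\ forall t, s <= t -> P0 (mu t).

Definition borel_coef (R : realType) (d p q : nat)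
    (f : R -> 'rV[R]_d -> Pr R d -> 'M[R]_(p, q)) : Prop :=
  measurable_fun ([set t : R | 0 <= t] `*` [set: 'rV[R]_d] `*` [set: Pr R d])
    (fun z : R * 'rV[R]_d * Pr R d => f z.1.1 z.1.2 z.2).

Section TestFunctions.
Context (R : realType) (d : nat).

Definition partial (i : 'I_d) (h : 'rV[R]_d -> R) : 'rV[R]_d -> R :=
  fun x => 'D_(delta_mx 0 i) h x.

Definition smooth (h : 'rV[R]_d -> R) : Prop :=
  forall l : seq 'I_d, let g := foldr partial h l in
    continuous g /\ forall (i : 'I_d) x, derivable g x (delta_mx 0 i).

Definition test_function (h : 'rV[R]_d -> R) : Prop :=
  smooth h /\
  exists2 K : set 'rV[R]_d, compact K & forall x, ~ K x -> h x = 0.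

End TestFunctions.

Definition propertyP (R : realType) (d : nat) (P0 : set (Pr R d))
    (A : set (`[0%R : R, +oo[%classic -> Pr R d)) : Prop :=
  [/\ measurable P0,
      forall lam : R -> Pr R d, A (from 0 lam) -> cpath 0 P0 lam,
      forall mu mu' (C : R), P0 mu -> 0 < C -> measure_le mu' C mu -> P0 mu',
      forall (lam : R -> Pr R d) (s : R), 0 <= s -> A (from 0 lam) ->
        A (from 0 (fun t => lam (s + t)))
    & forall (lam lam' : R -> Pr R d) (C : R), A (from 0 lam) -> 0 < C -> cpath 0 P0 lam' ->
        (forall t : R, 0 <= t -> measure_le (lam' t) C (lam t)) ->
        A (from 0 lam')].

Section FokkerPlanck.
Context (R : realType) (d m : nat).
Variable b : R -> 'rV[R]_d -> Pr R d -> 'rV[R]_d.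
Variable sigma : R -> 'rV[R]_d -> Pr R d -> 'M[R]_(d, m).

Definition generator (t : R) (mu : Pr R d) (h : 'rV[R]_d -> R)
    (x : 'rV[R]_d) : R :=
  2^-1 * (\sum_(i < d) \sum_(j < d)
    (sigma t x mu *m (sigma t x mu)^T) i j * partial i (partial j h) x)
  + \sum_(i < d) b t x mu 0 i * partial i h x.

Definition coef_integrable (s : R) (mu nu : R -> Pr R d) : Prop :=
  forall t, s <= t ->
  (\int[lebesgue_measure]_(r in `[s, t]) \int[nu r]_x
     (eucl_norm (b r x (mu r)) + hs_norm2 (sigma r x (mu r)))%R%:E < +oo)%E.

(* d_t nu_t = L_{t, mu_t}^* nu_t on [s, +oo[, for a given path mu. *)
Definition FP2_solution (s : R) (mu nu : R -> Pr R d) : Prop :=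
  [/\ cpath s setT nu, coef_integrable s mu nu
    & forall t h, s <= t -> test_function h ->
      (\int[nu t]_x (h x)%:E = \int[nu s]_x (h x)%:E
       + \int[lebesgue_measure]_(r in `[s, t])
           \int[nu r]_x (generator r (mu r) h x)%:E)%E].

Definition FP1_solution (s : R) (mu : R -> Pr R d) : Prop :=
  FP2_solution s mu mu.

Variable P0 : set (Pr R d).
Variable A : set (`[0%R : R, +oo[%classic -> Pr R d).

Definition unique_in (s : R) (zeta : Pr R d)
    (sol : (R -> Pr R d) -> Prop) (mu : R -> Pr R d) : Prop :=
  let good lam :=
    [/\ sol lam, measure_eq (lam s) zeta & A (from 0 (fun t => lam (s + t)))] in
  good mu /\ forall mu', good mu' -> forall t, s <= t -> measure_eq (mu' t) (mu t).

Definition FP_wellposed : Prop :=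
  exists (mu : R -> Pr R d -> R -> Pr R d)
         (nu : R -> Pr R d -> Pr R d -> R -> Pr R d),
  [/\ forall (s : R) zeta, 0 <= s -> P0 zeta ->
        unique_in s zeta (FP1_solution s) (mu s zeta),
      forall s t : R, 0 <= s -> s <= t ->
        measurable_fun P0 (fun zeta => mu s zeta t),
      forall (s : R) theta zeta, 0 <= s -> P0 theta -> P0 zeta ->
        unique_in s theta (FP2_solution s (mu s zeta)) (nu s zeta theta)
    & forall s t : R, 0 <= s -> s <= t ->
        measurable_fun (P0 `*` P0)
          (fun z : Pr R d * Pr R d => nu s z.2 z.1 t)].

End FokkerPlanck.

Section StochasticIntegral.
Context (R : realType) (d m : nat).
Context (disp : measure_display) (Omega : measurableType disp).
Variable P : probability Omega R.
Variable F : R -> set (set Omega).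

Definition normal_filtration : Prop :=
  [/\ forall t, 0 <= t ->
        sigma_algebra [set: Omega] (F t) /\ F t `<=` measurable,
      forall t u, 0 <= t -> t <= u -> F t `<=` F u,
      forall t, 0 <= t -> \bigcap_(u in [set u | t < u]) F u `<=` F t
    & forall N, P.-negligible N -> F 0 N].

Definition F_measurable (t : R) (p q : nat) (f : Omega -> 'M[R]_(p, q)) :=
  forall B, measurable B -> F t (f @^-1` B).

(* The last clause says that W_t - W_u is independent of F_u and has law
   N(0, (t - u) I_m). *)
Definition brownian_motion (W : R -> Omega -> 'rV[R]_m) : Prop :=
  [/\ {ae P, forall w, W 0 w = 0},
      forall w, {within `[0, +oo[, continuous (W ^~ w)},
      forall t : R, 0 <= t -> F_measurable t (W t)
    & forall u t : R, 0 <= u -> u < t ->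
      forall (D : set Omega) (B : 'I_m -> set R),
        F u D -> (forall j, measurable (B j)) ->
        (P (D `&` [set w | forall j, B j (W t w 0 j - W u w 0 j)%R])
         = P D * \prod_(j < m) normal_prob 0 (Num.sqrt (t - u)) (B j))%E].

(* \sum_(k < sp_size) sp_val k * 1_{]sp_time k, sp_time k.+1]} *)
Record simple_process := SimpleProcess {
  sp_size : nat ;
  sp_time : nat -> R ;
  sp_val : nat -> Omega -> 'M[R]_(d, m) }.

Definition simple_from (s : R) (H : simple_process) : Prop :=
  forall k, [/\ s <= sp_time H k, sp_time H k <= sp_time H k.+1,
    F_measurable (sp_time H k) (sp_val H k)
  & exists C : R, forall w, `|sp_val H k w| <= C].

Definition simple_value (H : simple_process) (r : R) (w : Omega)
    : 'M[R]_(d, m) :=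
  \sum_(k < sp_size H)
    (sp_time H k < r <= sp_time H k.+1)%R%:R *: sp_val H k w.

Definition simple_integral (W : R -> Omega -> 'rV[R]_m) (H : simple_process)
    (t : R) (w : Omega) : 'rV[R]_d :=
  \sum_(k < sp_size H)
    (W (Num.min (sp_time H k.+1) t) w - W (Num.min (sp_time H k) t) w)
      *m (sp_val H k w)^T.

(* I is a continuous version of t |-> \int_s^t H_r dW_r for H in
   L^2(P * dr) on each [s, t]: the L^2-limit of the integrals of simple
   processes that converge to H. *)
Definition ito_integral (W : R -> Omega -> 'rV[R]_m) (s : R)
    (H : R -> Omega -> 'M[R]_(d, m)) (I : R -> Omega -> 'rV[R]_d) : Prop :=
  [/\ forall w, {within `[s, +oo[, continuous (I ^~ w)},
      forall t, s <= t -> F_measurable t (I t)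
    & exists Hn : nat -> simple_process,
      (forall n, simple_from s (Hn n)) /\
      forall t, s <= t ->
        (fun n => \int[P]_w \int[lebesgue_measure]_(r in `[s, t])
           (hs_norm2 (simple_value (Hn n) r w - H r w)%R)%:E)%E
          @ \oo --> 0%E /\
        (fun n => \int[P]_w
           ((eucl_norm (simple_integral W (Hn n) t w - I t w)%R ^+ 2)%R)%:E)%E
          @ \oo --> 0%E].

End StochasticIntegral.

Section PathSpace.
Context (R : realType) (d : nat) (s : R).

Definition path_space : Type :=
  {x : `[s, +oo[%classic -> 'rV[R]_d | continuous x}.

HB.instance Definition _ := gen_eqMixin path_space.
HB.instance Definition _ := gen_choiceMixin path_space.
HB.instance Definition _ := isPointed.Build path_space
  (exist _ (cst 0) (@cst_continuous `[s, +oo[%classic 'rV[R]_d 0)).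

(* The sigma-algebra of the coordinate maps. *)
Definition cylinders : set (set path_space) :=
  [set C | exists t (B : set 'rV[R]_d),
     measurable B /\ C = [set x | B (sval x t)]].

HB.instance Definition _ :=
  Measurable.copy path_space (g_sigma_algebraType cylinders).

Definition path_of (Omega : Type) (X : R -> Omega -> 'rV[R]_d)
    (cX : forall w, {within `[s, +oo[, continuous (X ^~ w)}) (w : Omega)
    : path_space :=
  exist _ (from s (X ^~ w)) ((subspace_sigL_continuousP _ _).1 (cX w)).

End PathSpace.

Section McKeanVlasov.
Context (R : realType) (d m : nat).
Variable b : R -> 'rV[R]_d -> Pr R d -> 'rV[R]_d.
Variable sigma : R -> 'rV[R]_d -> Pr R d -> 'M[R]_(d, m).

Section WeakSolution.
Context (disp : measure_display) (Omega : measurableType disp).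
Variable P : probability Omega R.

Definition law (X : R -> {RV P >-> 'rV[R]_d}) (t : R) : Pr R d :=
  distribution P (X t).

(* As for paths, only the X_t with s <= t matter. *)
Definition weak_solution (F : R -> set (set Omega))
    (W : R -> Omega -> 'rV[R]_m) (X : R -> {RV P >-> 'rV[R]_d})
    (s : R) (zeta : Pr R d) : Prop :=
  [/\ normal_filtration P F /\ brownian_motion P F W,
      (forall w, {within `[s, +oo[, continuous (fun t => X t w)}) /\
        (forall t, s <= t -> F_measurable F t (X t)),
      measure_eq (law X s) zeta,
      coef_integrable b sigma s (law X) (law X)
    & exists I : R -> Omega -> 'rV[R]_d,
        ito_integral P F W s (fun r w => sigma r (X r w) (law X r)) I /\
        {ae P, forall w, forall t, s <= t ->
          X t w = X s w
            + (\row_i \int[lebesgue_measure]_(r in `[s, t])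
                 b r (X r w) (law X r) 0 i)
            + I t w}].

End WeakSolution.

Definition MV_weakly_wellposed (P0 : set (Pr R d))
    (A : set (`[0%R : R, +oo[%classic -> Pr R d)) : Prop :=
  forall (s : R) (zeta : Pr R d), 0 <= s -> P0 zeta ->
  forall (d1 d2 : measure_display)
    (O1 : measurableType d1) (O2 : measurableType d2)
    (P1 : probability O1 R) (P2 : probability O2 R)
    (F1 : R -> set (set O1)) (F2 : R -> set (set O2))
    (W1 : R -> O1 -> 'rV[R]_m) (W2 : R -> O2 -> 'rV[R]_m)
    (X1 : R -> {RV P1 >-> 'rV[R]_d}) (X2 : R -> {RV P2 >-> 'rV[R]_d})
    (cX1 : forall w, {within `[s, +oo[, continuous (fun t => X1 t w)})
    (cX2 : forall w, {within `[s, +oo[, continuous (fun t => X2 t w)}),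
  weak_solution F1 W1 X1 s zeta -> weak_solution F2 W2 X2 s zeta ->
  A (from 0 (fun t => law X1 (s + t))) ->
  A (from 0 (fun t => law X2 (s + t))) ->
  forall C : set (path_space d s), measurable C ->
    pushforward P1 (path_of cX1) C = pushforward P2 (path_of cX2) C.

End McKeanVlasov.

(* Main.v *)
Require Import Defs.
From HB Require Import structures.
From mathcomp Require Import all_boot all_order all_algebra.
From mathcomp Require Import all_classical all_reals all_analysis.
From mathcomp Require Import measurable_realfun ring lra.
Set Implicit Arguments.
Unset Strict Implicit.
Unset Printing Implicit Defensive.
Import Order.TTheory GRing.Theory Num.Theory.
Import numFieldNormedType.Exports.
Local Open Scope classical_set_scope.
Local Open Scope ring_scope.

(** * Real-valued integrals *)

Section RealIntegrals.
Context (R : realType) d (T : measurableType d).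
Variable mu : {measure set T -> \bar R}.
Implicit Types (D : set T) (f g : T -> R).

Definition integrableR D f := mu.-integrable D (EFin \o f).

Lemma integrableR_measurable D f : integrableR D f -> measurable_fun D f.
Proof. by move=> h; apply/measurable_EFinP; exact: measurable_int h. Qed.

Lemma le_integrableR D g f : measurable D -> integrableR D g ->
  measurable_fun D f -> (forall x, D x -> `|f x| <= g x) -> integrableR D f.
Proof.
move=> mD ig mf fg; apply: (le_integrable mD _ _ ig).
  exact/measurable_EFinP.
move=> x Dx /=; rewrite lee_fin; apply: le_trans (fg x Dx) _; exact: ler_norm.
Qed.

Lemma integrableRS D E f : measurable D -> measurable E -> E `<=` D ->
  integrableR D f -> integrableR E f.
Proof. exact: integrableS. Qed.

Lemma integrableR_norm D f : integrableR D f -> integrableR D (fun x => `|f x|).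
Proof. exact: integrable_norm. Qed.

Lemma integrableRD D f g : measurable D ->
  integrableR D f -> integrableR D g -> integrableR D (fun x => f x + g x).
Proof. by move=> mD fi gi; exact: (integrableD mD fi gi). Qed.

Lemma integrableRB D f g : measurable D ->
  integrableR D f -> integrableR D g -> integrableR D (fun x => f x - g x).
Proof. by move=> mD fi gi; exact: (integrableB mD fi gi). Qed.

Lemma integrableRZ D (k : R) f : measurable D ->
  integrableR D f -> integrableR D (fun x => k * f x).
Proof. by move=> mD fi; exact: (integrableZl mD k fi). Qed.

Lemma integrableR0 D : measurable D -> integrableR D (fun _ => 0).
Proof. by move=> mD; exact: integrable0. Qed.

Lemma integrableR_sum D (I : Type) (s : seq I) (h : I -> T -> R) : measurable D ->
  (forall i, integrableR D (h i)) -> integrableR D (fun x => \sum_(i <- s) h i x).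
Proof.
move=> mD hi; elim: s => [|i s IH].
  by under eq_fun do rewrite big_nil; exact: integrableR0.
by under eq_fun do rewrite big_cons; exact: integrableRD.
Qed.

Lemma integrableRM D (K : R) f g : measurable D -> integrableR D g ->
  measurable_fun D f -> (forall x, D x -> `|f x| <= K) ->
  integrableR D (fun x => f x * g x).
Proof.
move=> mD gi mf fK.
apply: (le_integrableR mD (integrableRZ K mD (integrableR_norm gi))).
  by apply: measurable_funM => //; exact: integrableR_measurable.
by move=> x Dx; rewrite normrM ler_wpM2r// fK.
Qed.

Lemma Rintegral_sum D (I : Type) (s : seq I) (h : I -> T -> R) : measurable D ->
  (forall i, integrableR D (h i)) ->
  \int[mu]_(x in D) (\sum_(i <- s) h i x) = \sum_(i <- s) \int[mu]_(x in D) h i x.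
Proof.
move=> mD hi; elim: s => [|i s IH].
  under eq_Rintegral do rewrite big_nil.
  by rewrite big_nil /Rintegral integral0.
under eq_Rintegral do rewrite big_cons.
rewrite big_cons RintegralD// ?IH//; first exact: hi.
exact: (integrableR_sum s mD hi).
Qed.

Lemma EFin_Rintegral D f : measurable D -> integrableR D f ->
  (\int[mu]_(x in D) f x)%:E = (\int[mu]_(x in D) (f x)%:E)%E.
Proof. by move=> mD fi; rewrite /Rintegral fineK//; exact: integrable_fin_num. Qed.

Lemma dominated_cvgR D (f_ : nat -> T -> R) f g : measurable D ->
  (forall n, measurable_fun D (f_ n)) -> measurable_fun D f ->
  (forall x, D x -> (fun n => f_ n x) @ \oo --> f x) ->
  integrableR D g -> (forall n x, D x -> `|f_ n x| <= g x) ->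
  (fun n => \int[mu]_(x in D) f_ n x) @ \oo --> \int[mu]_(x in D) f x.
Proof.
move=> mD mf_ mf f_f ig f_g.
have h1 n : measurable_fun D (EFin \o f_ n) by exact/measurable_EFinP.
have h2 : measurable_fun D (EFin \o f) by exact/measurable_EFinP.
have h3 : {ae mu, forall x, D x -> (fun n => (EFin \o f_ n) x) @ \oo --> (EFin \o f) x}.
  apply: aeW => x Dx; apply/fine_cvgP; split; [exact: nearW|exact: f_f].
have h4 : {ae mu, forall x n, D x -> (`|(EFin \o f_ n) x| <= (EFin \o g) x)%E}.
  by apply: aeW => x n Dx /=; rewrite lee_fin; exact: f_g.
have [fi _ cv] := @dominated_convergence _ _ _ mu D mD _ _ _ h1 h2 h3 ig h4.
apply: fine_cvg; rewrite EFin_Rintegral//; exact: cv.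
Qed.

Lemma ae_integrableR D f g : measurable D -> measurable_fun D f ->
  {ae mu, forall x, D x -> f x = g x} -> integrableR D g -> integrableR D f.
Proof.
move=> mD mf fg ig; have mg := integrableR_measurable ig.
have /integrableP[_ h] := ig; apply/integrableP; split; first exact/measurable_EFinP.
move: h; rewrite -(@ae_eq_integral _ _ _ mu D (abse \o (EFin \o g)) (abse \o (EFin \o f)) mD)//.
- by apply: measurableT_comp => //; exact/measurable_EFinP.
- by apply: measurableT_comp => //; exact/measurable_EFinP.
- by apply: filterS fg => x h Dx /=; rewrite h.
Qed.

Lemma ae_eq_Rintegral D f g : measurable D ->
  measurable_fun D f -> measurable_fun D g ->
  {ae mu, forall x, D x -> f x = g x} ->
  \int[mu]_(x in D) f x = \int[mu]_(x in D) g x.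
Proof.
move=> mD mf mg fg; congr fine; apply: ae_eq_integral => //.
- exact/measurable_EFinP.
- exact/measurable_EFinP.
- by apply: filterS fg => x h Dx /=; rewrite h.
Qed.

Lemma ae_le_Rintegral D f g : measurable D ->
  integrableR D f -> integrableR D g ->
  {ae mu, forall x, D x -> f x <= g x} ->
  \int[mu]_(x in D) f x <= \int[mu]_(x in D) g x.
Proof.
move=> mD fi gi fg; have mf := integrableR_measurable fi.
have mg := integrableR_measurable gi.
have mm : measurable_fun D (fun x => Num.max (f x) (g x)) by exact: measurable_maxr.
have mgi : {ae mu, forall x, D x -> Num.max (f x) (g x) = g x}.
  by apply: filterS fg => x h Dx; rewrite max_r// h.
rewrite -(ae_eq_Rintegral mD mm mg mgi); apply: le_Rintegral => //.
  exact: (ae_integrableR mD mm mgi).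
by move=> x _; rewrite le_max lexx.
Qed.

End RealIntegrals.

Lemma bounded_integrableR (R : realType) d (T : measurableType d)
    (P : probability T R) (K : R) (f : T -> R) :
  measurable_fun setT f -> (forall x, `|f x| <= K) -> integrableR P setT f.
Proof.
by move=> mf fK; apply: (le_integrableR measurableT
  (finite_measure_integrable_cst P K measurableT)).
Qed.

Lemma cube_sum_le (R : realType) (I : Type) (s : seq I) (x : I -> R) :
  (forall i, 0 <= x i) ->
  (\sum_(i <- s) x i) ^+ 3 <= 4 ^+ size s * \sum_(i <- s) x i ^+ 3.
Proof.
move=> x0; elim: s => [|i s IH]; first by rewrite !big_nil expr0n/= mulr0.
rewrite !big_cons /= [4 ^+ _]exprS -mulrA.
set S := \sum_(j <- s) x j in IH *; set S3 := \sum_(j <- s) _ in IH *.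
have S0 : 0 <= S by exact: sumr_ge0.
have h : (x i + S) ^+ 3 <= 4 * (x i ^+ 3 + S ^+ 3).
  have := mulr_ge0 (addr_ge0 (x0 i) S0) (sqr_ge0 (x i - S)).
  rewrite !exprS expr0; nra.
apply: le_trans h _; rewrite ler_wpM2l// mulrDr lerD//.
by rewrite ler_peMl ?exprn_ge0// exprn_ege1// ler1n.
Qed.

Lemma cvg_sum (R : realType) (T : Type) (F : set_system T) (FF : Filter F)
    (I : Type) (s : seq I) (u : I -> T -> R) (l : I -> R) :
  (forall i, u i @ F --> l i) ->
  (fun n => \sum_(i <- s) u i n) @ F --> \sum_(i <- s) l i.
Proof.
move=> ul; elim: s => [|i s IH].
  by under eq_fun do rewrite big_nil; rewrite big_nil; exact: cvg_cst.
by under eq_fun do rewrite big_cons; rewrite big_cons; exact: cvgD.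
Qed.

(** * Borel sets of matrix spaces *)

Lemma natSinv_half (R : realType) (e : R) : 0 < e ->
  exists n, n.+1%:R^-1 + n.+1%:R^-1 < e.
Proof.
move=> e0; have e20 : 0 < e / 2 by rewrite divr_gt0.
have [n _ /(_ n (leqnn n))/= h] := near_infty_natSinv_lt (PosNum e20).
have {}h : (n.+1%:R^-1 : R) < e / 2 := h.
by exists n; rewrite [ltRHS]splitr ltrD.
Qed.

Section MatrixBorel.
Context (R : realType) (p q : nat).

Lemma open_measurable_mx (U : set 'M[R]_(p, q)) : open U -> measurable U.
Proof. exact: sub_sigma_algebra. Qed.

Lemma continuous_measurable_mx (f : 'M[R]_(p, q) -> R) :
  continuous f -> measurable_fun setT f.
Proof.
move=> /continuousP cf; apply: (measurability _ (RGenOpens.measurableE R)).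
move=> _ [_ [a [b ->] <-]]; rewrite setTI.
by apply: open_measurable_mx; apply: cf; exact: interval_open.
Qed.

Lemma measurable_coord i j :
  measurable_fun setT (fun A : 'M[R]_(p, q) => A i j).
Proof. apply: continuous_measurable_mx; exact: coord_continuous. Qed.

Lemma ratmx_dense (x : 'M[R]_(p, q)) (e : R) : 0 < e ->
  exists Q : 'M[rat]_(p, q), ball x e (map_mx ratr Q).
Proof.
move=> e0.
have H i j : exists r : rat, `|x i j - ratr r| < e.
  have [r] := @rat_in_itvoo R (x i j - e) (x i j + e) ltac:(lra).
  rewrite in_itv/= => /andP[h1 h2]; exists r; rewrite ltr_norml; lra.
exists (\matrix_(i, j) sval (cid (H i j))) => //.
by split=> // i j; rewrite !mxE; case: cid.
Qed.

(** Rational boxes form a countable base, so the coordinates generate the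
    Borel sets. *)
Lemma measurable_mxP d (T : measurableType d) (D : set T)
    (f : T -> 'M[R]_(p, q)) : measurable D ->
  (forall i j, measurable_fun D (fun t => f t i j)) -> measurable_fun D f.
Proof.
move=> mD mf.
have mball (y : 'M[R]_(p, q)) (e : R) : 0 < e ->
    measurable (D `&` [set t | ball y e (f t)]).
  move=> e0; have -> : D `&` [set t | ball y e (f t)] = D `&`
      \bigcap_(ij in [set: 'I_p * 'I_q])
        (D `&` [set t | ball (y ij.1 ij.2) e (f t ij.1 ij.2)]).
    apply/seteqP; split => t /= [Dt].
      by move=> h; split=> // -[i j] _; split => //; exact: h.2.
    by move=> h; split=> //; split=> // i j; have [] := h (i, j) I.
  apply: measurableI => //; apply: fin_bigcap_measurable => //.
  move=> [i j] _ /=.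
  have -> : D `&` [set t | ball (y i j) e (f t i j)] =
     D `&` (fun t => f t i j) @^-1` ball (y i j) e by [].
  by apply: mf => //; exact: measurable_ball.
apply: (@measurability _ _ _ _ D f (@open 'M[R]_(p, q)) erefl).
move=> _ [U oU <-].
have -> : D `&` f @^-1` U = \bigcup_(Q : 'M[rat]_(p, q)) \bigcup_(n : nat)
    (if `[< ball (map_mx ratr Q : 'M[R]_(p, q)) n.+1%:R^-1 `<=` U >]
     then D `&` [set t | ball (map_mx ratr Q : 'M[R]_(p, q)) n.+1%:R^-1 (f t)] else set0).
  apply/seteqP; split => [t [Dt Uft]|t [Q _ [n _]]]; last first.
    by case: asboolP => // sU [Dt /sU].
  have /nbhs_ballP[e /= e0 eU] : nbhs (f t) U by exact: open_nbhs_nbhs.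
  have [n ne] := natSinv_half e0.
  have [Q Qb] := @ratmx_dense (f t) (n.+1%:R^-1) ltac:(by rewrite invr_gt0).
  exists Q => //; exists n => //.
  have sU : ball (map_mx ratr Q : 'M[R]_(p, q)) n.+1%:R^-1 `<=` U.
    move=> z Qz; apply: eU; apply: (le_ball (ltW ne)).
    exact: ball_triangle Qb Qz.
  rewrite /= asboolT//.
  by split => //; exact: ball_sym.
apply: countable_bigcupT_measurable => [|Q]; first exact: countableP.
apply: bigcupT_measurable => n.
by case: ifPn => //= _; apply: mball; rewrite invr_gt0.
Qed.

Lemma measurable_fun_coord d (T : measurableType d) (D : set T)
    (f : T -> 'M[R]_(p, q)) i j :
  measurable_fun D f -> measurable_fun D (fun t => f t i j).
Proof. by move=> mf; apply: (measurableT_comp (measurable_coord i j)). Qed.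

Lemma continuous_mxP (T : topologicalType) (f : T -> 'M[R]_(p, q)) :
  (forall i j, continuous (fun t => f t i j)) -> continuous f.
Proof.
move=> cf t A [B nB BA].
have H : \forall u \near t, forall ij : 'I_p * 'I_q, B ij.1 ij.2 (f u ij.1 ij.2).
  by apply: filter_forall => -[i j] /=; exact: (cf i j t _ (nB i j)).
by apply: (@filterS _ (nbhs t) _ _ _ _ H) => u hu; apply: BA => i j; exact: (hu (i, j)).
Qed.

Lemma measurable_singleton_mx (v : 'M[R]_(p, q)) : measurable [set v].
Proof.
have -> : [set v] = ~` (~` [set v]) by rewrite setCK.
apply: measurableC; apply: open_measurable_mx; rewrite openC.
by apply: accessible_closed_set1; apply: hausdorff_accessible; exact: norm_hausdorff.
Qed.

End MatrixBorel.

(** * Taylor estimates for test functions *)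

Section Lines.
Context (R : realType) (d : nat).
Implicit Types (f : 'rV[R]_d -> R) (x v : 'rV[R]_d).

Lemma is_derive_line f v x (t : R) : derivable f (x + t *: v) v ->
  is_derive t (1 : R) (fun t : R => f (x + t *: v)) ('D_v f (x + t *: v)).
Proof.
move=> df.
have E : (fun h : R => h^-1 *: (((fun t : R => f (x + t *: v)) \o shift t)
     (h *: (1 : R)) - f (x + t *: v))) =
   (fun h : R => h^-1 *: ((f \o shift (x + t *: v)) (h *: v) - f (x + t *: v))).
  apply/funext => h /=; congr (_ *: (f _ - _)).
  rewrite (_ : h *: (1 : R) = h); last exact: mulr1.
  by rewrite scalerDl addrCA.
by split; rewrite /derivable/derive /= E.
Qed.

Lemma mvt_coord f i x (a : R) :
  (forall y, derivable f y (delta_mx 0 i)) ->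
  exists2 c : R, `|c| <= `|a| &
    f (x + a *: delta_mx 0 i) - f x =
    partial i f (x + c *: delta_mx 0 i) * a.
Proof.
move=> df; pose g (t : R) := f (x + t *: delta_mx 0 i).
have dg (t : R) : is_derive t (1 : R) g (partial i f (x + t *: delta_mx 0 i)).
  exact: is_derive_line.
have cg (I : set R) : {within I, continuous g}.
  apply: continuous_subspaceT => t; apply: differentiable_continuous.
  by apply/derivable1_diffP; have [] := dg t.
have g0 : g 0 = f x by rewrite /g scale0r addr0.
have [a0|/ltW a0] := leP 0 a.
  have [c cI] := MVT_segment a0 (fun t _ => dg t) (cg _).
  rewrite g0 subr0 => E; exists c => //.
  by move: cI; rewrite in_itv/= => /andP[? ?]; rewrite !ger0_norm.
have [c cI] := MVT_segment a0 (fun t _ => dg t) (cg _).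
rewrite g0 sub0r => E; exists c.
  by move: cI; rewrite in_itv/= => /andP[? ?]; rewrite !ler0_norm// lerN2.
by apply: oppr_inj; rewrite -mulrN -E opprB.
Qed.

Lemma ler_mx_coord p q (A : 'M[R]_(p, q)) i j : `|A i j| <= `|A|.
Proof.
rewrite [leRHS](_ : _ = mx_norm A)// mx_normrE.
by apply/bigmax_geP; right => /=; exists (i, j).
Qed.

Lemma ler_coord x i : `|x 0 i| <= `|x|. Proof. exact: ler_mx_coord. Qed.

Lemma ler_mxnormP x (r : R) : 0 <= r ->
  (forall i, `|x 0 i| <= r) -> `|x| <= r.
Proof.
move=> r0 h; rewrite [leLHS](_ : _ = mx_norm x)// mx_normrE; apply/bigmax_leP; split => // -[i j] _ /=.
by rewrite ord1.
Qed.

(** Moving from [x] to [x + v] one coordinate at a time. *)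
Lemma mvt_coords f x v :
  (forall i y, derivable f y (delta_mx 0 i)) ->
  exists2 w : 'I_d -> 'rV[R]_d, (forall i, `|w i| <= `|v|) &
    f (x + v) - f x = \sum_(i < d) partial i f (x + w i) * v 0 i.
Proof.
move=> df; pose V (k : nat) : 'rV[R]_d := \row_(i < d) (if (i < k)%N then v 0 i else 0).
have VS (i : 'I_d) : V i.+1 = V i + v 0 i *: delta_mx 0 i.
  apply/rowP => j; rewrite !mxE eqxx/= ltnS leq_eqVlt.
  have [->|ji] := eqVneq j i; first by rewrite eqxx ltnn/= mulr1 add0r.
  by rewrite (negbTE (_ : val j != val i)) //= mulr0 addr0.
have H (i : 'I_d) : exists c : R, `|c| <= `|v 0 i| /\
    f (x + V i.+1) - f (x + V i) =
    partial i f (x + (V i + c *: delta_mx 0 i)) * v 0 i.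
  have [c h1 h2] := mvt_coord (x + V i) (v 0 i) (df i).
  by exists c; rewrite VS !addrA.
pose c i := sval (cid (H i)).
exists (fun i : 'I_d => V i + c i *: delta_mx 0 i) => [i|].
  apply: ler_mxnormP => // j; rewrite !mxE eqxx/=.
  have := ler_coord v j; have := ler_coord v i.
  rewrite /c; case: cid => /= ci [ci1 _] vi vj.
  have [->|ji] := eqVneq j i; first by rewrite ltnn/= mulr1 add0r (le_trans ci1).
  by rewrite mulr0 addr0; case: ifP => // _; rewrite normr0.
have -> : f (x + v) - f x = f (x + V d) - f (x + V 0).
  congr (f (x + _) - f _); first by apply/rowP => j; rewrite mxE ltn_ord.
  by rewrite (_ : V 0 = 0) ?addr0//; apply/rowP => j; rewrite !mxE.
rewrite -(telescope_sumr (fun k => f (x + V k)) (leq0n d)) big_mkord.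
by apply: eq_bigr => i _; rewrite /c; case: cid => /= ci [].
Qed.

Lemma lipschitz_partials f (K : R) x v :
  (forall i y, derivable f y (delta_mx 0 i)) ->
  (forall i y, `|partial i f y| <= K) ->
  `|f (x + v) - f x| <= d%:R * K * `|v|.
Proof.
move=> df bf; have [w _ ->] := mvt_coords x v df.
apply: le_trans (ler_norm_sum _ _ _) _.
apply: (@le_trans _ _ (\sum_(i < d) K * `|v|)); last first.
  by rewrite sumr_const card_ord -[leLHS]mulr_natl !mulrA.
by apply: ler_sum => i _; rewrite normrM ler_pM// ler_coord.
Qed.

Lemma taylor1 f (K : R) x v :
  (forall i y, derivable f y (delta_mx 0 i)) ->
  (forall i j y, derivable (partial i f) y (delta_mx 0 j)) ->
  (forall i j y, `|partial j (partial i f) y| <= K) ->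
  `|f (x + v) - f x - \sum_(i < d) partial i f x * v 0 i|
    <= d%:R * (d%:R * K) * `|v| ^+ 2.
Proof.
move=> df ddf bf; have [w wv ->] := mvt_coords x v df.
rewrite -sumrB; apply: le_trans (ler_norm_sum _ _ _) _.
apply: (@le_trans _ _ (\sum_(i < d) d%:R * K * `|v| ^+ 2)); last first.
  by rewrite sumr_const card_ord -[leLHS]mulr_natl !mulrA.
apply: ler_sum => i _; rewrite -mulrBl normrM expr2 mulrA ler_pM ?ler_coord//.
apply: le_trans (lipschitz_partials x (w i) (ddf i) (bf i)) _.
apply: ler_wpM2l => //; have K0 : 0 <= K by apply: le_trans (bf i i 0).
by rewrite mulr_ge0.
Qed.

Lemma is_derive_partials f (K : R) x v (t : R) :
  (forall i y, derivable f y (delta_mx 0 i)) ->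
  (forall i j y, derivable (partial i f) y (delta_mx 0 j)) ->
  (forall i j y, `|partial j (partial i f) y| <= K) ->
  is_derive t (1 : R) (fun t : R => f (x + t *: v))
    (\sum_(i < d) partial i f (x + t *: v) * v 0 i).
Proof.
move=> df ddf bf; set L := \sum_(i < d) _.
set C := d%:R * (d%:R * K) * `|v| ^+ 2.
have C0 : 0 <= C.
  have := taylor1 x v df ddf bf.
  by move=> h; apply: le_trans h.
suff H : (fun h : R => h^-1 *: (((fun t : R => f (x + t *: v)) \o shift t)
     (h *: (1 : R)) - f (x + t *: v))) @ 0^' --> L.
  by split; [apply/cvg_ex; exists L|exact/cvg_lim].
apply/cvgrPdist_le => e e0.
have eC0 : 0 < e / (C + 1) by rewrite divr_gt0// ltr_wpDl.
near=> h; have h0 : h != 0 by near: h; exact: nbhs_dnbhs_neq.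
have hC : `|h| < e / (C + 1).
  near: h; apply: dnbhs0_lt; exact: eC0.
rewrite /= (_ : h *: (1 : R) = h); last exact: mulr1.
rewrite (addrC h) scalerDl addrA.
set y := x + t *: v.
have E : L - h^-1 * (f (y + h *: v) - f y) =
  - h^-1 * (f (y + h *: v) - f y - \sum_(i < d) partial i f y * (h *: v) 0 i).
  have -> : \sum_(i < d) partial i f y * (h *: v) 0 i = h * L.
    by rewrite mulr_sumr; apply: eq_bigr => i _; rewrite mxE mulrCA.
  by field.
rewrite [X in `|X|]E normrM normrN normfV [leLHS]mulrC.
rewrite ler_pdivrMr ?normr_gt0//.
apply: le_trans (taylor1 y (h *: v) df ddf bf) _.
rewrite normrZ exprMn mulrCA expr2 -/C -mulrA mulrC; apply: ler_wpM2r => //.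
apply: le_trans (_ : e / (C + 1) * C <= _).
  by apply: ler_wpM2r => //; exact: ltW.
by rewrite mulrAC ler_pdivrMr ?ltr_wpDl// ler_wpM2l ?(ltW e0)// ler_wpDr.
Unshelve. all: by end_near. Qed.

Lemma taylor2 f (K : R) x v :
  (forall i y, derivable f y (delta_mx 0 i)) ->
  (forall i j y, derivable (partial i f) y (delta_mx 0 j)) ->
  (forall i j k y, derivable (partial j (partial i f)) y (delta_mx 0 k)) ->
  (forall i j y, `|partial j (partial i f) y| <= K) ->
  (forall i j k y, `|partial k (partial j (partial i f)) y| <= K) ->
  `|f (x + v) - f x - \sum_(i < d) partial i f x * v 0 i
      - 2^-1 * \sum_(i < d) \sum_(j < d)
          partial i (partial j f) x * (v 0 i * v 0 j)|
    <= d%:R * (d%:R * (d%:R * K)) * `|v| ^+ 3.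
Proof.
move=> df ddf dddf b2 b3.
set L1 := \sum_(i < d) partial i f x * v 0 i.
set L2 := \sum_(i < d) \sum_(j < d) _.
pose g (t : R) := f (x + t *: v) - t * L1 - t ^+ 2 * (2^-1 * L2).
pose g' (t : R) := \sum_(i < d) partial i f (x + t *: v) * v 0 i - L1 - t * L2.
have dg (t : R) : is_derive t (1 : R) g (g' t).
  have h := is_derive_partials x v t df ddf b2.
  have h1 : is_derive t (1:R) (fun t : R => t * L1) L1.
    have -> : (fun t : R => t * L1) = L1 \*: id.
      by apply/funext => u /=; rewrite /GRing.scale/= mulrC.
    by apply: is_derive_eq; rewrite /GRing.scale/= mulr1.
  have h2 : is_derive t (1:R) (fun t : R => t ^+ 2 * (2^-1 * L2)) (t * L2).
    have -> : (fun t : R => t ^+ 2 * (2^-1 * L2)) = (2^-1 * L2) \*: (fun t => t ^+ 2).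
      by apply/funext => u /=; rewrite /GRing.scale/= mulrC.
    apply: is_derive_eq; rewrite /GRing.scale/=; by field.
  exact: (is_deriveB (is_deriveB h h1) h2).
have [c cI E] := @MVT_segment _ g g' 0 1 ler01 (fun t _ => dg t)
  (@continuous_subspaceT _ _ _ g (fun t => differentiable_continuous
    ((derivable1_diffP _ _).1 (@ex_derive _ _ _ _ _ _ _ (dg t))))).
move: cI; rewrite in_itv/= => /andP[c0 c1].
have -> : f (x + v) - f x - L1 - 2^-1 * L2 = g' c.
  have -> : g' c = g 1 - g 0 by rewrite E subr0 mulr1.
  by rewrite /g scale1r scale0r addr0; ring.
have -> : g' c = \sum_(j < d) (partial j f (x + c *: v) - partial j f x
    - \sum_(i < d) partial i (partial j f) x * (c *: v) 0 i) * v 0 j.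
  rewrite /g' /L1 /L2 exchange_big/= mulr_sumr -!sumrB.
  apply: eq_bigr => j _; rewrite !mulrBl; congr (_ - _).
  by rewrite mulr_sumr mulr_suml; apply: eq_bigr => i _; rewrite mxE; ring.
apply: le_trans (ler_norm_sum _ _ _) _.
apply: (@le_trans _ _ (\sum_(j < d) d%:R * (d%:R * K) * `|v| ^+ 3)); last first.
  by rewrite sumr_const card_ord -[leLHS]mulr_natl !mulrA.
apply: ler_sum => j _; rewrite normrM exprSr [leRHS]mulrA ler_pM ?ler_coord//.
apply: le_trans (taylor1 x (c *: v) (ddf j) (dddf j) (b3 j)) _.
have K0 : 0 <= K by apply: le_trans (b2 j j 0).
rewrite normrZ exprMn (ger0_norm c0).
rewrite ler_wpM2l ?mulr_ge0//.
by rewrite ler_piMl ?exprn_ge0// exprn_ile1.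
Qed.

End Lines.

Section TestFunctionBounds.
Context (R : realType) (d : nat).
Implicit Types (h : 'rV[R]_d -> R) (x y v : 'rV[R]_d).

Lemma partials_support h (K : set 'rV[R]_d) (l : seq 'I_d) : compact K ->
  (forall x, ~ K x -> h x = 0) -> forall x, ~ K x -> foldr (@partial R d) h l x = 0.
Proof.
move=> cK hK; elim: l => [//|i l IH] x nKx /=.
have oK : open (~` K).
  by rewrite openC; apply: compact_closed => //; exact: norm_hausdorff.
rewrite /partial (@near_eq_derive _ _ _ _ (cst 0)) ?derive_cst//.
have : nbhs x (~` K) by apply: open_nbhs_nbhs; split.
by apply: filterS => y; exact: IH.
Qed.

Lemma test_function_bounded h (l : seq 'I_d) : test_function h ->
  exists C : R, forall x, `|foldr (@partial R d) h l x| <= C.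
Proof.
move=> [sh [K cK hK]]; have [ch _] := sh l.
have cfK : compact (foldr (@partial R d) h l @` K).
  by apply: continuous_compact => //; exact: continuous_subspaceT.
have [M [_ bM]] := compact_bounded cfK.
exists (`|M| + 1) => x; have [Kx|nKx] := pselect (K x).
  by apply: (bM (`|M| + 1)); [rewrite ltr_pwDr// ler_norm|exists x].
by rewrite (partials_support l cK hK nKx) normr0.
Qed.

Lemma common_bound (I : finType) (T : Type) (F : I -> T -> R) :
  (forall i, exists C : R, forall t, `|F i t| <= C) ->
  exists2 C : R, 0 <= C & forall i t, `|F i t| <= C.
Proof.
move=> H; pose c i := sval (cid (H i)); exists (\sum_i `|c i|).
  by apply: sumr_ge0.
move=> i t; apply: (@le_trans _ _ `|c i|).
  by rewrite /c; case: cid => /= C hC; rewrite (le_trans (hC t))// ler_norm.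
by rewrite (bigD1 i)//= lerDl sumr_ge0.
Qed.

(** Everything that the expectation estimates use of a test function.  The
    truncations by [1] keep the errors integrable when the drift is merely
    integrable, and the increment is split into a martingale part [N] and a
    drift part [B] because only [N] has moments. *)
Record jet_bound h (C : R) : Prop := JetBound {
  jet_ge0 : 0 <= C ;
  jet_b0 : forall x, `|h x| <= C ;
  jet_b1 : forall i x, `|partial i h x| <= C ;
  jet_b2 : forall i j x, `|partial i (partial j h) x| <= C ;
  jet_l0 : forall x y, `|h x - h y| <= C * Num.min 1 `|x - y| ;
  jet_l1 : forall i x y,
    `|partial i h x - partial i h y| <= C * Num.min 1 `|x - y| ;
  jet_l2 : forall i j x y,
    `|partial i (partial j h) x - partial i (partial j h) y|
      <= C * Num.min 1 `|x - y| ;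
  jet_taylor : forall y N B,
    `|h (y + N + B) - h y - \sum_(i < d) partial i h y * (N + B) 0 i
      - 2^-1 * \sum_(i < d) \sum_(j < d)
          partial i (partial j h) y * (N 0 i * N 0 j)|
    <= C * (`|B| * Num.min 1 (`|N| + `|B|) + `|N| ^+ 3) }.

Lemma test_function_jet h : test_function h -> exists C, jet_bound h C.
Proof.
move=> th; have [sh _] := th.
have D0 i y : derivable h y (delta_mx 0 i) by have [_] := sh [::]; exact.
have D1 i j y : derivable (partial i h) y (delta_mx 0 j).
  by have [_] := sh [:: i]; exact.
have D2 i j k y : derivable (partial j (partial i h)) y (delta_mx 0 k).
  by have [_] := sh [:: j; i]; exact.
have D3 i j k l y :
    derivable (partial k (partial j (partial i h))) y (delta_mx 0 l).
  by have [_] := sh [:: k; j; i]; exact.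
have [C0 B0] := test_function_bounded [::] th.
have [C1 C1_ge0 B1] := @common_bound 'I_d 'rV[R]_d (fun i => partial i h)
  (fun i => test_function_bounded [:: i] th).
have [C2 C2_ge0 B2] := @common_bound ('I_d * 'I_d)%type 'rV[R]_d
  (fun ij => partial ij.2 (partial ij.1 h))
  (fun ij => test_function_bounded [:: ij.2; ij.1] th).
have [C3 C3_ge0 B3] := @common_bound ('I_d * 'I_d * 'I_d)%type 'rV[R]_d
  (fun ij => partial ij.2 (partial ij.1.2 (partial ij.1.1 h)))
  (fun ij => test_function_bounded [:: ij.2; ij.1.2; ij.1.1] th).
have C0_ge0 : 0 <= C0 by apply: le_trans (B0 0).
have d0 : 0 <= d%:R :> R by [].
have lip (f : 'rV[R]_d -> R) (c k K : R) : 0 <= k -> k + k <= K ->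
    d%:R * c <= K -> (forall x, `|f x| <= k) ->
    (forall i y, derivable f y (delta_mx 0 i)) ->
    (forall i y, `|partial i f y| <= c) ->
    forall x y, `|f x - f y| <= K * Num.min 1 `|x - y|.
  move=> k0 kK cK bf df bdf x y; have K0 : 0 <= K by rewrite (le_trans _ kK)// addr_ge0.
  rewrite minr_pMr// mulr1 le_min; apply/andP; split.
    by rewrite (le_trans (ler_normB _ _))// (le_trans _ kK)// lerD.
  have := lipschitz_partials y (x - y) df bdf.
  by rewrite [y + _]addrC subrK => /le_trans; apply; rewrite ler_wpM2r.
pose L1 := C1 + C1 + d%:R * C2.
have L1_ge0 : 0 <= L1 by rewrite !addr_ge0// mulr_ge0.
have lip1 i : forall x y, `|partial i h x - partial i h y| <= L1 * Num.min 1 `|x - y|.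
  apply: (lip _ C2 C1) => //.
  - by rewrite lerDl mulr_ge0.
  - by rewrite lerDr addr_ge0.
  - by move=> j y; exact: (B2 (i, j)).
pose C := C0 + C0 + d%:R * C1 + (C1 + C1 + d%:R * C2) + (C2 + C2 + d%:R * C3)
  + d%:R * L1 + d%:R * (d%:R * (d%:R * (C2 + C3))).
have p1 : 0 <= d%:R * C1 by rewrite mulr_ge0.
have p2 : 0 <= d%:R * C2 by rewrite mulr_ge0.
have p3 : 0 <= d%:R * C3 by rewrite mulr_ge0.
have p4 : 0 <= d%:R * L1 by rewrite mulr_ge0.
have p5 : 0 <= d%:R * (d%:R * (d%:R * (C2 + C3))) by rewrite !mulr_ge0// addr_ge0.
exists C; split.
- by rewrite /C; lra.
- by move=> x; apply: le_trans (B0 x) _; rewrite /C; lra.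
- by move=> i x; apply: le_trans (B1 i x) _; rewrite /C; lra.
- by move=> i j x; apply: le_trans (B2 (j, i) x) _; rewrite /C; lra.
- by apply: (lip _ C1 C0) => //; rewrite /C; lra.
- move=> i x y; apply: le_trans (lip1 i x y) _; apply: ler_wpM2r.
    by rewrite le_min ler01 normr_ge0.
  by move: p4; rewrite /C /L1; lra.
- move=> i j; apply: (lip _ C3 C2) => //.
  + by rewrite /C; lra.
  + by rewrite /C; lra.
  + by move=> x; exact: (B2 (j, i)).
  + by move=> k y; exact: (B3 (j, i, k)).
move=> y N B; set Q := 2^-1 * _.
have b2 i j z : `|partial j (partial i h) z| <= C2 + C3.
  by apply: le_trans (B2 (i, j) z) _; rewrite lerDl.
have b3 i j k z : `|partial k (partial j (partial i h)) z| <= C2 + C3.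
  by apply: le_trans (B3 (i, j, k) z) _; rewrite lerDr.
have T2 := taylor2 y N D0 D1 D2 b2 b3.
have [w wB E] := mvt_coords (y + N) B D0.
have -> : h (y + N + B) - h y - \sum_(i < d) partial i h y * (N + B) 0 i - Q =
   (h (y + N) - h y - \sum_(i < d) partial i h y * N 0 i - Q) +
   \sum_(i < d) (partial i h (y + N + w i) - partial i h y) * B 0 i.
  have -> : \sum_(i < d) partial i h y * (N + B) 0 i =
      \sum_(i < d) partial i h y * N 0 i + \sum_(i < d) partial i h y * B 0 i.
    by rewrite -big_split/=; apply: eq_bigr => i _; rewrite mxE mulrDr.
  under [X in _ = _ + X]eq_bigr do rewrite mulrBl.
  rewrite sumrB -E; ring.
apply: le_trans (ler_normD _ _) _; rewrite mulrDr [leRHS]addrC lerD//.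
  apply: le_trans T2 _; apply: ler_wpM2r; first exact: exprn_ge0.
  by rewrite /C; lra.
apply: le_trans (ler_norm_sum _ _ _) _.
apply: (@le_trans _ _ (\sum_(i < d) L1 * (`|B| * Num.min 1 (`|N| + `|B|)))).
  apply: ler_sum => i _; rewrite normrM mulrA [L1 * _]mulrC -mulrA mulrC.
  apply: ler_pM => //; first exact: ler_coord.
  apply: le_trans (lip1 i _ _) _; apply: ler_wpM2l => //.
  rewrite (_ : y + N + w i - y = N + w i); last by rewrite [y + N]addrC addrAC addrK.
  rewrite le_min ge_min lexx/= ge_min; apply/orP; right.
  by rewrite (le_trans (ler_normD _ _))// lerD.
rewrite sumr_const card_ord -[leLHS]mulr_natl mulrA; apply: ler_wpM2r.
  by rewrite mulr_ge0// le_min ler01 addr_ge0.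
by rewrite /C; lra.
Qed.

End TestFunctionBounds.

(** * Moments of centred normal distributions *)

Section Gaussian.
Context (R : realType).
Local Notation mu := (@lebesgue_measure R).

Lemma ae_eq_normal_density (m s : R) :
  ae_eq mu setT (Radon_Nikodym_SigmaFinite.f (normal_prob m s) mu)
    (EFin \o normal_pdf m s).
Proof.
apply: integral_ae_eq => //.
- exact: Radon_Nikodym_SigmaFinite.f_integrable (normal_prob_dominates m s).
- by apply/measurable_EFinP; exact: measurable_normal_pdf.
- move=> E _ mE.
  by rewrite -Radon_Nikodym_SigmaFinite.f_integral//; exact: normal_prob_dominates.
Qed.

Lemma ge0_integral_normal_prob (m s : R) (f : R -> \bar R) :
  measurable_fun setT f -> (forall x, 0 <= f x)%E ->
  (\int[normal_prob m s]_x f x = \int[mu]_x (f x * (normal_pdf m s x)%:E))%E.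
Proof.
move=> mf f0; have dom := normal_prob_dominates m s.
rewrite -(Radon_Nikodym_SigmaFinite.change_of_variables dom)//.
apply: ae_eq_integral => //.
- apply: emeasurable_funM => //; apply: (measurable_int mu).
  exact: Radon_Nikodym_SigmaFinite.f_integrable.
- apply: emeasurable_funM => //; apply/measurable_EFinP.
  exact: measurable_normal_pdf.
- by apply: ae_eqe_mul2l; exact: ae_eq_normal_density.
Qed.

Lemma integrable_normal_prob (m s : R) (f : R -> R) :
  measurable_fun setT f ->
  mu.-integrable setT (EFin \o (fun x => f x * normal_pdf m s x)) ->
  (normal_prob m s).-integrable setT (EFin \o f).
Proof.
move=> mf /integrableP[_ fi]; apply/integrableP; split; first exact/measurable_EFinP.
rewrite ge0_integral_normal_prob//; last first.
  by apply: measurableT_comp => //; exact/measurable_EFinP.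
move: fi; congr (_ < _)%E; apply: eq_integral => x _ /=.
by rewrite -EFinM normrM (ger0_norm (normal_pdf_ge0 _ _ _)).
Qed.

Lemma integral_normal_prob (m s : R) (f : R -> R) :
  measurable_fun setT f ->
  mu.-integrable setT (EFin \o (fun x => f x * normal_pdf m s x)) ->
  (\int[normal_prob m s]_x (f x)%:E
    = \int[mu]_x (f x * normal_pdf m s x)%:E)%E.
Proof.
move=> mf fi; rewrite integralE [RHS]integralE.
have mpos : measurable_fun setT (EFin \o f)^\+%E.
  by apply: measurable_funepos; exact/measurable_EFinP.
have mneg : measurable_fun setT (EFin \o f)^\-%E.
  by apply: measurable_funeneg; exact/measurable_EFinP.
rewrite ge0_integral_normal_prob// ge0_integral_normal_prob//.
have p0 x : 0 <= normal_pdf m s x by exact: normal_pdf_ge0.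
congr (_ - _)%E; apply: eq_integral => x _.
- by rewrite !funeposE EFinM maxe_pMl ?lee_fin// mul0e.
- by rewrite !funenegE EFinM -mulNe maxe_pMl ?lee_fin// mul0e.
Qed.

Section Moments.
Variable s : R.
Hypothesis s0 : 0 < s.

Let sn0 : s != 0. Proof. by rewrite gt_eqF. Qed.

Let e (x : R) := expR (- x ^+ 2 / (s ^+ 2 *+ 2)).

Let pdfE x : normal_pdf 0 s x = normal_peak s * e x.
Proof. by rewrite /normal_pdf (negbTE sn0) /normal_fun subr0. Qed.

(** A cubic factor costs a constant and a fixed part of the exponent: this
    dominates the third absolute moment by the mass of a normal law with twice
    the variance. *)
Lemma cube_gauss_le (x : R) : `|x| ^+ 3 * expR (- x ^+ 2 / (s ^+ 2 *+ 2)) <= 64 * s ^+ 3 * expR (- x ^+ 2 / (s ^+ 2 *+ 4)).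
Proof.
pose y := `|x| / s; have y0 : 0 <= y by rewrite divr_ge0// ltW.
have xE : `|x| = y * s by rewrite /y divfK.
have y2 : x ^+ 2 / (s ^+ 2) = y ^+ 2 by rewrite /y expr_div_n real_normK// num_real.
have -> : expR (- x ^+ 2 / (s ^+ 2 *+ 2)) = expR (- y ^+ 2 / 4) * expR (- x ^+ 2 / (s ^+ 2 *+ 4)).
  rewrite -expRD -y2; congr expR; field.
  by rewrite sn0.
rewrite mulrA ler_wpM2r ?expR_ge0// xE exprMn.
rewrite -mulrA [s ^+ 3 * _]mulrC mulrA ler_wpM2r ?exprn_ge0 ?(ltW s0)//.
have h : 1 + y ^+ 2 / 8 <= expR (y ^+ 2 / 8) by exact: expR_ge1Dx.
have -> : - y ^+ 2 / 4 = - (y ^+ 2 / 8 + y ^+ 2 / 8) by field.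
rewrite expRN expRD ler_pdivrMr ?mulr_gt0 ?expR_gt0//.
apply: le_trans (_ : 64 * ((1 + y ^+ 2 / 8) * (1 + y ^+ 2 / 8)) <= _).
  have := mulr_ge0 y0 (mulr_ge0 y0 (sqr_ge0 (y - 1))).
  have := mulr_ge0 y0 y0; have := sqr_ge0 (y * y).
  rewrite !expr2 !exprS expr0; nra.
have p : 0 <= 1 + y ^+ 2 / 8 by rewrite addr_ge0// divr_ge0// exprn_ge0.
by rewrite ler_wpM2l// ler_pM.
Qed.

Let s2 : R := Num.sqrt 2 * s.
Let s2n0 : s2 != 0. Proof. by rewrite mulf_neq0// sqrtr_eq0 -ltNge. Qed.
Let s2E : s2 ^+ 2 = s ^+ 2 *+ 2.
Proof. by rewrite exprMn sqr_sqrtr// mulr_natl. Qed.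

Definition cube_const : R := 64 * Num.sqrt 2.

Let cube_pdf x :
  `|x| ^+ 3 * normal_pdf 0 s x <= cube_const * s ^+ 3 * normal_pdf 0 s2 x.
Proof.
have peakE : normal_peak s = Num.sqrt 2 * normal_peak s2.
  rewrite /normal_peak s2E.
  have -> : s ^+ 2 *+ 2 * pi *+ 2 = 2 * (s ^+ 2 * pi *+ 2) by ring.
  by rewrite [in RHS]sqrtrM// invfM mulrA divff ?mul1r.
rewrite pdfE peakE /normal_pdf (negbTE s2n0) /normal_fun subr0 s2E -mulrnA.
rewrite mulrCA; apply: le_trans (ler_wpM2l _ (cube_gauss_le x)) _.
  by rewrite mulr_ge0// ?sqrtr_ge0// normal_peak_ge0.
rewrite /cube_const le_eqVlt; apply/orP; left; apply/eqP; ring.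
Qed.

Let mpdf (t : R) : measurable_fun setT (normal_pdf 0 t).
Proof. exact: measurable_normal_pdf. Qed.

Let mabs3 : measurable_fun setT (fun x : R => `|x| ^+ 3).
Proof. by apply: measurable_funX; exact: normr_measurable. Qed.

Let integrable_cube_pdf :
  mu.-integrable setT (EFin \o (fun x => `|x| ^+ 3 * normal_pdf 0 s x)).
Proof.
have : mu.-integrable setT (fun x => ((cube_const * s ^+ 3)%:E * (normal_pdf 0 s2 x)%:E)%E).
  by apply: integrableZl => //; exact: integrable_normal_pdf.
apply: le_integrable => //.
  by apply/measurable_EFinP; apply: measurable_funM => //; exact: mpdf.
move=> x _ /=; rewrite lee_fin.
rewrite ger0_norm; last by rewrite mulr_ge0// ?exprn_ge0// normal_pdf_ge0.
by apply: le_trans (cube_pdf x) _; exact: ler_norm.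
Qed.

Lemma normal_cube_moment :
  (\int[normal_prob 0 s]_x (`|x| ^+ 3)%:E <= (cube_const * s ^+ 3)%:E)%E.
Proof.
have mE : measurable_fun setT (fun x : R => (`|x| ^+ 3)%:E).
  by apply/measurable_EFinP; exact: mabs3.
rewrite ge0_integral_normal_prob//.
apply: (@le_trans _ _ (\int[mu]_x ((cube_const * s ^+ 3)%:E * (normal_pdf 0 s2 x)%:E))%E).
  apply: ge0_le_integral => //.
  - by move=> x _; rewrite mule_ge0// lee_fin ?exprn_ge0// normal_pdf_ge0.
  - by apply/measurable_EFinP; apply: measurable_funM => //; exact: mpdf.
  - by apply/measurable_EFinP; apply: measurable_funM => //; exact: mpdf.
  - by move=> x _; rewrite -!EFinM lee_fin; exact: cube_pdf.
rewrite integralZl//; last exact: integrable_normal_pdf.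
by rewrite integral_normal_pdf mule1.
Qed.

Lemma normal_integrable_pow k : (k <= 3)%N ->
  mu.-integrable setT (EFin \o (fun x => x ^+ k * normal_pdf 0 s x)).
Proof.
move=> k3.
have : mu.-integrable setT (fun x => (`|x| ^+ 3 * normal_pdf 0 s x)%:E
    + (normal_pdf 0 s x)%:E)%E.
  by apply: integrableD => //; exact: integrable_normal_pdf.
apply: le_integrable => //.
  by apply/measurable_EFinP; apply: measurable_funM; [exact: measurable_funX|exact: mpdf].
have p0 x : 0 <= normal_pdf 0 s x by exact: normal_pdf_ge0.
move=> x _ /=; rewrite lee_fin normrM (ger0_norm (p0 x)) normrX.
rewrite -[X in _ + X]mul1r -mulrDl [leRHS]ger0_norm ?mulr_ge0 ?addr_ge0 ?exprn_ge0//.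
apply: ler_wpM2r => //; have [x1|x1] := leP `|x| 1.
  by rewrite (@le_trans _ _ 1)// ?exprn_ile1// lerDr exprn_ge0.
by rewrite (@le_trans _ _ (`|x| ^+ 3))// ?lerDl// ler_eXn2l.
Qed.

End Moments.

(** Integrating an exact derivative whose primitive vanishes at infinity. *)
Lemma integral_derivative0 (f F : R -> R) (C : R) :
  continuous f -> (forall x, is_derive x (1 : R) F (f x)) ->
  mu.-integrable setT (EFin \o f) ->
  (forall n : nat, `|F n.+1%:R| <= C / n.+1%:R /\ `|F (- n.+1%:R)| <= C / n.+1%:R) ->
  (\int[mu]_x (f x)%:E = 0)%E.
Proof.
move=> cf dF fi FC.
pose I n : set R := `[- n.+1%:R, n.+1%:R]%classic.
have cF : continuous F.
  move=> x; apply: differentiable_continuous.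
  by apply/derivable1_diffP; have [] := dF x.
have int_n n : (\int[mu]_x ((f \_ (I n)) x)%:E
    = (F n.+1%:R)%:E - (F (- n.+1%:R))%:E)%E.
  rewrite [X in (\int[mu]_x X x)%E](_ : _ = (EFin \o f) \_ (I n)); last first.
    by rewrite restrict_EFin.
  rewrite -integral_mkcond; apply: (@continuous_FTC2 _ f F).
  - by rewrite -subr_gt0 opprK -natrD ltr0n.
  - exact: continuous_subspaceT.
  - split; first by move=> x _; have [] := dF x.
      by apply: cvg_at_right_filter; exact: cF.
    by apply: cvg_at_left_filter; exact: cF.
  - by move=> x _; rewrite derive1E; have [_ ->] := dF x.
have mf : measurable_fun setT (EFin \o f) by exact: measurable_int fi.
have mI n : measurable (I n) by exact: measurable_itv.
have mfn n : measurable_fun setT (fun x => ((f \_ (I n)) x)%:E).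
  apply/measurable_EFinP; apply/(measurable_restrictT _ (mI n)).
  by apply: measurable_funTS; exact/measurable_EFinP.
have fn_cvg : {ae mu, forall x, [set: R] x ->
    (fun n => ((f \_ (I n)) x)%:E) @ \oo --> (EFin \o f) x}.
  apply: aeW => x _; apply: cvg_near_cst; near=> n.
  rewrite patchE mem_set// /I/= in_itv/= -ler_norml.
  near: n; have [N _ hN] := nbhs_infty_ger `|x|.
  by exists N => // n /= Nn; rewrite (le_trans (hN n Nn))// ler_nat.
have fn_le : {ae mu, forall x n, [set: R] x ->
    (`|((f \_ (I n)) x)%:E| <= (abse \o (EFin \o f)) x)%E}.
  apply: aeW => x n _; rewrite patchE /=; case: ifP => _ //.
  by rewrite normr0 lee_fin.
have [_ _ cvg1] := @dominated_convergence _ _ _ mu setT measurableT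
  _ _ _ mfn mf fn_cvg
  (integrable_abse fi) fn_le.
have cvg2 : (fun n => \int[mu]_x ((f \_ (I n)) x)%:E)%E @ \oo --> (0 : \bar R).
  under eq_fun do rewrite int_n -EFinB.
  apply/fine_cvgP; split; first by apply: nearW.
  rewrite /=; apply/cvgr0Pnorm_le => eps eps0.
  have [n0 _ hn0] := @near_infty_natSinv_lt R (PosNum (divr_gt0 eps0 (ltr_pwDr ltr01 (addr_ge0 (normr_ge0 C) (normr_ge0 C))))).
  exists n0 => // n /= n0n; apply: le_trans (ler_normB _ _) _.
  have [h1 h2] := FC n; apply: le_trans (lerD h1 h2) _.
  have := hn0 n n0n; rewrite /= ltr_pdivlMr; last by rewrite ltr_pwDr// addr_ge0.
  move=> h3; rewrite -mulrDl mulrC; apply: le_trans (ltW h3).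
  apply: ler_wpM2l; first by rewrite invr_ge0.
  by rewrite -[leLHS]addr0; rewrite !lerD ?ler_norm.
by apply: (cvg_unique _ cvg1 cvg2).
Unshelve. all: by end_near. Qed.

Section FirstMoments.
Variable s : R.
Hypothesis s0 : 0 < s.

Let sn0 : s != 0. Proof. by rewrite gt_eqF. Qed.

Let e (x : R) := expR (- x ^+ 2 / (s ^+ 2 *+ 2)).

Let pdfE x : normal_pdf 0 s x = normal_peak s * e x.
Proof. by rewrite /normal_pdf (negbTE sn0) /normal_fun subr0. Qed.

Let pdf_decay (n : nat) k : (k <= 1)%N ->
  n.+1%:R ^+ k * normal_pdf 0 s n.+1%:R
    <= 64 * s ^+ 3 * normal_peak s / n.+1%:R.
Proof.
move=> k1; set x : R := n.+1%:R; have x0 : 0 < x by rewrite ltr0n.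
have x1 : 1 <= x by rewrite ler1n.
have := @cube_gauss_le s s0 x; rewrite (ger0_norm (ltW x0)) => h.
rewrite ler_pdivlMr// pdfE.
have e1 : expR (- x ^+ 2 / (s ^+ 2 *+ 4)) <= 1.
  rewrite -[leRHS]expR0 ler_expR mulNr oppr_le0.
  by rewrite divr_ge0// ?mulrn_wge0// sqr_ge0.
have h' : x ^+ 3 * e x <= 64 * s ^+ 3.
  by apply: le_trans h _; rewrite ler_piMr// mulr_ge0// exprn_ge0// ltW.
have p0 : 0 <= normal_peak s by exact: normal_peak_ge0.
apply: (@le_trans _ _ (normal_peak s * (x ^+ 3 * e x))); last first.
  by rewrite [leRHS]mulrC ler_wpM2l.
have -> : x ^+ k * (normal_peak s * e x) * x = normal_peak s * (x ^+ k.+1 * e x).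
  by rewrite exprS; ring.
by rewrite ler_wpM2l// ler_wpM2r ?expR_ge0// ler_weXn2l// !ltnS (leq_trans k1).
Qed.

Let is_derive_pdf (x : R) :
  is_derive x (1 : R) (normal_pdf 0 s) (- (x / s ^+ 2) * normal_pdf 0 s x).
Proof.
have -> : normal_pdf 0 s = (fun x => normal_peak s * e x) by apply/funext => z; rewrite pdfE.
have h : is_derive x (1 : R) (fun y : R => - y ^+ 2 / (s ^+ 2 *+ 2)) (- (x / s ^+ 2)).
  have -> : (fun y : R => - y ^+ 2 / (s ^+ 2 *+ 2)) =
    (- (s ^+ 2 *+ 2)^-1) \*: (fun y : R => y ^+ 2).
    by apply/funext => y /=; rewrite /GRing.scale/= mulrC mulrN mulNr.
  by apply: is_derive_eq; rewrite /GRing.scale/=; field.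
have he : is_derive x (1 : R) e ((- (x / s ^+ 2)) * e x).
  by have := is_derive1_comp (is_derive_expR _) h; rewrite mulrC.
have -> : (fun x => normal_peak s * e x) = normal_peak s \*: e by [].
by apply: is_derive_eq; rewrite /GRing.scale/=; ring.
Qed.

Let cpdf : continuous (normal_pdf 0 s).
Proof. exact: continuous_normal_pdf. Qed.

Let pdfN x : normal_pdf 0 s (- x) = normal_pdf 0 s x.
Proof. by rewrite !pdfE /e sqrrN. Qed.

Lemma normal_first_moment : (\int[normal_prob 0 s]_x x%:E = 0)%E.
Proof.
have i1 : mu.-integrable setT (EFin \o (fun x => x * normal_pdf 0 s x)).
  exact: (normal_integrable_pow s0 (isT : (1 <= 3)%N)).
rewrite (@integral_normal_prob 0 s id)//.
apply: (@integral_derivative0 _ (fun x => - s ^+ 2 * normal_pdf 0 s x)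
  (s ^+ 2 * (64 * s ^+ 3 * normal_peak s))) => //.
- move=> x; apply: continuousM; [exact: cvg_id|exact: cpdf].
- move=> x; have -> : (fun x => - s ^+ 2 * normal_pdf 0 s x) = (- s ^+ 2) \*: normal_pdf 0 s by [].
  have h := is_derive_pdf x.
  by apply: is_derive_eq; rewrite /GRing.scale/=; field.
- move=> n; rewrite pdfN; have p0 := normal_pdf_ge0 0 s n.+1%:R.
  rewrite normrM normrN (ger0_norm p0) ger0_norm ?sqr_ge0// -mulrA.
  have := @pdf_decay n 0 isT; rewrite expr0 mul1r => h.
  by split; apply: ler_wpM2l; rewrite ?sqr_ge0.
Qed.

Lemma normal_second_moment : (\int[normal_prob 0 s]_x (x ^+ 2)%:E = (s ^+ 2)%:E)%E.
Proof.
have i2 : mu.-integrable setT (EFin \o (fun x => x ^+ 2 * normal_pdf 0 s x)).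
  exact: normal_integrable_pow.
have i0 := integrable_normal_pdf 0 s.
have m2 : measurable_fun setT (fun x : R => x ^+ 2).
  by apply: (measurable_funX 2); exact: measurable_id.
rewrite (integral_normal_prob m2 i2).
have i3 : mu.-integrable setT (EFin \o (fun x => s ^+ 2 * normal_pdf 0 s x)).
  exact: (integrableZl measurableT (s ^+ 2) i0).
suff : (\int[mu]_x ((x ^+ 2 * normal_pdf 0 s x) - s ^+ 2 * normal_pdf 0 s x)%:E = 0)%E.
  rewrite (integralB_EFin measurableT i2 i3).
  have -> : (\int[mu]_x (s ^+ 2 * normal_pdf 0 s x)%:E = (s ^+ 2)%:E)%E.
    under eq_integral do rewrite EFinM.
    by rewrite integralZl// integral_normal_pdf mule1.
  move=> h; rewrite -[LHS](@subeK _ _ (s ^+ 2)%:E)// -[RHS]add0e; congr (_ + _)%E.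
  exact: h.
apply: (@integral_derivative0 _ (fun x => - s ^+ 2 * (x * normal_pdf 0 s x))
  (s ^+ 2 * (64 * s ^+ 3 * normal_peak s))).
- move=> x; apply: cvgB.
    by apply: cvgM; [exact: exprn_continuous|exact: cpdf].
  by apply: cvgM; [exact: cvg_cst|exact: cpdf].
- move=> x; have -> : (fun x => - s ^+ 2 * (x * normal_pdf 0 s x)) =
    (- s ^+ 2) \*: (id * normal_pdf 0 s) by [].
  have h := is_derive_pdf x.
  by apply: is_derive_eq; rewrite /GRing.scale/=; field.
- exact: (integrableB measurableT i2 i3).
- move=> n; rewrite pdfN; have p0 := normal_pdf_ge0 0 s n.+1%:R.
  rewrite !normrM !normrN (ger0_norm p0) (ger0_norm (sqr_ge0 s)) normr_nat -mulrA.
  by split; apply: ler_wpM2l; rewrite ?sqr_ge0//; exact: (@pdf_decay n 1 isT).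
Qed.

End FirstMoments.
End Gaussian.

(** * Orthogonality to a sub-sigma-algebra *)

Section SubSigmaAlgebra.
Context (R : realType) d (Omega : measurableType d).
Variable P : probability Omega R.

(** Measurability of a real function for a plain set of sets [G]; this is the
    usual notion as soon as [G] is a sigma-algebra. *)
Definition measurable_wrt (G : set (set Omega)) (f : Omega -> R) :=
  measurable_fun setT (f : g_sigma_algebraType G -> R).

Lemma measurable_wrtP (G : set (set Omega)) (f : Omega -> R) :
  sigma_algebra setT G ->
  (forall B, measurable B -> G (f @^-1` B)) <-> measurable_wrt G f.
Proof.
move=> sG; split.
  move=> h _ B mB; rewrite setTI; apply: sub_sigma_algebra; exact: h.
move=> mf B mB; have := mf measurableT B mB.
by rewrite setTI /measurable /= sigma_algebra_id.
Qed.

Lemma measurable_wrtS (G H : set (set Omega)) (f : Omega -> R) :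
  G `<=` H -> measurable_wrt G f -> measurable_wrt H f.
Proof.
move=> GH mf _ B mB; rewrite setTI.
have := mf measurableT B mB; rewrite setTI.
apply: smallest_sub; first exact: smallest_sigma_algebra.
by apply: subset_trans GH _; exact: sub_sigma_algebra.
Qed.

Lemma measurable_wrt_measurable (G : set (set Omega)) (f : Omega -> R) :
  G `<=` measurable -> measurable_wrt G f -> measurable_fun setT f.
Proof.
move=> GM mf _ B mB; rewrite setTI; have := mf measurableT B mB; rewrite setTI.
by apply: smallest_sub => //; exact: sigma_algebra_measurable.
Qed.

Import HBNNSimple.

Lemma measurable_preimage_wrt (G : set (set Omega)) (f : Omega -> R) B :
  sigma_algebra setT G -> measurable_wrt G f -> measurable B -> G (f @^-1` B).
Proof. by move=> sG /(measurable_wrtP _ sG) h; exact: h. Qed.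

Local Lemma orthogonal_ge0 (G : set (set Omega)) (Y xi : Omega -> R) :
  sigma_algebra setT G -> G `<=` measurable ->
  integrableR P setT Y ->
  (forall A, G A -> \int[P]_(w in A) Y w = 0) ->
  measurable_wrt G xi -> (forall w, 0 <= xi w) ->
  integrableR P setT (fun w => xi w * Y w) ->
  \int[P]_w (xi w * Y w) = 0.
Proof.
move=> sG GM iY Y0 mxi xi0 ixiY.
pose T' : measurableType _ := g_sigma_algebraType G.
have mxi' : measurable_fun [set: T'] (fun w : T' => (xi w)%:E) by exact/measurable_EFinP.
pose f := nnsfun_approx (@measurableT _ T') mxi'.
have xi0' (w : T') : [set: T'] w -> (0 <= (xi w)%:E)%E by move=> _; rewrite lee_fin.
have mY := integrableR_measurable iY.
have f_G n : measurable_wrt G (f n) by exact: measurable_funPT.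
have mf n : measurable_fun setT (f n : Omega -> R).
  exact: (measurable_wrt_measurable GM).
have f_cvg (w : Omega) : (fun n => f n w) @ \oo --> xi w.
  have := @cvg_nnsfun_approx _ T' R setT measurableT _ mxi' xi0' w I.
  exact: fine_cvg.
have f_le n (w : Omega) : `|f n w| <= xi w.
  rewrite ger0_norm; last exact: (@fun_ge0 _ _ (f n)).
  apply: (cvgr_to_ge (f_cvg w)); near=> m.
  have nm : (n <= m)%N by near: m; exact: nbhs_infty_ge.
  by have /lefP := @nd_nnsfun_approx _ T' R setT measurableT _ mxi' n m nm; exact.
have fY0 n : \int[P]_w (f n w * Y w) = 0.
  have iA A : measurable A -> integrableR P setT (Y \_ A).
    move=> mA; rewrite /integrableR -restrict_EFin; apply/(integrable_mkcond _ mA).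
    exact: integrableS iY.
  have mlev (y : R) : G ((f n : Omega -> R) @^-1` [set y]).
    exact: (measurable_preimage_wrt sG (f_G n)).
  under eq_Rintegral do rewrite fimfunEord mulr_suml.
  set s := fset_set _.
  pose c (i : nat) := (finmap.enum_fset s)`_i.
  have E (i : nat) (w : Omega) : c i * \1_((f n : Omega -> R) @^-1` [set c i]) w * Y w
      = c i * (Y \_ ((f n : Omega -> R) @^-1` [set c i])) w.
    by rewrite patch_indic /= -mulrA [Y w * _]mulrC.
  under eq_Rintegral do under eq_bigr do rewrite -/(c _) E.
  have iAi (i : nat) : integrableR P setT (Y \_ ((f n : Omega -> R) @^-1` [set c i])).
    by apply: iA; exact: GM.
  rewrite Rintegral_sum//; last by move=> i; exact: integrableRZ.
  apply: big1 => i _; rewrite RintegralZl//; last exact: iAi.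
  by rewrite -Rintegral_mkcond Y0// mulr0.
have cv := @dominated_cvgR _ _ _ P setT (fun n w => f n w * Y w)
  (fun w => xi w * Y w) (fun w => `|xi w * Y w|) measurableT
  (fun n => measurable_funM (mf n) mY) (integrableR_measurable ixiY).
have {}cv := cv (fun w _ => cvgM (f_cvg w) (@cvg_cst _ _ _ _ _)) (integrableR_norm ixiY).
have {}cv : (fun n => \int[P]_w (f n w * Y w)) @ \oo --> \int[P]_w (xi w * Y w).
  apply: cv => n w _; rewrite !normrM ler_wpM2r//.
  by rewrite (le_trans (f_le n w))// ler_norm.
have cv0 : (fun n => \int[P]_w (f n w * Y w)) @ \oo --> (0 : R).
  by under eq_fun do rewrite fY0; exact: cvg_cst.
exact: (cvg_unique _ cv cv0).
Unshelve. all: by end_near. Qed.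

(** The defining property of conditional expectation, extended from events to
    multipliers: this replaces conditional expectations throughout. *)
Lemma orthogonal_wrt (G : set (set Omega)) (Y xi : Omega -> R) :
  sigma_algebra setT G -> G `<=` measurable ->
  integrableR P setT Y ->
  (forall A, G A -> \int[P]_(w in A) Y w = 0) ->
  measurable_wrt G xi ->
  integrableR P setT (fun w => xi w * Y w) ->
  \int[P]_w (xi w * Y w) = 0.
Proof.
move=> sG GM iY Y0 mxi ixiY; have mY := integrableR_measurable iY.
have mp : measurable_wrt G (fun w => Num.max (xi w) 0).
  exact: (measurable_funrpos mxi).
have mn : measurable_wrt G (fun w => Num.max (- xi w) 0).
  exact: (measurable_funrneg mxi).
have ip : integrableR P setT (fun w => Num.max (xi w) 0 * Y w).
  apply: (le_integrableR measurableT (integrableR_norm ixiY)).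
    by apply: measurable_funM => //; exact: (measurable_wrt_measurable GM).
  move=> w _; rewrite !normrM ler_wpM2r// ger0_norm ?le_max ?lexx ?orbT//.
  by rewrite ge_max ler_norm normr_ge0.
have in_ : integrableR P setT (fun w => Num.max (- xi w) 0 * Y w).
  apply: (le_integrableR measurableT (integrableR_norm ixiY)).
    by apply: measurable_funM => //; exact: (measurable_wrt_measurable GM).
  move=> w _; rewrite !normrM ler_wpM2r// ger0_norm ?le_max ?lexx ?orbT//.
  by rewrite ge_max -[`|xi w|]normrN ler_norm normr_ge0.
have E w : xi w * Y w = Num.max (xi w) 0 * Y w - Num.max (- xi w) 0 * Y w.
  rewrite -mulrBl; congr (_ * _).
  by have [h|/ltW h] := leP 0 (xi w); rewrite ?(max_l h) ?(max_r h);
    [rewrite max_r ?oppr_le0// subr0|rewrite max_l ?oppr_ge0// sub0r opprK].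
under eq_Rintegral do rewrite E.
have max0 (x : R) : 0 <= Num.max x 0 by rewrite le_max lexx orbT.
by rewrite RintegralB// (orthogonal_ge0 sG GM iY Y0 mp)// (orthogonal_ge0 sG GM iY Y0 mn)// subr0.
Qed.

End SubSigmaAlgebra.

Section EventLaw.
Context (R : realType) d (Omega : measurableType d).
Variable P : probability Omega R.

Lemma ge0_integral_mrestr (A : set Omega) (mA : measurable A) (g : Omega -> \bar R) :
  measurable_fun setT g -> (forall w, 0 <= g w)%E ->
  (\int[mrestr P mA]_w g w = \int[P]_(w in A) g w)%E.
Proof.
move=> mg g0; rewrite -(setUv A) ge0_integral_setU//=; last 3 first.
- exact: measurableC.
- exact: measurable_funTS.
- by apply/disj_setPCl.
rewrite (_ : \int[mrestr P mA]_(x in ~` A) g x = 0)%E ?adde0; last first.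
  rewrite (@eq_measure_integral _ _ _ (~` A) mzero) ?integral_measure_zero//.
  move=> B mB BA; have BA0 : B `&` A = set0 by exact/disjoints_subset.
  by rewrite /= /mrestr /mzero BA0 measure0.
by apply: eq_measure_integral => B mB BA; rewrite /= /mrestr setIidl.
Qed.

(** If, on the event [A], the random variable [x] has a multiple of the law
    [N], integrals over [A] are computed under [N]. *)
Lemma Rintegral_event_law (A : set Omega) (x : Omega -> R) (c : R)
    (N : probability (measurableTypeR R) R) (f : R -> R) :
  measurable A -> measurable_fun setT x -> 0 <= c ->
  (forall B, measurable B -> P (A `&` x @^-1` B) = (c%:E * N B)%E) ->
  measurable_fun setT f -> integrableR N setT f ->
  integrableR P A (f \o x) /\
  \int[P]_(w in A) f (x w) = c * \int[N]_y f y.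
Proof.
move=> mA mx c0 law mf iNf.
have mx' : measurable_fun setT (x : Omega -> measurableTypeR R) by exact: mx.
have ge0 (g : measurableTypeR R -> \bar R) : measurable_fun setT g ->
    (forall y, 0 <= g y)%E ->
    (\int[P]_(w in A) g (x w) = c%:E * \int[N]_y g y)%E.
  move=> mg g0.
  rewrite -(ge0_integral_mrestr mA (measurableT_comp mg mx') (fun w => g0 (x w))).
  rewrite -(ge0_integral_pushforward mx' (mrestr P mA) measurableT mg)//.
  pose c' := NngNum c0.
  transitivity (\int[mscale c' N]_y g y)%E; last exact: ge0_integral_mscale.
  apply: eq_measure_integral => B mB _; have := law B mB.
  by rewrite setIC.
have ifx : integrableR P A (f \o x).
  apply/integrableP; split.
    by apply/measurable_EFinP; apply: measurable_funTS; exact: measurableT_comp.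
  rewrite (ge0 (fun y => `|(f y)%:E|%E))//; last first.
    by apply: measurableT_comp => //; exact/measurable_EFinP.
  by have /integrableP[_ h] := iNf; apply: lte_mul_pinfty.
split => //; apply: EFin_inj.
rewrite EFinM !EFin_Rintegral// integralE [X in _ = (_ * X)%E]integralE.
have mpos : measurable_fun setT (EFin \o f)^\+%E.
  by apply: measurable_funepos; exact/measurable_EFinP.
have mneg : measurable_fun setT (EFin \o f)^\-%E.
  by apply: measurable_funeneg; exact/measurable_EFinP.
have hp := ge0 _ mpos (fun y => funepos_ge0 _ _).
have hn := ge0 _ mneg (fun y => funeneg_ge0 _ _).
rewrite muleBr//; last first.
  rewrite fin_num_adde_defr//.
  by apply: integrable_pos_fin_num.
congr (_ - _)%E.
- by rewrite -hp; apply: eq_integral => w _; rewrite !funeposE.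
- by rewrite -hn; apply: eq_integral => w _; rewrite !funenegE.
Qed.

End EventLaw.

(** * Increments of Brownian motion *)

Section Filtrations.
Context (R : realType) d (Omega : measurableType d) (P : probability Omega R).
Variable F : R -> set (set Omega).
Hypothesis nF : normal_filtration P F.

Lemma filtration_sigma t : 0 <= t -> sigma_algebra setT (F t).
Proof. by case: nF => h _ _ _ /h[]. Qed.

Lemma filtration_measurable t : 0 <= t -> F t `<=` measurable.
Proof. by case: nF => h _ _ _ /h[]. Qed.

Lemma filtration_le t u : 0 <= t -> t <= u -> F t `<=` F u.
Proof. by case: nF => _ h _ _; exact: h. Qed.

Lemma F_measurable_coord t p q (f : Omega -> 'M[R]_(p, q)) i j : 0 <= t ->
  F_measurable F t f -> measurable_wrt (F t) (fun w => f w i j).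
Proof.
move=> t0 mf; apply/(measurable_wrtP _ (filtration_sigma t0)) => B mB.
rewrite (_ : _ @^-1` B = f @^-1` ((fun A : 'M[R]_(p, q) => A i j) @^-1` B))//.
apply: mf; rewrite -[X in measurable X]setTI; exact: measurable_coord.
Qed.

Lemma coord_F_measurable t p q (f : Omega -> 'M[R]_(p, q)) : 0 <= t ->
  (forall i j, measurable_wrt (F t) (fun w => f w i j)) -> F_measurable F t f.
Proof.
move=> t0 mf B mB; pose T' : measurableType _ := g_sigma_algebraType (F t).
have h := @measurable_mxP R p q _ T' setT f measurableT mf.
have := h measurableT B mB; rewrite setTI.
by rewrite {1}/measurable /= sigma_algebra_id//; exact: filtration_sigma.
Qed.

Lemma F_measurable_fun t p q (f : Omega -> 'M[R]_(p, q)) : 0 <= t ->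
  F_measurable F t f -> measurable_fun setT f.
Proof.
move=> t0 mf _ B mB; rewrite setTI; apply: (filtration_measurable t0); exact: mf.
Qed.

Lemma F_measurableS t u p q (f : Omega -> 'M[R]_(p, q)) : 0 <= t -> t <= u ->
  F_measurable F t f -> F_measurable F u f.
Proof. by move=> t0 tu mf B mB; apply: (filtration_le t0 tu); exact: mf. Qed.

End Filtrations.

Section BrownianIncrements.
Context (R : realType) (m : nat) d (Omega : measurableType d) (P : probability Omega R).
Variables (F : R -> set (set Omega)) (W : R -> Omega -> 'rV[R]_m).
Hypotheses (nF : normal_filtration P F) (bW : brownian_motion P F W).
Variables u t : R.
Hypotheses (u0 : 0 <= u) (ut : u < t).

Let t0 : 0 <= t. Proof. by rewrite (le_trans u0)// ltW. Qed.
Let s : R := Num.sqrt (t - u).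
Let s0 : 0 < s. Proof. by rewrite sqrtr_gt0 subr_gt0. Qed.
Let s2 : s ^+ 2 = t - u. Proof. by rewrite sqr_sqrtr// subr_ge0 ltW. Qed.
Let N : probability (measurableTypeR R) R := normal_prob 0 s.

Definition increment (j : 'I_m) (w : Omega) : R := W t w 0 j - W u w 0 j.

Lemma measurable_increment j : measurable_fun setT (increment j).
Proof.
have [_ _ mW _] := bW.
by apply: measurable_funB; apply: measurable_fun_coord;
  apply: (F_measurable_fun nF) (mW _ _).
Qed.

Let NT : (N setT = 1)%E. Proof. exact: probability_setT. Qed.

Lemma increment_event1 D j B : F u D -> measurable B ->
  P (D `&` increment j @^-1` B) = (P D * N B)%E.
Proof.
move=> FD mB; have [_ _ _ ind] := bW.
have := ind u t u0 ut D (fun k => if k == j then B else setT) FD.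
rewrite (_ : [set w | _] = increment j @^-1` B); last first.
  apply/seteqP; split => w /=; first by move=> /(_ j); rewrite eqxx.
  by move=> h k; case: eqP => [->|].
move=> ->; last by move=> k; case: eqP.
congr (_ * _)%E; rewrite (bigD1 j)//= eqxx big1 ?mule1// => k /negbTE ->.
exact: NT.
Qed.

Lemma increment_event2 D j l B C : F u D -> j != l -> measurable B -> measurable C ->
  P (D `&` increment l @^-1` C `&` increment j @^-1` B) = (P D * N C * N B)%E.
Proof.
move=> FD jl mB mC; have [_ _ _ ind] := bW.
have := ind u t u0 ut D (fun k => if k == j then B else if k == l then C else setT) FD.
rewrite (_ : [set w | _] = increment l @^-1` C `&` increment j @^-1` B); last first.
  apply/seteqP; split => w /=.
    by move=> h; split; [have := h l; rewrite eq_sym (negbTE jl) eqxx|have := h j; rewrite eqxx].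
  by move=> [h1 h2] k; case: eqP => [->//|_]; case: eqP => [->|].
rewrite setIA => ->; last by move=> k; case: eqP => // _; case: eqP.
rewrite -muleA; congr (_ * _)%E; rewrite (bigD1 l)//= eq_sym (negbTE jl) eqxx.
rewrite (bigD1 j)//= eqxx big1 ?mule1// => k /andP[/negbTE kl /negbTE ->].
by rewrite kl; exact: NT.
Qed.

Let mpow k : measurable_fun setT (fun x : R => x ^+ k).
Proof. by apply: (measurable_funX k); exact: measurable_id. Qed.

Let iN k : (k <= 3)%N -> integrableR N setT (fun x => x ^+ k).
Proof.
move=> k3; apply: integrable_normal_prob; first exact: mpow.
exact: normal_integrable_pow.
Qed.

Let N1 : \int[N]_x (x : R) = 0.
Proof. by rewrite /Rintegral (normal_first_moment s0). Qed.

Let N2 : \int[N]_x (x ^+ 2 : R) = t - u.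
Proof. by rewrite /Rintegral (normal_second_moment s0) s2. Qed.

Let FT : F u setT.
Proof.
have [h1 h2 _] := filtration_sigma nF u0.
by have := h2 _ h1; rewrite setD0.
Qed.

Let PE D : measurable D -> P D = (fine (P D))%:E.
Proof. by move=> mD; rewrite fineK// fin_num_measure. Qed.

Let event_pow D j k : (k <= 3)%N -> F u D ->
  integrableR P D (fun w => increment j w ^+ k) /\
  \int[P]_(w in D) increment j w ^+ k = fine (P D) * \int[N]_x (x ^+ k).
Proof.
move=> k3 FD; have mD := filtration_measurable nF u0 FD.
apply: (@Rintegral_event_law _ _ _ P D (increment j) (fine (P D)) N (fun x => x ^+ k)) => //.
- exact: measurable_increment.
- exact: fine_ge0.
- by move=> B mB; rewrite -PE// increment_event1.
- exact: iN.
Qed.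

Lemma integrable_increment_pow j k : (k <= 3)%N ->
  integrableR P setT (fun w => increment j w ^+ k).
Proof. by move=> k3; have [] := event_pow j k3 FT. Qed.

Lemma integrable_increment j : integrableR P setT (increment j).
Proof. exact: (integrable_increment_pow j (isT : (1 <= 3)%N)). Qed.

Lemma integrable_increment_mul j l :
  integrableR P setT (fun w => increment j w * increment l w).
Proof.
apply: (le_integrableR measurableT (integrableRD measurableT
  (@integrable_increment_pow j 2 isT) (@integrable_increment_pow l 2 isT))).
  by apply: measurable_funM; exact: measurable_increment.
move=> w _; rewrite ler_norml; set x := increment j w; set y := increment l w.
have := sqr_ge0 (x + y); have := sqr_ge0 (x - y).
have := sqr_ge0 x; have := sqr_ge0 y; rewrite !expr2; nra.
Qed.

Lemma increment_mean j (xi : Omega -> R) (K : R) :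
  measurable_wrt (F u) xi -> (forall w, `|xi w| <= K) ->
  \int[P]_w (xi w * increment j w) = 0.
Proof.
move=> mxi xiK; have FM := filtration_measurable nF u0.
apply: (orthogonal_wrt (filtration_sigma nF u0) FM) => //.
- exact: integrable_increment.
- move=> D FD; have [_] := event_pow j (isT : (1 <= 3)%N) FD.
  by move=> ->; rewrite N1 mulr0.
- apply: (@integrableRM _ _ _ P setT K) => //; first exact: integrable_increment.
  exact: measurable_wrt_measurable mxi.
Qed.

Let offdiag_event D j l : j != l -> F u D ->
  \int[P]_(w in D) (increment j w * increment l w) = 0.
Proof.
move=> jl FD; have mD := filtration_measurable nF u0 FD.
pose G := preimage_set_system setT (increment l) measurable.
have sG : sigma_algebra setT G.
  exact: sigma_algebra_preimage (@sigma_algebra_measurable _ _).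
have GM : G `<=` measurable.
  by move=> _ [B mB <-]; exact: measurable_increment.
pose Y := increment j \_ D.
have iY : integrableR P setT Y.
  rewrite /integrableR -restrict_EFin; apply/(integrable_mkcond _ mD).
  by apply: (integrableS measurableT) => //; exact: integrable_increment.
rewrite Rintegral_mkcond.
have E w : ((fun w => increment j w * increment l w) \_ D) w = increment l w * Y w.
  by rewrite /Y !patch_indic /=; ring.
under eq_Rintegral do rewrite E.
apply: (orthogonal_wrt sG GM iY).
- move=> _ [C mC <-]; rewrite setTI -Rintegral_mkcondl.
  have mA : measurable (D `&` increment l @^-1` C).
    apply: measurableI => //; rewrite -[X in measurable X]setTI.
    exact: measurable_increment.
  have c0 : 0 <= fine (P D * N C) by apply: fine_ge0; exact: mule_ge0.
  have law B : measurable B -> P (D `&` increment l @^-1` C `&` increment j @^-1` B)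
      = ((fine (P D * N C))%:E * N B)%E.
    move=> mB; rewrite increment_event2// fineK//.
    by rewrite fin_numM// fin_num_measure.
  have [_ E1] := Rintegral_event_law mA (measurable_increment j) c0 law (mpow 1)
    (iN (isT : (1 <= 3)%N)).
  by rewrite [LHS]E1 [X in _ * X]N1 mulr0.
- apply/(measurable_wrtP _ sG) => B mB; exists B => //; by rewrite setTI.
- have h := integrable_increment_mul j l.
  have : integrableR P setT ((fun w => increment j w * increment l w) \_ D).
    rewrite /integrableR -restrict_EFin; apply/(integrable_mkcond _ mD).
    by apply: (integrableS measurableT) => //.
  by rewrite /integrableR; congr (_.-integrable _ _); apply/funext => w /=; rewrite E.
Qed.

Lemma increment_covariance j l (xi : Omega -> R) (K : R) :
  measurable_wrt (F u) xi -> (forall w, `|xi w| <= K) ->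
  \int[P]_w (xi w * (increment j w * increment l w))
    = (j == l)%:R * (t - u) * \int[P]_w xi w.
Proof.
move=> mxi xiK; have FM := filtration_measurable nF u0.
have mxi' := measurable_wrt_measurable FM mxi.
have ixi : integrableR P setT xi.
  by apply: (le_integrableR measurableT (finite_measure_integrable_cst P K measurableT)).
have imul f : integrableR P setT f -> integrableR P setT (fun w => xi w * f w).
  by move=> fi; apply: (@integrableRM _ _ _ P setT K).
have [<-|jl] := eqVneq j l; last first.
  rewrite !mul0r; apply: (orthogonal_wrt (filtration_sigma nF u0) FM) => //.
  - exact: integrable_increment_mul.
  - by move=> D FD; exact: offdiag_event.
  - by apply: imul; exact: integrable_increment_mul.
have i2 := @integrable_increment_pow j 2 isT.
have ic : integrableR P setT (fun _ => t - u).
  exact: finite_measure_integrable_cst.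
have iY := integrableRB measurableT i2 ic.
have : \int[P]_w (xi w * (increment j w ^+ 2 - (t - u))) = 0.
  apply: (orthogonal_wrt (filtration_sigma nF u0) FM) => //; last exact: imul.
  move=> D FD; have mD := FM _ FD.
  have iS f : integrableR P setT f -> integrableR P D f.
    exact: integrableRS.
  rewrite RintegralB//; [|exact: iS|exact: iS].
  have [_ ->] := event_pow j (isT : (2 <= 3)%N) FD.
  by rewrite N2 Rintegral_cst// mulrC subrr.
under eq_Rintegral do rewrite mulrBr.
rewrite RintegralB//; [|exact: imul|exact: imul].
move=> /eqP; rewrite subr_eq0 => /eqP h.
by rewrite mul1r [RHS]mulrC -RintegralZr.
Qed.

Lemma increment_cube j : \int[P]_w (`|increment j w| ^+ 3) <= cube_const R * s ^+ 3.
Proof.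
have law B : measurable B -> P (setT `&` increment j @^-1` B) = (1%:E * N B)%E.
  by move=> mB; rewrite increment_event1// probability_setT.
have mc : measurable_fun setT (fun x : R => `|x| ^+ 3).
  by apply: measurable_funX; exact: normr_measurable.
have iNc : integrableR N setT (fun x => `|x| ^+ 3).
  have := integrableR_norm (iN (isT : (3 <= 3)%N)).
  by rewrite /integrableR; congr (_.-integrable _ _); apply/funext => x /=; rewrite normrX.
have [_ ->] := Rintegral_event_law measurableT (measurable_increment j) ler01 law mc iNc.
rewrite mul1r -lee_fin EFin_Rintegral//; exact: normal_cube_moment.
Qed.

Lemma integrable_increment_cube j : integrableR P setT (fun w => `|increment j w| ^+ 3).
Proof.
have := integrableR_norm (@integrable_increment_pow j 3 isT).
by rewrite /integrableR; congr (_.-integrable _ _); apply/funext => x /=; rewrite normrX.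
Qed.

End BrownianIncrements.

(** * Processes on a time interval as functions on a product space *)

Section StepTimes.
Context (R : realType).

(** The left end point of the cell of [p + delta * Z] that contains [r], the
    cells being open on the left. *)
Definition step_time (p delta r : R) : R :=
  p + delta * (Num.ceil ((r - p) / delta) - 1)%:~R.

Lemma step_time_itv (p delta r : R) : 0 < delta ->
  step_time p delta r < r <= step_time p delta r + delta.
Proof.
move=> d0; have /andP[h1 h2] := ceil_itv ((r - p) / delta).
rewrite /step_time; move: h1 h2; rewrite intrB.
set c := (Num.ceil _)%:~R; rewrite ltr_pdivlMr// ler_pdivrMr// => h1 h2.
by apply/andP; split; lra.
Qed.

Lemma step_time_eq (p delta r : R) (k : nat) : 0 < delta ->
  p + delta * k%:R < r <= p + delta * k.+1%:R ->
  step_time p delta r = p + delta * k%:R.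
Proof.
move=> d0 /andP[h1 h2]; rewrite /step_time.
rewrite (_ : Num.ceil ((r - p) / delta) = Posz k.+1); last first.
  apply: ceil_def; rewrite ltr_pdivlMr// ler_pdivrMr//.
  rewrite intrB -!pmulrn -[k.+1]addn1 natrD in h2 *.
  by apply/andP; split; lra.
by rewrite intrB -!pmulrn -[k.+1]addn1 natrD addrK.
Qed.

Lemma step_time_cvg (p r : R) (delta : nat -> R) :
  (forall n, 0 < delta n) -> delta @ \oo --> (0 : R) ->
  (fun n => step_time p (delta n) r) @ \oo --> r /\
  (fun n => step_time p (delta n) r + delta n) @ \oo --> r.
Proof.
move=> d0 dcv.
have cvm : (fun n => r - delta n) @ \oo --> r.
  by rewrite -[X in _ --> X]subr0; apply: cvgB => //; exact: cvg_cst.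
have cvp : (fun n => r + delta n) @ \oo --> r.
  by rewrite -[X in _ --> X]addr0; apply: cvgD => //; exact: cvg_cst.
split.
  apply: (squeeze_cvgr _ cvm (cvg_cst r)); apply: nearW => n.
  by have := step_time_itv p r (d0 n); lra.
apply: (squeeze_cvgr _ (cvg_cst r) cvp); apply: nearW => n.
by have := step_time_itv p r (d0 n); lra.
Qed.

End StepTimes.

Lemma continuous_clamp (R : realType) (T : topologicalType) (s : R) (f : R -> T) :
  {within `[s, +oo[, continuous f} -> continuous (fun r => f (Num.max s r)).
Proof.
move=> /subspace_continuousP cf r; have sr : s <= Num.max s r by rewrite le_max lexx.
have cmax : (fun r : R => Num.max s r) @ nbhs r --> Num.max s r.
  exact: (@continuous_max _ _ (cst s) id r (cvg_cst _) cvg_id).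
have sI : `[s, +oo[%classic (Num.max s r) by rewrite /= in_itv/= sr.
move=> A /= /(cf _ sI) nA.
apply: (@filterS _ (nbhs r) _ _ _ _ (cmax _ nA)) => r' /=; apply.
by rewrite in_itv/= andbT le_max lexx.
Qed.

Section JointMeasurability.
Context (R : realType) d (Omega : measurableType d).
Local Notation RT := (measurableTypeR R).

Lemma measurable_step_process (Y : R -> Omega -> R) (p delta : R) : 0 < delta ->
  (forall r, measurable_fun setT (Y r)) ->
  measurable_fun setT (fun z : RT * Omega => Y (step_time p delta z.1) z.2).
Proof.
move=> d0 mY _ B mB; rewrite setTI.
rewrite (_ : _ @^-1` B = \bigcup_(k : int)
   ((`](p + delta * (k - 1)%:~R), (p + delta * k%:~R)]%classic : set RT)
     `*` (Y (p + delta * (k - 1)%:~R) @^-1` B))); last first.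
  apply/seteqP; split => [[r w] /= Bw|[r w] [k _ [/= rk Bw]]].
    exists (Num.ceil ((r - p) / delta)) => //; split => //=.
    have := step_time_itv p r d0; rewrite /step_time in_itv/=.
    by rewrite intrB mulrBr mulr1 addrA subrK.
  rewrite /step_time (@ceil_def _ _ k)//.
  move: rk; rewrite in_itv/= => /andP[h1 h2].
  by rewrite ltr_pdivlMr// ler_pdivrMr//; apply/andP; split; lra.
apply: countable_bigcupT_measurable => [|k]; first exact: countableP.
apply: measurableX; first exact: measurable_itv.
by rewrite -[X in measurable X]setTI; exact: mY.
Qed.

Lemma natSinv_cvg0 : (fun n : nat => (n.+1%:R^-1 : R)) @ \oo --> (0 : R).
Proof. exact: cvg_harmonic. Qed.

(** A continuous process is the limit of its piecewise constant
    discretizations. *)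
Lemma measurable_process (Y : R -> Omega -> R) :
  (forall r, measurable_fun setT (Y r)) ->
  (forall w, continuous (Y ^~ w)) ->
  measurable_fun setT (fun z : RT * Omega => Y z.1 z.2).
Proof.
move=> mY cY; pose delta n : R := n.+1%:R^-1.
have d0 n : 0 < delta n by rewrite invr_gt0.
apply: (measurable_fun_cvg (fun n => measurable_step_process 0 (d0 n) mY)).
move=> [r w] _ /=.
have [h _] := step_time_cvg 0 r d0 natSinv_cvg0.
by apply: (@continuous_cvg _ _ _ _ _ _ (Y ^~ w) r) h; exact: cY.
Qed.

End JointMeasurability.

Notation time_measure P := (lebesgue_measure \x P)%E.

Section TimeSpace.
Context (R : realType) d (Omega : measurableType d) (P : probability Omega R).
Local Notation RT := (measurableTypeR R).
Local Notation mu := (@lebesgue_measure R).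

Local Notation M := (time_measure P).

Definition strip (a b : R) : set (RT * Omega) :=
  (`]a, b]%classic : set RT) `*` [set: Omega].

Lemma measurable_strip a b : measurable (strip a b).
Proof. by apply: measurableX; [exact: measurable_itv|exact: measurableT]. Qed.
Hint Resolve measurable_strip : core.

Lemma time_measure_strip a b : a <= b -> M (strip a b) = (b - a)%:E.
Proof.
move=> ab; have mI : measurable (`]a, b]%classic : set RT) by exact: measurable_itv.
have -> : M (strip a b) = (mu `]a, b]%classic * P setT)%E.
  by rewrite /strip product_measure1E.
rewrite probability_setT mule1 lebesgue_measure_itv/= lte_fin EFinN -EFinB.
by case: ltgtP ab => // -> _; rewrite subrr.
Qed.

Lemma integrable_strip_bounded a b (K : R) (f : RT * Omega -> R) : a <= b ->
  measurable_fun setT f -> (forall z, strip a b z -> `|f z| <= K) ->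
  integrableR M (strip a b) f.
Proof.
move=> ab mf fK; have h : (M (strip a b) < +oo)%E.
  by rewrite time_measure_strip// ltry.
apply: measurable_bounded_integrable => //.
- exact: measurable_funTS.
- exists K; split; first exact: num_real.
  by move=> x Kx z Dz; exact: (le_trans (fK z Dz) (ltW Kx)).
Qed.

Lemma Rintegral_strip_setU a b c (f : RT * Omega -> R) : a <= b -> b <= c ->
  integrableR M (strip a c) f ->
  \int[M]_(z in strip a c) f z
    = \int[M]_(z in strip a b) f z + \int[M]_(z in strip b c) f z.
Proof.
move=> ab bc fi; have E : strip a c = strip a b `|` strip b c.
  apply/seteqP; split => [[r w] [/= + _]|[r w] [[/= + _]|[/= + _]]];
    rewrite !in_itv/= => /andP[h1 h2].
  - by have [rb|br] := leP r b; [left|right]; split => //=; rewrite in_itv/= ?h1 ?rb ?br.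
  - by split => //=; rewrite in_itv/= h1 (le_trans h2).
  - by split => //=; rewrite in_itv/= h2 (le_lt_trans ab).
rewrite E Rintegral_setU// -?E//; apply/disj_setPS => -[r w] [[/= + _] [/= + _]].
by rewrite !in_itv/= => /andP[_ h2] /andP[h3 _]; move: (lt_le_trans h3 h2); rewrite ltxx.
Qed.

Lemma strip_subset a b a' b' : a' <= a -> b <= b' -> strip a b `<=` strip a' b'.
Proof.
move=> h1 h2 [r w] [/=]; rewrite !in_itv/= => /andP[h3 h4] _; split => //=.
by rewrite in_itv/= (le_lt_trans h1)// (le_trans h4).
Qed.

Lemma integrable_stripS a b a' b' (f : RT * Omega -> R) : a' <= a -> b <= b' ->
  integrableR M (strip a' b') f -> integrableR M (strip a b) f.
Proof. by move=> h1 h2; apply: integrableRS => //; exact: strip_subset. Qed.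

Let restrE a b (f : RT * Omega -> R) r w :
  (f \_ (strip a b)) (r, w) = ((fun r => f (r, w)) \_ (`]a, b]%classic : set RT)) r.
Proof.
rewrite !patchE; congr (if _ then _ else _); apply/idP/idP; rewrite !inE => //.
by case.
Qed.

Let restr_in a b (f : RT * Omega -> R) r w : r \in (`]a, b]%classic : set RT) ->
  (f \_ (strip a b)) (r, w) = f (r, w).
Proof. by move=> h; rewrite restrE patchE h. Qed.

Let restr_out a b (f : RT * Omega -> R) r w : r \notin (`]a, b]%classic : set RT) ->
  (f \_ (strip a b)) (r, w) = 0.
Proof. by move=> h; rewrite restrE patchE (negbTE h). Qed.

Let integrable_restr a b (f : RT * Omega -> R) : integrableR M (strip a b) f ->
  M.-integrable setT (EFin \o (f \_ (strip a b))).
Proof. by move=> fi; rewrite -restrict_EFin; exact/(integrable_mkcond _ (measurable_strip a b)). Qed.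

Lemma integrable_strip_setU a b c (f : RT * Omega -> R) :
  integrableR M (strip a b) f -> integrableR M (strip b c) f ->
  integrableR M (strip a c) f.
Proof.
move=> i1 i2.
have sub : strip a c `<=` strip a b `|` strip b c.
  move=> [r w] [/= + _]; rewrite in_itv/= => /andP[h1 h2].
  by have [rb|br] := leP r b; [left|right]; split => //=; rewrite in_itv/= ?h1 ?h2 ?rb ?br.
have mU : measurable (strip a b `|` strip b c).
  by apply: measurableU; exact: measurable_strip.
have mf : measurable_fun (strip a c) f.
  apply: (measurable_funS mU sub).
  apply: (measurable_funU f (measurable_strip a b) (measurable_strip b c)).2.
  by split; [exact: integrableR_measurable i1|exact: integrableR_measurable i2].
have ig := integrableRD measurableT (integrableR_norm (integrable_restr i1))
  (integrableR_norm (integrable_restr i2)).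
apply: (le_integrableR (measurable_strip a c) (integrableRS measurableT
  (measurable_strip a c) (@subsetT _ _) ig) mf) => z /sub[zS|zS].
- by rewrite [X in _ <= `|X| + _]patchE mem_set// lerDl.
- by rewrite [X in _ <= _ + `|X|]patchE mem_set// lerDr.
Qed.

Lemma strip_integrable_crit a b (f : RT * Omega -> R) : measurable_fun setT f ->
  (\int[mu]_(r in `]a, b]) \int[P]_w `|f (r, w)|%:E < +oo)%E ->
  integrableR M (strip a b) f.
Proof.
move=> mf fin; apply/(integrable_mkcond _ (measurable_strip a b)).
rewrite restrict_EFin; apply/integrable12ltyP.
  apply/measurable_EFinP; apply/(measurable_restrictT _ (measurable_strip a b)).
  exact: measurable_funTS.
move: fin; rewrite integral_mkcond; congr (_ < _)%E; apply: eq_integral => r _.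
rewrite patchE; case: ifPn => rD.
  by apply: eq_integral => w _; rewrite /comp restr_in.
rewrite -[LHS](@integral0 _ _ _ P setT); apply: eq_integral => w _.
by rewrite /comp restr_out// ?abse0 ?normr0.
Qed.

Lemma strip_integrable_lty a b (f : RT * Omega -> R) :
  integrableR M (strip a b) f ->
  (\int[mu]_(r in `]a, b]) \int[P]_w `|f (r, w)|%:E < +oo)%E.
Proof.
move=> /integrable_restr fi; have mf := measurable_int _ fi.
have := (integrable12ltyP _ _ mf).1 fi.
rewrite [X in _ -> (X < _)%E]integral_mkcond; congr (_ < _)%E; apply: eq_integral => r _.
rewrite patchE; case: ifPn => rD.
  by apply: eq_integral => w _; rewrite /comp restr_in.
rewrite -[RHS](@integral0 _ _ _ P setT); apply: eq_integral => w _.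
by rewrite /comp restr_out// ?abse0 ?normr0.
Qed.

Lemma strip_integrable_ae a b (f : RT * Omega -> R) :
  integrableR M (strip a b) f ->
  {ae P, forall w, integrableR mu (`]a, b]%classic : set RT) (fun r => f (r, w))}.
Proof.
move=> /integrable_restr fi; have := ae_integrable2 fi.
have mI : measurable (`]a, b]%classic : set RT) by exact: measurable_itv.
apply: filterS => w h; apply/(integrable_mkcond _ mI).
rewrite restrict_EFin; move: h; congr (_.-integrable _ _).
by apply/funext => r; rewrite /= restrE.
Qed.

Let strip_section a b (f : RT * Omega -> R) w :
  (\int[mu]_r ((f \_ (strip a b)) (r, w))%:E
     = \int[mu]_(r in `]a, b]) (f (r, w))%:E)%E.
Proof.
rewrite [RHS]integral_mkcond; apply: eq_integral => r _.
by rewrite restrE !patchE; case: ifP.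
Qed.

Let integrable_fubini_G (g : RT * Omega -> \bar R) :
  M.-integrable setT g -> P.-integrable setT (fubini_G mu g).
Proof.
move=> gi; have mg := measurable_int _ gi; apply/integrableP; split.
  exact: (measurable_fubini_G gi).
apply: le_lt_trans ((integrable21ltyP _ _ mg).1 gi).
apply: ge0_le_integral => //.
- by apply: measurableT_comp => //; exact: (measurable_fubini_G gi).
- apply: (@measurable_fun_fubini_tonelli_G _ _ _ _ _ mu (abse \o g)) => //=.
  exact: measurableT_comp.
- move=> w _; apply: le_abse_integral => //; apply: measurableT_comp => //.
Qed.

Lemma integrable_time_integral a b (f : RT * Omega -> R) :
  integrableR M (strip a b) f ->
  integrableR P setT (fun w => \int[mu]_(r in `]a, b]) f (r, w)).
Proof.
move=> fi; have gi := integrable_restr fi.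
have iG := integrable_fubini_G gi; have ae := strip_integrable_ae fi.
pose G := fubini_G mu (EFin \o (f \_ (strip a b))).
have E : (fun w => \int[mu]_(r in `]a, b]) f (r, w)) = fine \o G.
  by apply/funext => w; rewrite /G /fubini_G /= strip_section.
have mfG : measurable_fun setT (EFin \o (fine \o G)).
  apply/measurable_EFinP; apply: measurableT_comp => //.
  exact: measurable_int iG.
rewrite /integrableR E; apply: (le_integrable measurableT mfG _ iG) => w _ /=.
by rewrite -/G; case: (G w) => [x| |] //=; rewrite normr0 leey.
Qed.

Lemma Rintegral_strip_Pr a b (f : RT * Omega -> R) :
  integrableR M (strip a b) f ->
  \int[M]_(z in strip a b) f z = \int[P]_w \int[mu]_(r in `]a, b]) f (r, w).
Proof.
move=> fi; have gi := integrable_restr fi.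
apply: EFin_inj; rewrite !EFin_Rintegral//; last exact: integrable_time_integral.
rewrite integral_mkcond; under eq_integral do rewrite restrict_EFin.
rewrite -[LHS](integral21_prod_meas1 gi) /fubini_G.
apply: ae_eq_integral => //.
- exact: measurable_int (integrable_fubini_G gi).
- exact: measurable_int (integrable_time_integral fi).
- have := strip_integrable_ae fi; apply: filterS => w wi _ /=.
  rewrite strip_section EFin_Rintegral//; exact: measurable_itv.
Qed.

Lemma Rintegral_strip_time a b (f : RT * Omega -> R) :
  integrableR M (strip a b) f ->
  (\int[M]_(z in strip a b) f z)%:E =
    (\int[mu]_(r in `]a, b]) \int[P]_w (f (r, w))%:E)%E.
Proof.
move=> fi; have gi := integrable_restr fi.
rewrite !EFin_Rintegral//.
rewrite integral_mkcond; under eq_integral do rewrite restrict_EFin.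
rewrite -[LHS](integral12_prod_meas1 gi) /fubini_F [RHS]integral_mkcond.
apply: eq_integral => r _; rewrite [RHS]patchE; case: ifPn => rD.
  by apply: eq_integral => w _; rewrite /comp restr_in.
rewrite -[RHS](@integral0 _ _ _ P setT); apply: eq_integral => w _.
by rewrite /comp restr_out.
Qed.

Lemma ge0_integral_strip a b (f : RT * Omega -> R) : measurable_fun setT f ->
  (forall z, 0 <= f z) ->
  (\int[M]_(z in strip a b) (f z)%:E
     = \int[P]_w \int[mu]_(r in `]a, b]) (f (r, w))%:E)%E.
Proof.
move=> mf f0; rewrite integral_mkcond; under eq_integral do rewrite restrict_EFin.
rewrite fubini_tonelli2 /=.
- by apply: eq_integral => w _; rewrite /fubini_G strip_section.
- apply/measurable_EFinP; apply/(measurable_restrictT _ (measurable_strip a b)).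
  exact: measurable_funTS.
- by move=> z; rewrite /= lee_fin patchE; case: ifP.
Qed.

(** A multiplier that does not depend on time enters the time integral. *)
Lemma Rintegral_strip_mul a b (xi : Omega -> R) (K : R) (f : RT * Omega -> R) :
  measurable_fun setT xi -> (forall w, `|xi w| <= K) ->
  integrableR M (strip a b) f ->
  integrableR M (strip a b) (fun z => xi z.2 * f z) /\
  \int[M]_(z in strip a b) (xi z.2 * f z)
    = \int[P]_w (xi w * \int[mu]_(r in `]a, b]) f (r, w)).
Proof.
move=> mxi xiK fi.
have mxi2 : measurable_fun setT (fun z : RT * Omega => xi z.2).
  by apply: (measurableT_comp mxi); exact: measurable_snd.
have xfi : integrableR M (strip a b) (fun z => xi z.2 * f z).
  by apply: (@integrableRM _ _ _ M _ K) => //; exact: measurable_funTS.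
split => //; rewrite Rintegral_strip_Pr//.
have h1 := integrable_time_integral xfi.
have h2 : integrableR P setT (fun w => xi w * \int[mu]_(r in `]a, b]) f (r, w)).
  by apply: (@integrableRM _ _ _ P _ K) => //; exact: integrable_time_integral.
apply: EFin_inj; rewrite (EFin_Rintegral measurableT h1) (EFin_Rintegral measurableT h2).
apply: ae_eq_integral => //.
- exact: measurable_int (integrable_time_integral xfi).
- apply/measurable_EFinP; apply: measurable_funM => //.
  exact: integrableR_measurable (integrable_time_integral fi).
- have := strip_integrable_ae fi; apply: filterS => w wi _ /=.
  by rewrite RintegralZl//; exact: measurable_itv.
Qed.

End TimeSpace.
#[global] Hint Resolve measurable_strip : core.

(** * The weak Ito formula for a constant diffusion coefficient *)

Section AdaptedReal.
Context (R : realType) d (Omega : measurableType d) (P : probability Omega R).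
Variable F : R -> set (set Omega).

Lemma measurable_wrt_comp t p q (f : Omega -> 'M[R]_(p, q)) (g : 'M[R]_(p, q) -> R) :
  continuous g -> F_measurable F t f -> measurable_wrt (F t) (g \o f).
Proof.
move=> cg mf _ B mB; rewrite setTI; apply: sub_sigma_algebra.
rewrite comp_preimage; apply: mf; rewrite -[X in measurable X]setTI.
exact: continuous_measurable_mx.
Qed.

Lemma measurable_wrtM (G : set (set Omega)) (f g : Omega -> R) :
  measurable_wrt G f -> measurable_wrt G g -> measurable_wrt G (fun w => f w * g w).
Proof. by move=> mf mg; exact: measurable_funM mf mg. Qed.

Lemma measurable_wrt_sum (G : set (set Omega)) (I : Type) (s : seq I)
    (f : I -> Omega -> R) : (forall i, measurable_wrt G (f i)) ->
  measurable_wrt G (fun w => \sum_(i <- s) f i w).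
Proof. by move=> mf; exact: measurable_sum. Qed.

End AdaptedReal.

Section ItoStep.
Context (R : realType) (d m : nat) disp (Omega : measurableType disp).
Variables (P : probability Omega R) (F : R -> set (set Omega)).
Variable W : R -> Omega -> 'rV[R]_m.
Hypotheses (nF : normal_filtration P F) (bW : brownian_motion P F W).
Local Notation RT := (measurableTypeR R).
Local Notation M := (time_measure P).
Local Notation mu := (@lebesgue_measure R).
Variables (Y beta : R -> Omega -> 'rV[R]_d) (V : Omega -> 'M[R]_(d, m)).
Variables (h : 'rV[R]_d -> R) (C K : R) (xi : Omega -> R) (a b : R).
Hypotheses (a0 : 0 <= a) (ab : a < b) (K0 : 0 <= K).
Hypotheses (mYa : F_measurable F a (Y a)) (mYb : F_measurable F b (Y b)).
Hypothesis mbeta : forall i, measurable_fun setT (fun z : RT * Omega => beta z.1 z.2 0 i).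
Hypothesis ibeta : forall i, integrableR M (strip a b) (fun z => beta z.1 z.2 0 i).
Hypotheses (mV : F_measurable F a V) (bV : forall w i j, `|V w i j| <= K).
Hypotheses (th : test_function h) (jh : jet_bound h C).
Hypotheses (mxi : measurable_wrt (F a) xi) (bxi : forall w, `|xi w| <= 1).

Let N i w : R := \sum_(j < m) V w i j * increment W a b j w.
Let B i w : R := Y b w 0 i - Y a w 0 i - N i w.

Hypothesis path : {ae P, forall w, forall i,
  B i w = \int[mu]_(r in `]a, b]) beta r w 0 i}.

Definition step_modulus w : R :=
  Num.min 1 (\sum_(i < d) `|N i w| + \sum_(i < d) `|B i w|).

Definition generator_integrand (y : 'rV[R]_d) (be : 'rV[R]_d) (v : 'M[R]_(d, m)) : R :=
  \sum_(i < d) partial i h y * be 0 i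
  + 2^-1 * \sum_(i < d) \sum_(j < d)
      partial i (partial j h) y * (v *m v^T) i j.

Definition cube_step_const : R :=
  (d%:R * K) ^+ 3 * (4 ^+ m * (m%:R * cube_const R)).

Let b0 : 0 <= b. Proof. by rewrite (le_trans a0)// ltW. Qed.
Let C0 : 0 <= C. Proof. exact: jet_ge0 jh. Qed.
Let FM : F a `<=` measurable. Proof. exact: filtration_measurable nF _ a0. Qed.
Let meas (f : Omega -> R) : measurable_wrt (F a) f -> measurable_fun setT f.
Proof. exact: measurable_wrt_measurable. Qed.
Let sh := th.1.
Let ch : continuous h. Proof. by have [] := sh [::]. Qed.
Let ch1 i : continuous (partial i h). Proof. by have [] := sh [:: i]. Qed.
Let ch2 i j : continuous (partial i (partial j h)). Proof. by have [] := sh [:: i; j]. Qed.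
Let mYa' : measurable_fun setT (Y a). Proof. exact: (F_measurable_fun nF a0 mYa). Qed.
Let mYb' : measurable_fun setT (Y b). Proof. exact: (F_measurable_fun nF b0 mYb). Qed.
Let mVc i j : measurable_wrt (F a) (fun w => V w i j).
Proof. exact: (F_measurable_coord nF). Qed.

Let inc := increment W a b.
Let minc j : measurable_fun setT (inc j). Proof. exact: (measurable_increment nF bW a0 ab). Qed.
Let iinc j : integrableR P setT (inc j). Proof. exact: (integrable_increment nF bW a0 ab). Qed.
Let iinc2 j k : integrableR P setT (fun w => inc j w * inc k w).
Proof. exact: (integrable_increment_mul nF bW a0 ab). Qed.

Let x1 i w := xi w * partial i h (Y a w).
Let x2 i j w := xi w * partial i (partial j h) (Y a w).
Let mx1 i : measurable_wrt (F a) (x1 i).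
Proof. by apply: measurable_funM => //; exact: measurable_wrt_comp. Qed.
Let mx2 i j : measurable_wrt (F a) (x2 i j).
Proof. by apply: measurable_funM => //; exact: measurable_wrt_comp. Qed.
Let bx1 i w : `|x1 i w| <= C.
Proof.
rewrite normrM -[leRHS]mul1r ler_pM//; exact: jet_b1.
Qed.
Let bx2 i j w : `|x2 i j w| <= C.
Proof.
rewrite normrM -[leRHS]mul1r ler_pM//; exact: jet_b2.
Qed.

Let bmul (L : R) (f g : Omega -> R) : measurable_fun setT f -> (forall w, `|f w| <= L) ->
  integrableR P setT g -> integrableR P setT (fun w => f w * g w).
Proof. by move=> mf fL gi; apply: (@integrableRM _ _ _ P setT L). Qed.

Let mN i : measurable_fun setT (N i).
Proof.
apply: measurable_sum => j; apply: measurable_funM => //; exact: meas.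
Qed.
Let iN i : integrableR P setT (N i).
Proof.
apply: integrableR_sum => // j.
by apply: (bmul (L := K)) => //; exact: meas.
Qed.

Let NNE i j w : N i w * N j w
  = \sum_(k < m) \sum_(l < m) (V w i k * V w j l) * (inc k w * inc l w).
Proof.
rewrite mulr_suml; apply: eq_bigr => k _; rewrite mulr_sumr.
by apply: eq_bigr => l _; rewrite /inc; ring.
Qed.
Let mVV i j k l : measurable_wrt (F a) (fun w => V w i k * V w j l).
Proof. exact: measurable_wrtM. Qed.
Let bVV i j k l w : `|V w i k * V w j l| <= K * K.
Proof. by rewrite normrM ler_pM// bV. Qed.
Let iNN i j : integrableR P setT (fun w => N i w * N j w).
Proof.
under eq_fun do rewrite NNE.
apply: integrableR_sum => // k; apply: integrableR_sum => // l.
by apply: (bmul (L := K * K)) => //; exact: meas.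
Qed.

Let mB i : measurable_fun setT (B i).
Proof. by apply: measurable_funB => //; apply: measurable_funB; exact: measurable_fun_coord. Qed.
Let pathi i : {ae P, forall w, [set: Omega] w -> B i w = \int[mu]_(r in `]a, b]) beta r w 0 i}.
Proof. by apply: filterS path => w hw _; exact: hw. Qed.
Let iB i : integrableR P setT (B i).
Proof. exact: (ae_integrableR measurableT (mB i) (pathi i) (integrable_time_integral (ibeta i))). Qed.

(** The martingale part has conditional mean zero. *)
Let mean_N i : \int[P]_w (x1 i w * N i w) = 0.
Proof.
have E w : x1 i w * N i w = \sum_(j < m) (x1 i w * V w i j) * inc j w.
  by rewrite mulr_sumr; apply: eq_bigr => j _; rewrite mulrA.
have bm j w : `|x1 i w * V w i j| <= C * K by rewrite normrM ler_pM// ?bx1 ?bV.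
have mm j : measurable_wrt (F a) (fun w => x1 i w * V w i j) by exact: measurable_wrtM.
under eq_Rintegral do rewrite E.
rewrite Rintegral_sum//; last first.
  by move=> j; apply: (bmul (L := C * K)) => //; exact: meas.
apply: big1 => j _; have := increment_mean nF bW a0 ab j (mm j) (bm j); exact.
Qed.

(** Its conditional covariance grows linearly in time. *)
Let cov_N i j : \int[P]_w (x2 i j w * (N i w * N j w))
  = (b - a) * \int[P]_w (x2 i j w * (V w *m (V w)^T) i j).
Proof.
have mm k l : measurable_wrt (F a) (fun w => x2 i j w * (V w i k * V w j l)).
  by apply: measurable_wrtM.
have bm k l w : `|x2 i j w * (V w i k * V w j l)| <= C * (K * K).
  by rewrite normrM ler_pM// ?bx2 ?bVV.
have E w : x2 i j w * (N i w * N j w) =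
    \sum_(k < m) \sum_(l < m) (x2 i j w * (V w i k * V w j l)) * (inc k w * inc l w).
  rewrite NNE mulr_sumr; apply: eq_bigr => k _; rewrite mulr_sumr.
  by apply: eq_bigr => l _; rewrite mulrA.
have E2 w : x2 i j w * (V w *m (V w)^T) i j =
    \sum_(k < m) x2 i j w * (V w i k * V w j k).
  by rewrite mxE mulr_sumr; apply: eq_bigr => k _; rewrite mxE.
under eq_Rintegral do rewrite E.
under [in RHS]eq_Rintegral do rewrite E2.
have ii k l : integrableR P setT (fun w => (x2 i j w * (V w i k * V w j l)) * (inc k w * inc l w)).
  by apply: (bmul (L := C * (K * K))) => //; exact: meas.
rewrite Rintegral_sum//; last by move=> k; exact: integrableR_sum.
rewrite Rintegral_sum//; last first.
  by move=> k; apply: (@bounded_integrableR _ _ _ P (C * (K * K))) => //; exact: meas.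
rewrite mulr_sumr; apply: eq_bigr => k _.
rewrite Rintegral_sum//.
rewrite (bigD1 k)//= big1 ?addr0; last first.
  move=> l lk; rewrite (increment_covariance nF bW a0 ab _ _ (mm k l) (bm k l)).
  by rewrite eq_sym (negbTE lk) !mul0r.
by rewrite (increment_covariance nF bW a0 ab _ _ (mm k k) (bm k k)) eqxx mul1r.
Qed.

Let drift_B i : integrableR M (strip a b) (fun z => x1 i z.2 * beta z.1 z.2 0 i) /\
  \int[P]_w (x1 i w * B i w) = \int[M]_(z in strip a b) (x1 i z.2 * beta z.1 z.2 0 i).
Proof.
have [h1 h2] := Rintegral_strip_mul (meas (mx1 i)) (bx1 i) (ibeta i).
split => //; rewrite [RHS]h2; apply: ae_eq_Rintegral => //.
- by apply: measurable_funM => //; exact: meas.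
- apply: measurable_funM; first exact: meas.
  exact: integrableR_measurable (integrable_time_integral (ibeta i)).
- by apply: filterS (pathi i) => w hw _; rewrite hw.
Qed.

Let mVVT i j : measurable_wrt (F a) (fun w => (V w *m (V w)^T) i j).
Proof.
have -> : (fun w => (V w *m (V w)^T) i j) = (fun w => \sum_(k < m) V w i k * V w j k).
  by apply/funext => w; rewrite mxE; apply: eq_bigr => k _; rewrite mxE.
by apply: measurable_wrt_sum => k; exact: measurable_wrtM.
Qed.

Let bVVT i j w : `|(V w *m (V w)^T) i j| <= m%:R * (K * K).
Proof.
rewrite mxE; apply: le_trans (ler_norm_sum _ _ _) _.
apply: (@le_trans _ _ (\sum_(k < m) K * K)).
  by apply: ler_sum => k _; rewrite mxE bVV.
by rewrite sumr_const card_ord mulr_natl.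
Qed.

Let cov_strip i j :
  integrableR M (strip a b) (fun z => x2 i j z.2 * (V z.2 *m (V z.2)^T) i j) /\
  \int[P]_w (x2 i j w * (N i w * N j w))
  = \int[M]_(z in strip a b) (x2 i j z.2 * (V z.2 *m (V z.2)^T) i j).
Proof.
pose f w := x2 i j w * (V w *m (V w)^T) i j.
have mf : measurable_fun setT f by apply: meas; exact: measurable_wrtM.
have bf w : `|f w| <= C * (m%:R * (K * K)).
  by rewrite normrM ler_pM// ?bx2 ?bVVT.
have i1 : integrableR M (strip a b) (fun _ => 1).
  apply: (@integrable_strip_bounded _ _ _ P a b 1); [exact: ltW|exact: measurable_cst|].
  by move=> z _; rewrite normr1.
have [h1 h2] := Rintegral_strip_mul mf bf i1.
have E : (fun z : RT * Omega => f z.2 * 1) = (fun z => f z.2).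
  by apply/funext => z; rewrite mulr1.
rewrite E in h1; split => //.
rewrite cov_N -[RHS](_ : \int[M]_(z in strip a b) (f z.2 * 1) = _); last first.
  by apply: eq_Rintegral => z _; rewrite mulr1.
have L : \int[mu]_(r in `]a, b]) (1 : R) = b - a.
  rewrite Rintegral_cst; last exact: measurable_itv.
  have E2 : (mu `]a, b]%classic = (b - a)%:E)%E.
    by rewrite lebesgue_measure_itv/= lte_fin ab -EFinB.
  by rewrite mul1r; exact: (congr1 fine E2).
rewrite h2; under [RHS]eq_Rintegral do rewrite L.
by rewrite mulrC RintegralZr//; exact: bounded_integrableR bf.
Qed.

Let mmod : measurable_fun setT step_modulus.
Proof.
apply: measurable_minr => //; apply: measurable_funD; apply: measurable_sum => i;
  by apply: measurableT_comp.
Qed.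
Let mod01 w : 0 <= step_modulus w <= 1.
Proof. by rewrite /step_modulus le_min ler01 ge_min lexx andbT addr_ge0// sumr_ge0. Qed.
Let mod1 w : `|step_modulus w| <= 1.
Proof. by rewrite ger0_norm; case/andP: (mod01 w). Qed.

Lemma integrable_modulus_strip : integrableR M (strip a b)
  (fun z => \sum_(i < d) `|beta z.1 z.2 0 i| * step_modulus z.2).
Proof.
apply: integrableR_sum => [|i]; first exact: measurable_strip.
have [h1 _] := Rintegral_strip_mul mmod mod1 (integrableR_norm (ibeta i)).
by move: h1; rewrite /integrableR; congr (_.-integrable _ _); apply/funext => z /=; rewrite mulrC.
Qed.

Let iBmod i : integrableR P setT (fun w => `|B i w| * step_modulus w).
Proof.
have := bmul mmod mod1 (integrableR_norm (iB i)).
by rewrite /integrableR; congr (_.-integrable _ _); apply/funext => z /=; rewrite mulrC.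
Qed.

Let drift_error : \int[P]_w (\sum_(i < d) `|B i w| * step_modulus w)
  <= \int[M]_(z in strip a b) (\sum_(i < d) `|beta z.1 z.2 0 i| * step_modulus z.2).
Proof.
rewrite Rintegral_sum// Rintegral_sum; first last.
- move=> i; have [h1 _] := Rintegral_strip_mul mmod mod1 (integrableR_norm (ibeta i)).
  by move: h1; rewrite /integrableR; congr (_.-integrable _ _); apply/funext => z /=; rewrite mulrC.
- exact: measurable_strip.
apply: ler_sum => i _.
have [h1 h2] := Rintegral_strip_mul mmod mod1 (integrableR_norm (ibeta i)).
under [leRHS]eq_Rintegral do rewrite mulrC.
rewrite h2; apply: ae_le_Rintegral => //.
  apply: (bmul mmod mod1); exact: integrable_time_integral (integrableR_norm (ibeta i)).
have ae := strip_integrable_ae (ibeta i).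
apply: filterS2 (pathi i) ae => w hw wi _; rewrite hw// mulrC ler_wpM2l//.
  by case/andP: (mod01 w).
by apply: le_normr_Rintegral => //; exact: measurable_itv.
Qed.

Let cube_N : integrableR P setT (fun w => (\sum_(i < d) `|N i w|) ^+ 3) /\
  \int[P]_w ((\sum_(i < d) `|N i w|) ^+ 3) <= cube_step_const * Num.sqrt (b - a) ^+ 3.
Proof.
pose S w := \sum_(j < m) `|inc j w| ^+ 3.
have iS : integrableR P setT S.
  by apply: integrableR_sum => // j; exact: (integrable_increment_cube nF bW a0 ab).
have le w : (\sum_(i < d) `|N i w|) ^+ 3 <= (d%:R * K) ^+ 3 * 4 ^+ m * S w.
  have h1 : \sum_(i < d) `|N i w| <= d%:R * K * \sum_(j < m) `|inc j w|.
    rewrite -mulrA mulr_sumr -[X in X%:R](card_ord d) mulr_natl -sumr_const.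
    apply: ler_sum => i _; apply: le_trans (ler_norm_sum _ _ _) _.
    by apply: ler_sum => j _; rewrite normrM ler_wpM2r// bV.
  have s0 : 0 <= \sum_(i < d) `|N i w| by exact: sumr_ge0.
  apply: (@le_trans _ _ ((d%:R * K * \sum_(j < m) `|inc j w|) ^+ 3)).
    by rewrite lerXn2r ?nnegrE// (le_trans s0).
  have dK : 0 <= d%:R * K by rewrite mulr_ge0.
  rewrite exprMn -mulrA ler_wpM2l ?exprn_ge0//.
  have := cube_sum_le (enum 'I_m) (fun j => normr_ge0 (inc j w)).
  by rewrite !big_enum/= size_enum_ord.
have sN0 w : 0 <= \sum_(i < d) `|N i w| by exact: sumr_ge0.
have mcube : measurable_fun setT (fun w => (\sum_(i < d) `|N i w|) ^+ 3).
  apply: measurable_funX; apply: measurable_sum => i.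
  exact: measurableT_comp.
have icS := integrableRZ ((d%:R * K) ^+ 3 * 4 ^+ m) measurableT iS.
have ic : integrableR P setT (fun w => (\sum_(i < d) `|N i w|) ^+ 3).
  apply: (le_integrableR measurableT icS mcube) => w _.
  by rewrite ger0_norm ?exprn_ge0// le.
split => //; apply: (@le_trans _ _ (\int[P]_w ((d%:R * K) ^+ 3 * 4 ^+ m * S w))).
  exact: le_Rintegral.
rewrite RintegralZl// /cube_step_const.
rewrite -[leRHS](mulrA ((d%:R * K) ^+ 3)) -[leLHS](mulrA ((d%:R * K) ^+ 3)).
rewrite ler_wpM2l ?exprn_ge0 ?mulr_ge0// -[leRHS](mulrA (4 ^+ m)).
rewrite ler_wpM2l ?exprn_ge0// Rintegral_sum//; last first.
  by move=> j; exact: (integrable_increment_cube nF bW a0 ab).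
apply: (@le_trans _ _ (\sum_(j < m) cube_const R * Num.sqrt (b - a) ^+ 3)).
  by apply: ler_sum => j _; exact: (increment_cube nF bW a0 ab).
by rewrite sumr_const card_ord -[leLHS]mulr_natl mulrA.
Qed.

(** Taylor's formula at the left end point: the first order martingale term
    has mean zero, the second order one has mean proportional to the length of
    the step, and the remainder is the displayed error. *)
Lemma ito_step :
  integrableR M (strip a b) (fun z => xi z.2 *
    generator_integrand (Y a z.2) (beta z.1 z.2) (V z.2)) /\
  `| \int[P]_w (xi w * (h (Y b w) - h (Y a w)))
     - \int[M]_(z in strip a b) (xi z.2 *
         generator_integrand (Y a z.2) (beta z.1 z.2) (V z.2)) |
  <= C * \int[M]_(z in strip a b) (\sum_(i < d) `|beta z.1 z.2 0 i| * step_modulus z.2)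
     + C * (cube_step_const * Num.sqrt (b - a) ^+ 3).
Proof.
have iG1 i : integrableR M (strip a b) (fun z => x1 i z.2 * beta z.1 z.2 0 i).
  by have [] := drift_B i.
have iG2 i j : integrableR M (strip a b)
    (fun z => x2 i j z.2 * (V z.2 *m (V z.2)^T) i j).
  by have [] := cov_strip i j.
have mS : measurable (strip a b : set (RT * Omega)) by exact: measurable_strip.
pose G1 (z : RT * Omega) := \sum_(i < d) x1 i z.2 * beta z.1 z.2 0 i.
pose G2 (z : RT * Omega) :=
  \sum_(i < d) \sum_(j < d) x2 i j z.2 * (V z.2 *m (V z.2)^T) i j.
have iG1' : integrableR M (strip a b) G1 by exact: integrableR_sum.
have iG2i i : integrableR M (strip a b)
    (fun z => \sum_(j < d) x2 i j z.2 * (V z.2 *m (V z.2)^T) i j).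
  exact: integrableR_sum.
have iG2' : integrableR M (strip a b) G2 by exact: integrableR_sum.
have iG2h := integrableRZ 2^-1 mS iG2'.
have GE (z : RT * Omega) : xi z.2 * generator_integrand (Y a z.2) (beta z.1 z.2) (V z.2)
    = G1 z + 2^-1 * G2 z.
  rewrite /generator_integrand mulrDr mulr_sumr mulrCA mulr_sumr; congr (_ + _ * _).
    by apply: eq_bigr => i _; rewrite mulrA.
  by apply: eq_bigr => i _; rewrite mulr_sumr; apply: eq_bigr => j _; rewrite mulrA.
have iG : integrableR M (strip a b) (fun z => xi z.2 *
    generator_integrand (Y a z.2) (beta z.1 z.2) (V z.2)).
  have := integrableRD mS iG1' iG2h.
  by rewrite /integrableR; congr (_.-integrable _ _); apply/funext => z /=; rewrite GE.
split => //.
under [X in `|_ - X|]eq_Rintegral do rewrite GE.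
rewrite RintegralD// RintegralZl//.
pose T1 w := xi w * (h (Y b w) - h (Y a w)).
pose T2 w := \sum_(i < d) x1 i w * N i w.
pose T3 w := \sum_(i < d) x1 i w * B i w.
pose T4 w := \sum_(i < d) \sum_(j < d) x2 i j w * (N i w * N j w).
have mh (y : Omega -> 'rV[R]_d) : measurable_fun setT y -> measurable_fun setT (h \o y).
  by move=> my; apply: measurableT_comp => //; exact: continuous_measurable_mx.
have iT1 : integrableR P setT T1.
  apply: (@bounded_integrableR _ _ _ P (C + C)).
    apply: measurable_funM; first exact: meas.
    by apply: measurable_funB; exact: mh.
  move=> w; rewrite normrM -[leRHS]mul1r ler_pM//.
  by rewrite (le_trans (ler_normB _ _))// lerD//; exact: (jet_b0 jh).
have ix1N i : integrableR P setT (fun w => x1 i w * N i w).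
  by apply: (bmul (L := C)) => //; exact: meas.
have ix1B i : integrableR P setT (fun w => x1 i w * B i w).
  by apply: (bmul (L := C)) => //; exact: meas.
have ix2N i j : integrableR P setT (fun w => x2 i j w * (N i w * N j w)).
  by apply: (bmul (L := C)) => //; exact: meas.
have iT2 : integrableR P setT T2 by exact: integrableR_sum.
have iT3 : integrableR P setT T3 by exact: integrableR_sum.
have ix2Ni i : integrableR P setT (fun w => \sum_(j < d) x2 i j w * (N i w * N j w)).
  exact: integrableR_sum.
have iT4 : integrableR P setT T4 by exact: integrableR_sum.
have iT4h := integrableRZ 2^-1 measurableT iT4.
have ET2 : \int[P]_w T2 w = 0 by rewrite Rintegral_sum// big1.
have ET3 : \int[P]_w T3 w = \int[M]_(z in strip a b) G1 z.
  rewrite Rintegral_sum// Rintegral_sum//.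
  by apply: eq_bigr => i _; have [_] := drift_B i.
have ET4 : \int[P]_w T4 w = \int[M]_(z in strip a b) G2 z.
  rewrite Rintegral_sum// Rintegral_sum//.
  apply: eq_bigr => i _; rewrite Rintegral_sum// Rintegral_sum//.
  by apply: eq_bigr => j _; have [_] := cov_strip i j.
have i12 := integrableRB measurableT iT1 iT2.
have i123 := integrableRB measurableT i12 iT3.
have iE := integrableRB measurableT i123 iT4h.
have -> : \int[P]_w T1 w - (\int[M]_(z in strip a b) G1 z
      + 2^-1 * \int[M]_(z in strip a b) G2 z)
    = \int[P]_w (T1 w - T2 w - T3 w - 2^-1 * T4 w).
  rewrite RintegralB// RintegralB// RintegralB// RintegralZl// ET2 ET3 ET4; ring.
apply: le_trans (le_normr_Rintegral _ iE) _ => //.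
have [icube cubele] := cube_N.
have iBm : integrableR P setT (fun w => \sum_(i < d) `|B i w| * step_modulus w).
  exact: integrableR_sum.
apply: (@le_trans _ _ (\int[P]_w (C * (\sum_(i < d) `|B i w| * step_modulus w)
    + C * (\sum_(i < d) `|N i w|) ^+ 3))); last first.
  rewrite RintegralD//; [|exact: integrableRZ|exact: integrableRZ].
  by rewrite RintegralZl// RintegralZl// lerD// ler_wpM2l.
apply: le_Rintegral => //.
- exact: integrableR_norm iE.
- by apply: integrableRD => //; exact: integrableRZ.
move=> w _; pose Nv : 'rV[R]_d := \row_i N i w; pose Bv : 'rV[R]_d := \row_i B i w.
have nN : `|Nv| <= \sum_(i < d) `|N i w|.
  apply: ler_mxnormP; first exact: sumr_ge0.
  by move=> i; rewrite mxE (bigD1 i)//= lerDl sumr_ge0.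
have nB : `|Bv| <= \sum_(i < d) `|B i w|.
  apply: ler_mxnormP; first exact: sumr_ge0.
  by move=> i; rewrite mxE (bigD1 i)//= lerDl sumr_ge0.
have YE : Y b w = Y a w + Nv + Bv.
  by apply/rowP => i; rewrite !mxE /B; ring.
have TE : T1 w - T2 w - T3 w - 2^-1 * T4 w = xi w * (h (Y a w + Nv + Bv) - h (Y a w)
    - \sum_(i < d) partial i h (Y a w) * (Nv + Bv) 0 i
    - 2^-1 * \sum_(i < d) \sum_(j < d)
        partial i (partial j h) (Y a w) * (Nv 0 i * Nv 0 j)).
  rewrite /T1 YE !mulrBr /T2 /T3 -[X in X - _ = _]addrA -opprD -big_split/=.
  congr (_ - _ - _).
    rewrite mulr_sumr; apply: eq_bigr => i _.
    by rewrite !mxE /x1 -mulrDr mulrA.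
  rewrite [RHS]mulrCA; congr (_ * _); rewrite mulr_sumr; apply: eq_bigr => i _.
  rewrite mulr_sumr; apply: eq_bigr => j _.
  by rewrite !mxE /x2 -mulrA.
rewrite TE normrM; apply: le_trans (ler_wpM2r (normr_ge0 _) (bxi w)) _.
rewrite mul1r; apply: le_trans (jet_taylor jh (Y a w) Nv Bv) _.
rewrite -mulrDr ler_wpM2l// lerD//; last by rewrite lerXn2r ?nnegrE// (le_trans _ nN).
have min0 : 0 <= Num.min 1 (`|Nv| + `|Bv|) by rewrite le_min ler01 addr_ge0.
rewrite -mulr_suml ler_pM//.
rewrite /step_modulus le_min ge_min lexx/= ge_min; apply/orP; right.
exact: lerD.
Qed.

End ItoStep.

Section GeneratorIntegrand.
Context (R : realType) (d m : nat).
Variables (h : 'rV[R]_d -> R) (C K : R).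
Hypotheses (jh : jet_bound h C) (K0 : 0 <= K).

Definition generator_const : R := 2^-1 * (d%:R * (d%:R * (C * (m%:R * (K * K))))).

Lemma mulmx_tr_bound (v : 'M[R]_(d, m)) i j : (forall i j, `|v i j| <= K) ->
  `|(v *m v^T) i j| <= m%:R * (K * K).
Proof.
move=> bv; rewrite mxE; apply: le_trans (ler_norm_sum _ _ _) _.
apply: (@le_trans _ _ (\sum_(k < m) K * K)).
  by apply: ler_sum => k _; rewrite mxE normrM ler_pM// bv.
by rewrite sumr_const card_ord mulr_natl.
Qed.

Lemma generator_integrand_bound (y be : 'rV[R]_d) (v : 'M[R]_(d, m)) :
  (forall i j, `|v i j| <= K) ->
  `|generator_integrand h y be v| <= C * (\sum_(i < d) `|be 0 i|) + generator_const.
Proof.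
move=> bv; apply: le_trans (ler_normD _ _) _; apply: lerD.
  rewrite mulr_sumr; apply: le_trans (ler_norm_sum _ _ _) _.
  by apply: ler_sum => i _; rewrite normrM ler_wpM2r// (jet_b1 jh).
rewrite normrM ger0_norm ?invr_ge0// ler_wpM2l ?invr_ge0//.
apply: le_trans (ler_norm_sum _ _ _) _.
rewrite -[X in X%:R * _](card_ord d) mulr_natl -sumr_const; apply: ler_sum => i _.
apply: le_trans (ler_norm_sum _ _ _) _.
rewrite -[X in X%:R * _](card_ord d) mulr_natl -sumr_const; apply: ler_sum => j _.
by rewrite normrM ler_pM// ?(jet_b2 jh)// mulmx_tr_bound.
Qed.

End GeneratorIntegrand.

Section ItoPiece.
Context (R : realType) (d m : nat) disp (Omega : measurableType disp).
Variables (P : probability Omega R) (F : R -> set (set Omega)).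
Variable W : R -> Omega -> 'rV[R]_m.
Hypotheses (nF : normal_filtration P F) (bW : brownian_motion P F W).
Local Notation RT := (measurableTypeR R).
Local Notation M := (time_measure P).
Local Notation mu := (@lebesgue_measure R).
Variables (Y beta : R -> Omega -> 'rV[R]_d) (V : Omega -> 'M[R]_(d, m)).
Variables (h : 'rV[R]_d -> R) (C K : R) (xi : Omega -> R) (p q : R).
Hypotheses (p0 : 0 <= p) (pq : p < q) (K0 : 0 <= K).
Hypothesis aY : forall r, p <= r -> r <= q -> F_measurable F r (Y r).
Hypothesis mY : forall r, measurable_fun setT (Y r).
Hypothesis cY : forall w, continuous (Y ^~ w).
Hypothesis mbeta : forall i, measurable_fun setT (fun z : RT * Omega => beta z.1 z.2 0 i).
Hypothesis ibeta : forall i, integrableR M (strip p q) (fun z => beta z.1 z.2 0 i).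
Hypotheses (mV : F_measurable F p V) (bV : forall w i j, `|V w i j| <= K).
Hypotheses (th : test_function h) (jh : jet_bound h C).
Hypotheses (mxi : measurable_wrt (F p) xi) (bxi : forall w, `|xi w| <= 1).
Hypothesis path : forall a b, p <= a -> a <= b -> b <= q -> {ae P, forall w, forall i,
  Y b w 0 i - Y a w 0 i - \sum_(j < m) V w i j * increment W a b j w
    = \int[mu]_(r in `]a, b]) beta r w 0 i}.

Let sh := th.1.
Let ch : continuous h. Proof. by have [] := sh [::]. Qed.
Let ch1 i : continuous (partial i h). Proof. by have [] := sh [:: i]. Qed.
Let ch2 i j : continuous (partial i (partial j h)). Proof. by have [] := sh [:: i; j]. Qed.
Let C0 : 0 <= C. Proof. exact: jet_ge0 jh. Qed.
Let mS : measurable (strip p q : set (RT * Omega)). Proof. exact: measurable_strip. Qed.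
Let mxi' : measurable_fun setT xi.
Proof. exact: (measurable_wrt_measurable (filtration_measurable nF p0)). Qed.
Let mVc i j : measurable_fun setT (fun w => V w i j).
Proof. by apply: measurable_fun_coord; exact: (F_measurable_fun nF p0). Qed.

(* Brownian motion is only given at nonnegative times *)
Let Wc r := W (Num.max 0 r).
Let mWc r j : measurable_fun setT (fun w => Wc r w 0 j).
Proof.
have [_ _ mW _] := bW; have r0 : 0 <= Num.max 0 r by rewrite le_max lexx.
by apply: measurable_fun_coord; apply: (F_measurable_fun nF r0); exact: mW.
Qed.
Let cWc w j : continuous (fun r => Wc r w 0 j).
Proof.
have [_ cW _ _] := bW.
have cW' := continuous_clamp (cW w).
by move=> r; apply: (@continuous_comp _ _ _ _ (fun v : 'rV[R]_m => v 0 j));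
  [exact: cW'|exact: coord_continuous].
Qed.

Let sumN a b i w : R := \sum_(j < m) V w i j * (Wc b w 0 j - Wc a w 0 j).
Let modc a b w : R := Num.min 1 (\sum_(i < d) `|sumN a b i w|
   + \sum_(i < d) `|Y b w 0 i - Y a w 0 i - sumN a b i w|).

Let mYi r i : measurable_fun setT (fun w => Y r w 0 i).
Proof. exact: measurable_fun_coord. Qed.
Let msumN a b i : measurable_fun setT (sumN a b i).
Proof.
apply: measurable_sum => j; apply: measurable_funM => //; exact: measurable_funB.
Qed.
Let mmodc a b : measurable_fun setT (modc a b).
Proof.
apply: measurable_minr => //; apply: measurable_funD; apply: measurable_sum => i;
  apply: measurableT_comp => //.
apply: measurable_funB => //; exact: measurable_funB.
Qed.
Let modc01 a b w : 0 <= modc a b w <= 1.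
Proof. by rewrite /modc le_min ler01 ge_min lexx andbT addr_ge0// sumr_ge0. Qed.
Let modcE a b w : p <= a -> a <= b -> modc a b w = step_modulus W Y V a b w.
Proof.
move=> pa ab; rewrite /modc /step_modulus /sumN /increment /Wc.
by rewrite !max_r// ?(le_trans p0)// (le_trans pa).
Qed.

Let cYi w i : continuous (fun r => Y r w 0 i).
Proof.
by move=> r; apply: (@continuous_comp _ _ _ (Y ^~ w) (fun v : 'rV[R]_d => v 0 i));
  [exact: cY|exact: coord_continuous].
Qed.
Let cvgY w (r : R) (u : nat -> R) (g : 'rV[R]_d -> R) : continuous g ->
  u @ \oo --> r -> (fun n => g (Y (u n) w)) @ \oo --> g (Y r w).
Proof.
move=> cg ur; apply: (@continuous_cvg _ _ _ _ _ _ (fun r => g (Y r w)) r) ur.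
by apply: (@continuous_comp _ _ _ (Y ^~ w) g); [exact: cY|exact: cg].
Qed.

Let cvg_sumN w i (r : R) (u v : nat -> R) : u @ \oo --> r -> v @ \oo --> r ->
  (fun n => sumN (u n) (v n) i w) @ \oo --> (0 : R).
Proof.
move=> ur vr.
rewrite (_ : 0 = \sum_(j < m) V w i j * (Wc r w 0 j - Wc r w 0 j)); last first.
  by rewrite big1// => j _; rewrite subrr mulr0.
apply: cvg_sum => j; apply: cvgM; first exact: cvg_cst.
by apply: cvgB; [apply: (@continuous_cvg _ _ _ _ _ _ (fun r => Wc r w 0 j) r) vr
  |apply: (@continuous_cvg _ _ _ _ _ _ (fun r => Wc r w 0 j) r) ur]; exact: cWc.
Qed.

Let cvg_modc w (r : R) (u v : nat -> R) : u @ \oo --> r -> v @ \oo --> r ->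
  (fun n => modc (u n) (v n) w) @ \oo --> (0 : R).
Proof.
move=> ur vr.
have S0 : (fun n => \sum_(i < d) `|sumN (u n) (v n) i w| + \sum_(i < d)
   `|Y (v n) w 0 i - Y (u n) w 0 i - sumN (u n) (v n) i w|) @ \oo --> (0 : R).
  rewrite [X in _ --> X](_ : 0 = \sum_(i < d) `|0 : R| + \sum_(i < d)
      `|Y r w 0 i - Y r w 0 i - 0|); last first.
    by rewrite !big1 ?addr0// => i _; rewrite ?subrr ?subr0 ?normr0.
  apply: cvgD; apply: cvg_sum => i; apply: cvg_norm.
    exact: (cvg_sumN w i ur vr).
  apply: cvgB; last exact: (cvg_sumN w i ur vr).
  have cc : continuous (fun v : 'rV[R]_d => v 0 i) by exact: coord_continuous.
  by apply: cvgB; [exact: (cvgY cc vr)|exact: (cvgY cc ur)].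
apply: (squeeze_cvgr _ (cvg_cst 0) S0); apply: nearW => n.
by case/andP: (modc01 (u n) (v n) w) => -> _ /=; rewrite ge_min lexx orbT.
Qed.

Let G (y : R -> Omega -> 'rV[R]_d) (z : RT * Omega) : R :=
  xi z.2 * generator_integrand h (y z.1 z.2) (beta z.1 z.2) (V z.2).
Let B1 (z : RT * Omega) : R := \sum_(i < d) `|beta z.1 z.2 0 i|.
Let GC : R := generator_const d m C K.
Let dom (z : RT * Omega) : R := C * B1 z + GC.

Let iB1 : integrableR M (strip p q) B1.
Proof. by apply: integrableR_sum => // i; exact: integrableR_norm. Qed.
Let idom : integrableR M (strip p q) dom.
Proof.
apply: integrableRD => //; first exact: integrableRZ.
by apply: (@integrable_strip_bounded _ _ _ P p q `|GC|); rewrite ?(ltW pq)//.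
Qed.
Let GC0 : 0 <= GC.
Proof. by rewrite /GC /generator_const !mulr_ge0// invr_ge0. Qed.

Let G_dom y z : `|G y z| <= dom z.
Proof.
rewrite normrM -[leRHS]mul1r ler_pM//; exact: generator_integrand_bound.
Qed.

Let measurable_G (y : R -> Omega -> 'rV[R]_d) :
  (forall g : 'rV[R]_d -> R, continuous g -> measurable_fun setT (fun z : RT * Omega => g (y z.1 z.2))) ->
  measurable_fun setT (G y).
Proof.
move=> my; have snd (f : Omega -> R) : measurable_fun setT f ->
    measurable_fun setT (fun z : RT * Omega => f z.2).
  by move=> mf; apply: (measurableT_comp mf); exact: measurable_snd.
apply: measurable_funM; first exact: snd.
apply: measurable_funD.
  apply: measurable_sum => i; apply: measurable_funM; first exact: my.
  exact: mbeta.
apply: measurable_funM => //; apply: measurable_sum => i; apply: measurable_sum => j.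
apply: measurable_funM; first exact: my.
rewrite (_ : (fun z : RT * Omega => (V z.2 *m (V z.2)^T) i j) =
  (fun z : RT * Omega => \sum_(k < m) V z.2 i k * V z.2 j k)).
  by apply: measurable_sum => k; apply: measurable_funM; apply: (snd (fun w => V w _ _)).
by apply/funext => z; rewrite mxE; apply: eq_bigr => k _; rewrite mxE.
Qed.

Let delta (n : nat) : R := (q - p) / n.+1%:R.
Let d0 n : 0 < delta n. Proof. by rewrite divr_gt0// subr_gt0. Qed.
Let delta_cvg : delta @ \oo --> (0 : R).
Proof.
rewrite -[X in _ --> X](mulr0 (q - p)); apply: cvgM; first exact: cvg_cst.
exact: natSinv_cvg0.
Qed.
Let t n (k : nat) : R := p + delta n * k%:R.
Let t0 n : t n 0 = p. Proof. by rewrite /t mulr0 addr0. Qed.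
Let tS n k : t n k.+1 = t n k + delta n.
Proof. by rewrite /t -[k.+1]addn1 natrD; ring. Qed.
Let tN n : t n n.+1 = q.
Proof. by rewrite /t /delta divfK// ?pnatr_eq0// addrC subrK. Qed.
Let t_lt n k : t n k < t n k.+1. Proof. by rewrite tS ltrDl. Qed.
Let t_ge n k : p <= t n k. Proof. by rewrite /t lerDl mulr_ge0// ltW. Qed.
Let t_le n k : (k <= n.+1)%N -> t n k <= q.
Proof. by move=> kn; rewrite -(tN n) /t lerD2l ler_wpM2l ?ler_nat// ltW. Qed.

Let Yk n r := Y (step_time p (delta n) r).
Let mYk n (g : 'rV[R]_d -> R) : continuous g ->
  measurable_fun setT (fun z : RT * Omega => g (Yk n z.1 z.2)).
Proof.
move=> cg; apply: (@measurable_step_process _ _ _ (fun r w => g (Y r w))) => // r.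
by apply: measurableT_comp => //; exact: continuous_measurable_mx.
Qed.
Let E n (z : RT * Omega) : R := B1 z * modc (step_time p (delta n) z.1)
  (step_time p (delta n) z.1 + delta n) z.2.
Let mE n : measurable_fun setT (E n).
Proof.
apply: measurable_funM.
  by apply: measurable_sum => i; apply: measurableT_comp.
exact: (@measurable_step_process _ _ _ (fun r => modc r (r + delta n))).
Qed.
Let E_dom n z : `|E n z| <= B1 z.
Proof.
have /andP[m0 m1] := modc01 (step_time p (delta n) z.1)
  (step_time p (delta n) z.1 + delta n) z.2.
have B0 : 0 <= B1 z by exact: sumr_ge0.
by rewrite ger0_norm ?mulr_ge0// ler_piMr.
Qed.
Let iGk n : integrableR M (strip p q) (G (Yk n)).
Proof.
apply: (le_integrableR mS idom) => [|z _]; last exact: G_dom.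
by apply: measurable_funTS; apply: measurable_G; exact: mYk.
Qed.
Let iE n : integrableR M (strip p q) (E n).
Proof.
apply: (le_integrableR mS iB1) => [|z _]; last exact: E_dom.
exact: measurable_funTS.
Qed.

Let sum_strip n (f : RT * Omega -> R) : integrableR M (strip p q) f ->
  \int[M]_(z in strip p q) f z
    = \sum_(k < n.+1) \int[M]_(z in strip (t n k) (t n k.+1)) f z.
Proof.
move=> fi; rewrite -(tN n).
suff H k : (k < n.+1)%N -> \int[M]_(z in strip p (t n k.+1)) f z
    = \sum_(l < k.+1) \int[M]_(z in strip (t n l) (t n l.+1)) f z by exact: H.
elim: k => [|k IH] kn; first by rewrite big_ord1 t0.
rewrite big_ord_recr/= -IH ?(ltnW kn)//.
rewrite (@Rintegral_strip_setU _ _ _ P p (t n k.+1) (t n k.+2))//.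
  exact: ltW.
by apply: (integrable_stripS _ _ fi) => //; exact: t_le.
Qed.

Let step_bound n : `| \int[P]_w (xi w * (h (Y q w) - h (Y p w)))
     - \int[M]_(z in strip p q) G (Yk n) z |
  <= C * \int[M]_(z in strip p q) E n z
     + C * cube_step_const d m K * (q - p) * Num.sqrt (delta n).
Proof.
have mh r : measurable_fun setT (fun w => h (Y r w)).
  by apply: measurableT_comp => //; exact: continuous_measurable_mx.
have ixi k : integrableR P setT (fun w => xi w * (h (Y (t n k.+1) w) - h (Y (t n k) w))).
  apply: (@bounded_integrableR _ _ _ P (C + C)).
    by apply: measurable_funM => //; exact: measurable_funB.
  move=> w; rewrite normrM -[leRHS]mul1r ler_pM//.
  by rewrite (le_trans (ler_normB _ _))// lerD//; exact: (jet_b0 jh).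
have -> : \int[P]_w (xi w * (h (Y q w) - h (Y p w)))
   = \sum_(k < n.+1) \int[P]_w (xi w * (h (Y (t n k.+1) w) - h (Y (t n k) w))).
  rewrite -Rintegral_sum//; apply: eq_Rintegral => w _.
  rewrite -mulr_sumr; congr (_ * _).
  have := telescope_sumr (fun k => h (Y (t n k) w)) (leq0n n.+1).
  by rewrite big_mkord tN t0.
rewrite (sum_strip n (iGk n)) (sum_strip n (iE n)) -sumrB.
have kE k (z : RT * Omega) : strip (t n k) (t n k.+1) z ->
    step_time p (delta n) z.1 = t n k.
  move=> [/= + _]; rewrite in_itv/= => zk; exact: step_time_eq.
apply: le_trans (ler_norm_sum _ _ _) _.
have -> : C * cube_step_const d m K * (q - p) * Num.sqrt (delta n) =
    \sum_(k < n.+1) C * (cube_step_const d m K * Num.sqrt (delta n) ^+ 3).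
  rewrite sumr_const card_ord -[RHS]mulr_natl.
  have : Num.sqrt (delta n) ^+ 2 = delta n by rewrite sqr_sqrtr// ltW.
  have : n.+1%:R * delta n = q - p by rewrite /delta mulrC divfK// pnatr_eq0.
  move=> <-; rewrite [_ ^+ 3]exprSr => ->; ring.
rewrite mulr_sumr -big_split/=; apply: ler_sum => k _.
have tab : t n k.+1 - t n k = delta n by rewrite tS addrAC subrr add0r.
have tk0 : 0 <= t n k by rewrite (le_trans p0).
have kq : t n k <= q by apply: t_le; rewrite ltnW.
have kSq : t n k.+1 <= q by exact: t_le.
have [_] := ito_step nF bW tk0 (t_lt n k) K0
  (aY (t_ge n k) kq) (aY (t_ge n k.+1) kSq)
  (fun i => integrable_stripS (t_ge n k) kSq (ibeta i))
  (F_measurableS nF p0 (t_ge n k) mV) bV th jh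
  (measurable_wrtS (filtration_le nF p0 (t_ge n k)) mxi) bxi
  (path (t_ge n k) (ltW (t_lt n k)) kSq).
rewrite tab => hst.
have G_eq : \int[M]_(z in strip (t n k) (t n k.+1)) G (Yk n) z =
    \int[M]_(z in strip (t n k) (t n k.+1)) (xi z.2 *
      generator_integrand h (Y (t n k) z.2) (beta z.1 z.2) (V z.2)).
  by apply: eq_Rintegral => z zS; rewrite /G /Yk (kE k z (set_mem zS)).
have E_eq : \int[M]_(z in strip (t n k) (t n k.+1)) E n z =
    \int[M]_(z in strip (t n k) (t n k.+1)) (\sum_(i < d) `|beta z.1 z.2 0 i| *
      step_modulus W Y V (t n k) (t n k.+1) z.2).
  apply: eq_Rintegral => z zS; rewrite /E (kE k z (set_mem zS)).
  by rewrite -(tS n k) (modcE z.2 (t_ge n k) (ltW (t_lt n k))) -mulr_suml.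
by rewrite G_eq E_eq.
Qed.

(** Refining the partition turns the Riemann sums of the step estimates into
    the time integral and makes the errors vanish. *)
Lemma ito_piece :
  integrableR M (strip p q) (fun z => xi z.2 *
    generator_integrand h (Y z.1 z.2) (beta z.1 z.2) (V z.2)) /\
  \int[P]_w (xi w * (h (Y q w) - h (Y p w)))
  = \int[M]_(z in strip p q) (xi z.2 *
    generator_integrand h (Y z.1 z.2) (beta z.1 z.2) (V z.2)).
Proof.
have mG : measurable_fun setT (G Y).
  apply: measurable_G => g cg; apply: (measurable_process (Y := fun r w => g (Y r w))).
    by move=> r; apply: measurableT_comp => //; exact: continuous_measurable_mx.
  by move=> w r; apply: (@continuous_comp _ _ _ (Y ^~ w) g); [exact: cY|exact: cg].
have iG : integrableR M (strip p q) (G Y).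
  apply: (le_integrableR mS idom) => [|z _]; last exact: G_dom.
  exact: measurable_funTS.
split => //.
have cvG : (fun n => \int[M]_(z in strip p q) G (Yk n) z) @ \oo -->
    \int[M]_(z in strip p q) G Y z.
  apply: (dominated_cvgR mS _ _ _ idom) => [n||z _|n z _].
  - by apply: measurable_funTS; apply: measurable_G; exact: mYk.
  - exact: measurable_funTS.
  - have [cv _] := step_time_cvg p z.1 d0 delta_cvg.
    apply: cvgM; first exact: cvg_cst.
    apply: cvgD.
      by apply: cvg_sum => i; apply: cvgM; [exact: cvgY|exact: cvg_cst].
    apply: cvgM; first exact: cvg_cst.
    apply: cvg_sum => i; apply: cvg_sum => j.
    by apply: cvgM; [exact: cvgY|exact: cvg_cst].
  - exact: G_dom.
have cvE : (fun n => \int[M]_(z in strip p q) E n z) @ \oo --> (0 : R).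
  rewrite (_ : 0 = \int[M]_(z in strip p q) 0); last first.
    by rewrite /Rintegral integral0.
  apply: (dominated_cvgR mS _ _ _ iB1) => [n||z _|n z _].
  - exact: measurable_funTS.
  - exact: measurable_cst.
  - have [cv1 cv2] := step_time_cvg p z.1 d0 delta_cvg.
    rewrite -[X in _ --> X](mulr0 (B1 z)); apply: cvgM; first exact: cvg_cst.
    exact: (cvg_modc z.2 cv1 cv2).
  - exact: E_dom.
have cvs : (fun n => Num.sqrt (delta n)) @ \oo --> (0 : R).
  rewrite -[X in _ --> X](sqrtr0 R).
  by apply: (@continuous_cvg _ _ _ _ _ _ (@Num.sqrt R) 0) delta_cvg; exact: sqrt_continuous.
pose L := \int[P]_w (xi w * (h (Y q w) - h (Y p w))).
pose I := \int[M]_(z in strip p q) G Y z.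
change (L = I).
have cvb : (fun n => C * \int[M]_(z in strip p q) E n z
     + C * cube_step_const d m K * (q - p) * Num.sqrt (delta n)) @ \oo --> (0 : R).
  rewrite -[X in _ --> X](addr0 (0 : R)); apply: cvgD.
    by rewrite -[X in _ --> X](mulr0 C); apply: cvgM => //; exact: cvg_cst.
  rewrite -[X in _ --> X](mulr0 (C * cube_step_const d m K * (q - p))).
  by apply: cvgM => //; exact: cvg_cst.
have cvL : (fun n => `|L - \int[M]_(z in strip p q) G (Yk n) z|) @ \oo --> `|L - I|.
  by apply: cvg_norm; apply: cvgB => //; exact: cvg_cst.
apply/eqP; rewrite -subr_eq0 -normr_eq0 eq_le normr_ge0 andbT.
by apply: (ler_cvg_to cvL cvb); apply: nearW => n; exact: step_bound.
Qed.

End ItoPiece.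

(** * The weak Ito formula for simple integrands *)

Section SimpleIntegrand.
Context (R : realType) (d m : nat) disp (Omega : measurableType disp).
Variables (P : probability Omega R) (F : R -> set (set Omega)).
Variable W : R -> Omega -> 'rV[R]_m.
Hypotheses (nF : normal_filtration P F) (bW : brownian_motion P F W).
Local Notation RT := (measurableTypeR R).
Local Notation M := (time_measure P).
Local Notation mu := (@lebesgue_measure R).
Variables (s : R) (S : simple_process R d m Omega).
Hypotheses (s0 : 0 <= s) (sS : simple_from F s S).

Local Notation tm := (sp_time S).
Let t_ge k : s <= tm k. Proof. by have [] := sS k. Qed.
Let t_ge0 k : 0 <= tm k. Proof. exact: le_trans (t_ge k). Qed.
Let t_S k : tm k <= tm k.+1. Proof. by have [] := sS k. Qed.
Let t_mono k l : (k <= l)%N -> tm k <= tm l.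
Proof. by move=> kl; exact: (homo_leq (@lexx _ _) (@le_trans _ _) t_S kl). Qed.
Let mVk k : F_measurable F (tm k) (sp_val S k). Proof. by have [] := sS k. Qed.

Let W_F t : 0 <= t -> F_measurable F t (W t).
Proof. by have [_ _ h _] := bW; exact: h. Qed.

Lemma simple_integral_coord t w i : simple_integral W S t w 0 i =
  \sum_(k < sp_size S) \sum_(j < m)
    (W (Num.min (tm k.+1) t) w 0 j - W (Num.min (tm k) t) w 0 j) * sp_val S k w i j.
Proof.
rewrite /simple_integral summxE; apply: eq_bigr => k _.
by rewrite mxE; apply: eq_bigr => j _; rewrite !mxE.
Qed.

Lemma simple_integral_adapted t : s <= t -> F_measurable F t (simple_integral W S t).
Proof.
move=> st; have t0 := le_trans s0 st.
apply: (coord_F_measurable nF t0) => i0 i; rewrite (ord1 i0).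
under eq_fun do rewrite simple_integral_coord.
apply: measurable_wrt_sum => k; apply: measurable_wrt_sum => j.
have [tk|] := boolP (tm k <= t); last first.
  rewrite -ltNge => /ltW tk.
  have h1 := min_r (le_trans tk (t_S k)); have h2 := min_r tk.
  rewrite [X in measurable_wrt _ X](_ : _ = fun=> 0); first exact: measurable_cst.
  by apply/funext => w; rewrite h1 h2 subrr mul0r.
have Wm r : 0 <= r -> r <= t -> measurable_wrt (F t) (fun w => W r w 0 j).
  move=> r0 rt; apply: (measurable_wrtS (filtration_le nF r0 rt)).
  by apply: (F_measurable_coord nF _ _ r0); exact: W_F.
apply: measurable_wrtM.
  apply: measurable_funB; apply: Wm; rewrite ?le_min ?t_ge0 ?t0 ?ge_min ?lexx ?orbT//.
apply: (measurable_wrtS (filtration_le nF (t_ge0 k) tk)).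
exact: (F_measurable_coord nF).
Qed.

Lemma simple_integral_continuous w : continuous (fun r => simple_integral W S (Num.max s r) w).
Proof.
have [_ cW _ _] := bW; have cWc := continuous_clamp (cW w).
have cmin (c : R) : continuous (fun r : R => Num.max 0 (Num.min c (Num.max s r))).
  have c1 : continuous (fun r : R => Num.max s r).
    by move=> r; exact: (@continuous_max _ _ (cst s) id r (cvg_cst _) cvg_id).
  have c2 : continuous (fun r : R => Num.min c (Num.max s r)).
    by move=> r; exact: (@continuous_min _ _ (cst c) (fun r => Num.max s r) r (cvg_cst _) (c1 r)).
  by move=> r; exact: (@continuous_max _ _ (cst 0) (fun r => Num.min c (Num.max s r)) r
    (cvg_cst _) (c2 r)).
have cWm k j : continuous (fun r => W (Num.min (tm k) (Num.max s r)) w 0 j).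
  have -> : (fun r => W (Num.min (tm k) (Num.max s r)) w 0 j) =
      (fun r => W (Num.max 0 (Num.max 0 (Num.min (tm k) (Num.max s r)))) w 0 j).
    apply/funext => r; have m0 : 0 <= Num.min (tm k) (Num.max s r).
      by rewrite le_min t_ge0 (le_trans s0)// le_max lexx.
    by rewrite (max_r m0) (max_r m0).
  move=> r; apply: (@continuous_comp _ _ _ (fun r : R => W (Num.max 0 (Num.max 0
    (Num.min (tm k) (Num.max s r)))) w) (fun v : 'rV[R]_m => v 0 j)).
    apply: (@continuous_comp _ _ _ (fun r : R => Num.max 0 (Num.min (tm k) (Num.max s r)))
      (fun r => W (Num.max 0 r) w)); first exact: cmin.
    exact: cWc.
  exact: coord_continuous.
apply: continuous_mxP => i0 i; rewrite (ord1 i0).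
have -> : (fun r => simple_integral W S (Num.max s r) w 0 i) = (fun r =>
    \sum_(k < sp_size S) \sum_(j < m) (W (Num.min (tm k.+1) (Num.max s r)) w 0 j
      - W (Num.min (tm k) (Num.max s r)) w 0 j) * sp_val S k w i j).
  by apply/funext => r; rewrite simple_integral_coord.
move=> r; apply: cvg_sum => k; apply: cvg_sum => j.
by apply: cvgM; [apply: cvgB; exact: cWm|exact: cvg_cst].
Qed.

Lemma measurable_simple_value i j :
  measurable_fun setT (fun z : RT * Omega => simple_value S z.1 z.2 i j).
Proof.
have -> : (fun z : RT * Omega => simple_value S z.1 z.2 i j) = (fun z =>
    \sum_(k < sp_size S) \1_(`]tm k, tm k.+1]%classic : set RT) z.1 * sp_val S k z.2 i j).
  apply/funext => z; rewrite /simple_value summxE; apply: eq_bigr => k _.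
  by rewrite mxE indicE; congr (_%:R * _); rewrite mem_setE.
apply: measurable_sum => k; apply: measurable_funM.
  have mI : measurable_fun setT (\1_(`]tm k, tm k.+1]%classic : set RT) : RT -> R).
    by apply: measurable_indic; exact: measurable_itv.
  exact: (measurableT_comp mI measurable_fst).
apply: (@measurableT_comp _ _ _ _ _ _ (fun w => sp_val S k w i j));
  last exact: measurable_snd.
by apply: measurable_fun_coord; exact: (F_measurable_fun nF (t_ge0 k)).
Qed.

Lemma sp_val_bounded : exists2 K : R, 0 <= K & forall k w i j, (k < sp_size S)%N ->
  `|sp_val S k w i j| <= K.
Proof.
have H (k : 'I_(sp_size S)) : exists C : R, forall w, `|(`|sp_val S k w|)| <= C.
  by have [_ _ _ [C hC]] := sS k; exists C => w; rewrite normr_id.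
have [K K0 hK] := common_bound H; exists K => // k w i j kS.
apply: le_trans (ler_mx_coord _ _ _) _.
by have := hK (Ordinal kS) w; rewrite normr_id.
Qed.

Lemma simple_value_active k a b r w : (k < sp_size S)%N -> tm k <= a -> b <= tm k.+1 ->
  a < r -> r <= b -> simple_value S r w = sp_val S k w.
Proof.
move=> kS ka bk ar rb; rewrite /simple_value (bigD1 (Ordinal kS))//=.
rewrite (le_lt_trans ka ar) (le_trans rb bk) scale1r big1 ?addr0// => l lk.
have [kl|lk'|E] := ltngtP k l; last by move: lk; rewrite -val_eqE /= E eqxx.
  by rewrite ltNge (le_trans rb (le_trans bk (t_mono kl))) scale0r.
by rewrite [X in _ && X]leNgt (le_lt_trans (t_mono lk') (le_lt_trans ka ar)) andbF scale0r.
Qed.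

Lemma simple_integral_active k a b w : (k < sp_size S)%N -> tm k <= a -> a <= b ->
  b <= tm k.+1 ->
  simple_integral W S b w - simple_integral W S a w = (W b w - W a w) *m (sp_val S k w)^T.
Proof.
move=> kS ka ab bk; rewrite /simple_integral -sumrB (bigD1 (Ordinal kS))//=.
rewrite -mulmxBl (min_r bk) (min_r (le_trans ab bk)) (min_l ka) (min_l (le_trans ka ab)).
rewrite opprB addrA subrK big1 ?addr0// => l lk.
rewrite -mulmxBl; have [kl|lk'|E] := ltngtP k l; last by move: lk; rewrite -val_eqE /= E eqxx.
  have h := le_trans bk (t_mono kl); have h' := le_trans h (t_S l).
  rewrite (min_r h) (min_r h') (min_r (le_trans ab h)) (min_r (le_trans ab h')).
  by rewrite !subrr mul0mx.
have h := le_trans (t_mono lk') ka; have h' := le_trans (t_S l) h.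
rewrite (min_l h) (min_l h') (min_l (le_trans h ab)) (min_l (le_trans h' ab)).
by rewrite subrr mul0mx.
Qed.

Definition inactive a b := b <= tm 0 \/ tm (sp_size S) <= a.

Lemma simple_value_inactive a b r w : inactive a b -> a < r -> r <= b ->
  simple_value S r w = 0.
Proof.
move=> ina ar rb; rewrite /simple_value big1// => l _; case: ina => h.
  by rewrite ltNge (le_trans rb (le_trans h (t_mono (leq0n l)))) scale0r.
by rewrite [X in _ && X]leNgt (le_lt_trans (t_mono (ltn_ord l)) (le_lt_trans h ar)) andbF scale0r.
Qed.

Lemma simple_integral_inactive a b w : inactive a b -> a <= b ->
  simple_integral W S b w - simple_integral W S a w = 0.
Proof.
move=> ina ab; rewrite /simple_integral -sumrB big1// => l _; rewrite -mulmxBl.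
case: ina => h.
  have h1 := le_trans h (t_mono (leq0n l)); have h2 := le_trans h1 (t_S l).
  rewrite (min_r h1) (min_r h2) (min_r (le_trans ab h1)) (min_r (le_trans ab h2)).
  by rewrite !subrr mul0mx.
have h1 := le_trans (t_mono (ltn_ord l)) h; have h2 := le_trans (t_S l) h1.
rewrite (min_l h1) (min_l h2) (min_l (le_trans h1 ab)) (min_l (le_trans h2 ab)).
by rewrite subrr mul0mx.
Qed.

(** ** Gluing the pieces *)

Variables (X I beta : R -> Omega -> 'rV[R]_d).
Hypothesis aX : forall t, s <= t -> F_measurable F t (X t).
Hypothesis aI : forall t, s <= t -> F_measurable F t (I t).
Hypothesis cX : forall w, {within `[s, +oo[, continuous (X ^~ w)}.
Hypothesis cI : forall w, {within `[s, +oo[, continuous (I ^~ w)}.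
Hypothesis mbeta : forall i, measurable_fun setT (fun z : RT * Omega => beta z.1 z.2 0 i).
Hypothesis ibeta : forall t i, integrableR M (strip s t) (fun z => beta z.1 z.2 0 i).
Hypothesis path0 : {ae P, forall w, forall t i, s <= t ->
  X t w 0 i - I t w 0 i = X s w 0 i + \int[mu]_(r in `]s, t]) beta r w 0 i}.
Variables (h : 'rV[R]_d -> R) (C : R).
Hypotheses (th : test_function h) (jh : jet_bound h C).

(** The solution with the stochastic integral replaced by that of the simple
    process, frozen before the initial time. *)
Definition approx_process r w : 'rV[R]_d :=
  X (Num.max s r) w - I (Num.max s r) w + simple_integral W S (Num.max s r) w.
Local Notation Y := approx_process.

Lemma approx_process_continuous w : continuous (Y ^~ w).
Proof.
have h1 := continuous_clamp (@cX w); have h2 := continuous_clamp (@cI w).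
move=> r; apply: cvgD; last exact: simple_integral_continuous.
by apply: cvgB; [exact: h1|exact: h2].
Qed.

Lemma approx_process_adapted t : s <= t -> F_measurable F t (Y t).
Proof.
move=> st; have t0 := le_trans s0 st.
apply: (coord_F_measurable nF t0) => i0 i; rewrite (ord1 i0).
have -> : (fun w => Y t w 0 i) = (fun w => X t w 0 i - I t w 0 i + simple_integral W S t w 0 i).
  by apply/funext => w; rewrite /approx_process (max_r st) !mxE.
apply: measurable_funD; last exact: (F_measurable_coord nF _ _ t0 (simple_integral_adapted st)).
apply: measurable_funB; first exact: (F_measurable_coord nF _ _ t0 (aX st)).
exact: (F_measurable_coord nF _ _ t0 (aI st)).
Qed.

Lemma approx_process_measurable r : measurable_fun setT (Y r).
Proof.
have sm : s <= Num.max s r by rewrite le_max lexx.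
have -> : Y r = Y (Num.max s r) by rewrite /approx_process maxA maxxx.
exact: (F_measurable_fun nF (le_trans s0 sm) (approx_process_adapted sm)).
Qed.

Let drift_increment a b : s <= a -> a <= b -> {ae P, forall w, forall i,
  (X b w - I b w) 0 i - (X a w - I a w) 0 i = \int[mu]_(r in `]a, b]) beta r w 0 i}.
Proof.
move=> sa ab.
have ae : {ae P, forall w, forall i : 'I_d,
    integrableR mu (`]s, b]%classic : set RT) (fun r => beta r w 0 i)}.
  by apply: filter_forall => i; exact: strip_integrable_ae (ibeta b i).
apply: filterS2 path0 ae => w hp hi i; rewrite !mxE.
rewrite hp ?(le_trans sa)// hp// opprD addrACA subrr add0r.
have := @Rintegral_itvB R (fun r => beta r w 0 i) (BRight s) (BRight b) a (hi i).
by apply; rewrite bnd_simp.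
Qed.

Let G z := generator_integrand h (Y z.1 z.2) (beta z.1 z.2) (simple_value S z.1 z.2).

Let ito_on u v := forall xi : Omega -> R, measurable_wrt (F u) xi ->
  (forall w, `|xi w| <= 1) ->
  integrableR M (strip u v) (fun z => xi z.2 * G z) /\
  \int[P]_w (xi w * (h (Y v w) - h (Y u w))) = \int[M]_(z in strip u v) (xi z.2 * G z).

Let ito_refl u : ito_on u u.
Proof.
move=> xi _ _; have -> : strip u u = set0 :> set (RT * Omega).
  by rewrite -subset0 => -[r w] [/= + _]; rewrite in_itv/= => /andP[/lt_le_trans/[apply]]; rewrite ltxx.
split; first exact: integrable_set0.
rewrite Rintegral_set0; under eq_Rintegral do rewrite subrr mulr0.
by rewrite /Rintegral integral0.
Qed.

Let ito_const u v (V : Omega -> 'M[R]_(d, m)) K : s <= u -> u < v -> 0 <= K ->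
  F_measurable F u V -> (forall w i j, `|V w i j| <= K) ->
  (forall r w, u < r -> r <= v -> simple_value S r w = V w) ->
  (forall a b w, u <= a -> a <= b -> b <= v ->
     simple_integral W S b w - simple_integral W S a w = (W b w - W a w) *m (V w)^T) ->
  ito_on u v.
Proof.
move=> su uv K0 mV bV vE iE xi mxi bxi.
have u0 := le_trans s0 su.
have aY r : u <= r -> r <= v -> F_measurable F r (Y r).
  by move=> ur _; apply: approx_process_adapted; exact: le_trans ur.
have path a b : u <= a -> a <= b -> b <= v -> {ae P, forall w, forall i,
    Y b w 0 i - Y a w 0 i - \sum_(j < m) V w i j * increment W a b j w
      = \int[mu]_(r in `]a, b]) beta r w 0 i}.
  move=> ua ab bv; have sa := le_trans su ua; have sb := le_trans sa ab.
  apply: filterS (drift_increment sa ab) => w hw i; rewrite -hw.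
  have /matrixP/(_ 0 i) := iE a b w ua ab bv; rewrite [LHS]mxE [X in _ + X]mxE [RHS]mxE => E.
  have -> : \sum_(j < m) V w i j * increment W a b j w =
      simple_integral W S b w 0 i - simple_integral W S a w 0 i.
    by rewrite E; apply: eq_bigr => j _; rewrite !mxE mulrC.
  rewrite /approx_process (max_r sa) (max_r sb) !mxE; ring.
have ib i : integrableR M (strip u v) (fun z => beta z.1 z.2 0 i).
  exact: (integrable_stripS su (lexx _) (ibeta v i)).
have [h1 h2] := ito_piece nF bW u0 uv K0 aY approx_process_measurable
  approx_process_continuous mbeta ib mV bV th jh mxi bxi path.
have E (z : RT * Omega) : strip u v z -> G z =
    generator_integrand h (Y z.1 z.2) (beta z.1 z.2) (V z.2).
  by move=> [/= + _]; rewrite in_itv/= => /andP[ur rv]; rewrite /G vE.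
split; last by rewrite h2; apply: eq_Rintegral => z /set_mem zS; rewrite E.
apply: eq_integrable h1; first exact: measurable_strip.
by move=> z /set_mem zS /=; rewrite E.
Qed.

Let ito_trans u v t : s <= u -> u <= v -> v <= t -> ito_on u v -> ito_on v t -> ito_on u t.
Proof.
move=> su uv vt h1 h2 xi mxi bxi.
have u0 := le_trans s0 su.
have [i1 e1] := h1 xi mxi bxi.
have [i2 e2] := h2 xi (measurable_wrtS (filtration_le nF u0 uv) mxi) bxi.
have mS1 := @measurable_strip R _ Omega u v; have mS2 := @measurable_strip R _ Omega v t.
have i12 : integrableR M (strip u t) (fun z => xi z.2 * G z).
  exact: integrable_strip_setU i1 i2.
split => //; rewrite (Rintegral_strip_setU uv vt i12) -e1 -e2.
have mh r : measurable_fun setT (fun w => h (Y r w)).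
  apply: measurableT_comp; last exact: approx_process_measurable.
  by apply: continuous_measurable_mx; have [] := th.1 [::].
have mxi' := measurable_wrt_measurable (filtration_measurable nF u0) mxi.
have bd a b : integrableR P setT (fun w => xi w * (h (Y b w) - h (Y a w))).
  apply: (@bounded_integrableR _ _ _ P (C + C)).
    by apply: measurable_funM => //; exact: measurable_funB.
  move=> w; rewrite normrM -[leRHS]mul1r ler_pM//.
  by rewrite (le_trans (ler_normB _ _))// lerD//; exact: (jet_b0 jh).
rewrite -RintegralD//; [|exact: bd|exact: bd]; apply: eq_Rintegral => w _; ring.
Qed.

Lemma ito_simple u v (xi : Omega -> R) : s <= u -> u <= v ->
  measurable_wrt (F u) xi -> (forall w, `|xi w| <= 1) ->
  integrableR M (strip u v) (fun z => xi z.2 *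
    generator_integrand h (Y z.1 z.2) (beta z.1 z.2) (simple_value S z.1 z.2)) /\
  \int[P]_w (xi w * (h (Y v w) - h (Y u w))) =
  \int[M]_(z in strip u v) (xi z.2 *
    generator_integrand h (Y z.1 z.2) (beta z.1 z.2) (simple_value S z.1 z.2)).
Proof.
move=> su uv; suff : ito_on u v by exact.
pose tau k := Num.max u (Num.min (tm k) v).
have tau_u k : u <= tau k by rewrite le_max lexx.
have tau_v k : tau k <= v by rewrite ge_max uv ge_min lexx orbT.
have tau_S k : tau k <= tau k.+1.
  have h1 : Num.min (tm k) v <= Num.min (tm k.+1) v.
    by rewrite le_min !ge_min t_S lexx orbT.
  by rewrite /tau ge_max le_max lexx/= le_max h1 orbT.
(* a nondegenerate cell of the clamped subdivision is a genuine one *)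
have inact a b : s <= a -> a <= b -> (a < b -> inactive a b) -> ito_on a b.
  move=> sa; rewrite le_eqVlt => /predU1P[<- _|ab /(_ ab) ina]; first exact: ito_refl.
  apply: (ito_const (V := fun _ => 0) (K := 0)) => //.
  - apply: (coord_F_measurable nF (le_trans s0 sa)) => i j.
    under eq_fun do rewrite mxE; exact: measurable_cst.
  - by move=> w i j; rewrite mxE normr0.
  - by move=> r w ar rb; rewrite (simple_value_inactive w ina).
  - move=> a' b' w aa' ab' bb'; rewrite trmx0 mulmx0.
    apply: simple_integral_inactive => //; case: ina => hh.
      by left; exact: le_trans bb' hh.
    by right; exact: le_trans hh aa'.
have first_piece : ito_on u (tau 0).
  apply: inact => //; rewrite /tau lt_max ltxx/= => hu; left.
  by rewrite max_r ?(ltW hu)// ge_min lexx.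
have cells k : (k <= sp_size S)%N -> ito_on u (tau k).
  elim: k => [//|k IH] kS; apply: (ito_trans su (tau_u k) (tau_S k)); first exact/IH/ltnW.
  have [K K0 bK] := sp_val_bounded.
  have := tau_S k; rewrite le_eqVlt => /predU1P[->|tt]; first exact: ito_refl.
  have tka : tm k <= tau k.
    have := lt_le_trans tt (tau_v k.+1); rewrite /tau !gt_max => /andP[_].
    rewrite gt_min ltxx orbF => kv; by rewrite le_max le_min lexx (ltW kv) orbT.
  have tkb : tau k.+1 <= tm k.+1.
    have := le_lt_trans (tau_u k) tt; rewrite {1}/tau lt_max ltxx/= => hu.
    by rewrite /tau max_r ?(ltW hu)// ge_min lexx.
  apply: (ito_const (V := sp_val S k) (K := K)) => //.
  - exact: le_trans (tau_u k).
  - exact: (F_measurableS nF (t_ge0 k) tka (mVk k)).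
  - by move=> w i j; exact: bK.
  - by move=> r w ar rb; exact: (simple_value_active w kS tka tkb).
  - move=> a b w ua ab bv; apply: simple_integral_active => //.
      exact: le_trans ua.
    exact: le_trans bv tkb.
apply: (ito_trans su (tau_u (sp_size S)) (tau_v _)); first exact: cells.
apply: inact => //; first exact: le_trans (tau_u _).
rewrite /tau gt_max => /andP[_]; rewrite gt_min ltxx orbF => hN; right.
by rewrite le_max le_min lexx (ltW hN) orbT.
Qed.

End SimpleIntegrand.

(** * Passage to the limit of general integrands *)

Lemma small_cvg (R : realType) (a : nat -> R) : (forall n, 0 <= a n) ->
  (forall e, 0 < e -> exists2 u : nat -> R, u @ \oo --> (0 : R) & forall n, a n <= e + u n) ->
  a @ \oo --> (0 : R).
Proof.
move=> a0 H; apply/cvgr0Pnorm_lt => e e0.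
have e2 : 0 < e / 2 by rewrite divr_gt0.
have [u /cvgr0Pnorm_lt/(_ _ e2) hu au] := H _ e2.
apply: filterS hu => n hn; rewrite ger0_norm//.
have := au n; have := ler_norm (u n); lra.
Qed.

Section WeightedConvergence.
Context (R : realType) d (T : measurableType d) (mu : {measure set T -> \bar R}).
Variables (D : set T) (mD : measurable D).
Hypothesis i1 : integrableR mu D (fun _ => 1).

Lemma le_RintegralR (f g : T -> R) : integrableR mu D f -> integrableR mu D g ->
  (forall x, D x -> f x <= g x) ->
  \int[mu]_(x in D) f x <= \int[mu]_(x in D) g x.
Proof. by move=> fi gi fg; apply: le_Rintegral. Qed.

Let tail_cvg (g : T -> R) : (forall x, D x -> 0 <= g x) -> integrableR mu D g ->
  (fun n : nat => \int[mu]_(x in D) (g x - Num.min (g x) n%:R)) @ \oo --> (0 : R).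
Proof.
move=> g0 ig; have mg := integrableR_measurable ig.
have <- : \int[mu]_(x in D) (0 : R) = 0 by rewrite /Rintegral integral0.
apply: (dominated_cvgR mD _ _ _ ig).
- by move=> n; apply: measurable_funB => //; exact: measurable_minr.
- exact: measurable_cst.
- move=> x Dx; apply: cvg_near_cst; near=> n.
  rewrite min_l ?subrr//; near: n; exact: nbhs_infty_ger.
- move=> n x Dx; have [gn|ng] := leP (g x) n%:R; first by rewrite subrr normr0 g0.
  by rewrite ger0_norm ?subr_ge0 ?(ltW ng)// lerBlDr lerDl.
Unshelve. all: by end_near. Qed.

(** An integrable weight does not spoil the convergence in quadratic mean of
    bounded functions: it is bounded up to a small part of its mass. *)
Lemma weight_cvg0 (g : T -> R) (Z : nat -> T -> R) :
  (forall x, D x -> 0 <= g x) -> integrableR mu D g ->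
  (forall n, measurable_fun D (Z n)) -> (forall n x, D x -> 0 <= Z n x <= 1) ->
  (fun n => \int[mu]_(x in D) (Z n x ^+ 2)) @ \oo --> (0 : R) ->
  (fun n => \int[mu]_(x in D) (g x * Z n x)) @ \oo --> (0 : R).
Proof.
move=> g0 ig mZ Z01 cZ.
have nZ n x : D x -> `|Z n x| <= 1.
  by move=> Dx; have /andP[h1 h2] := Z01 n _ Dx; rewrite ger0_norm.
have igZ n : integrableR mu D (fun x => g x * Z n x).
  have := @integrableRM _ _ _ mu D 1 (Z n) g mD ig (mZ n) (nZ n).
  by apply: eq_integrable => // x _ /=; rewrite mulrC.
have iZ2 n : integrableR mu D (fun x => Z n x ^+ 2).
  apply: (le_integrableR mD i1) => [|x Dx]; first exact: measurable_funX.
  by rewrite normrX expr_le1// nZ.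
apply: small_cvg => [n|e e0].
  by apply: Rintegral_ge0 => x Dx; rewrite mulr_ge0 ?g0//; have /andP[] := Z01 n _ Dx.
pose L := \int[mu]_(x in D) (1 : R).
have L0 : 0 <= L by apply: Rintegral_ge0.
have e2 : 0 < e / 2 by rewrite divr_gt0.
have /cvgr0Pnorm_lt/(_ _ e2)[N _ /(_ N (leqnn N)) hN] := tail_cvg g0 ig.
pose e' := e / (2 * (L + 1)).
have L1 : 0 < 2 * (L + 1) by rewrite mulr_gt0// ltr_wpDl.
have e'0 : 0 < e' by rewrite divr_gt0.
exists (fun n => (N%:R ^+ 2 / e') * \int[mu]_(x in D) (Z n x ^+ 2)).
  by rewrite -[X in _ --> X](mulr0 (N%:R ^+ 2 / e')); apply: cvgMr.
move=> n.
have mg := integrableR_measurable ig.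
have it : integrableR mu D (fun x => g x - Num.min (g x) N%:R).
  apply: (le_integrableR mD ig) => [|x Dx].
    by apply: measurable_funB => //; exact: measurable_minr.
  have [gn|ng] := leP (g x) N%:R; first by rewrite subrr normr0 g0.
  by rewrite ger0_norm ?subr_ge0 ?(ltW ng)// lerBlDr lerDl.
have ie : integrableR mu D (fun x => e' * 1) by exact: integrableRZ.
have iz : integrableR mu D (fun x => (N%:R ^+ 2 / e') * Z n x ^+ 2) by exact: integrableRZ.
have ite := integrableRD mD it ie.
apply: (@le_trans _ _ (\int[mu]_(x in D)
    ((g x - Num.min (g x) N%:R + e' * 1) + (N%:R ^+ 2 / e') * Z n x ^+ 2))).
  apply: le_RintegralR => //; first exact: integrableRD.
  move=> x Dx; have /andP[z0 z1] := Z01 n _ Dx; have gx := g0 _ Dx.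
  set k := N%:R; set z := Z n x; rewrite mulr1.
  have k0 : 0 <= k by rewrite ler0n.
  have hk : k * z <= e' + k ^+ 2 / e' * z ^+ 2.
    rewrite -(ler_pM2r e'0).
    have -> : (e' + k ^+ 2 / e' * z ^+ 2) * e' = e' ^+ 2 + (k * z) ^+ 2.
      by field; rewrite gt_eqF.
    by have := sqr_ge0 (k * z - e' / 2); nra.
  have hg : g x * z <= (g x - Num.min (g x) k) + k * z.
    have [gn|/ltW ng] := leP (g x) k; first by rewrite subrr add0r ler_wpM2r.
    have := mulr_ge0 (_ : 0 <= g x - k) (_ : 0 <= 1 - z); rewrite !subr_ge0 ng z1.
    by move=> /(_ isT isT); lra.
  by apply: le_trans hg _; rewrite -[leRHS]addrA lerD2l.
rewrite RintegralD// (RintegralD mD it ie) RintegralZl// RintegralZl ?lerD2r//; last exact: iZ2.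
have hT : \int[mu]_(x in D) (g x - Num.min (g x) N%:R) <= e / 2.
  by apply: ltW; apply: le_lt_trans hN; exact: ler_norm.
have hL : e' * L <= e / 2.
  rewrite /e' -mulrA [(2 * _)^-1]invfM -mulrA ler_pM2l//.
  by rewrite ler_piMr// mulrC ler_pdivrMr ?mul1r ?ltr_wpDl// lerDl.
by rewrite [leRHS](splitr e) lerD.
Qed.

End WeightedConvergence.

Section GeneratorPerturbation.
Context (R : realType) (d m : nat) (h : 'rV[R]_d -> R) (C : R).
Hypothesis jh : jet_bound h C.
Implicit Types (x y be : 'rV[R]_d) (v H : 'M[R]_(d, m)).

Lemma hs_norm2_ge0 p q (a : 'M[R]_(p, q)) : 0 <= hs_norm2 a.
Proof. by apply: sumr_ge0 => i _; apply: sumr_ge0 => j _; exact: sqr_ge0. Qed.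

Lemma weighted_amgm (e a b : R) : 0 < e -> `|a * b| <= (e^-1 * a ^+ 2 + e * b ^+ 2) / 2.
Proof.
move=> e0; rewrite normrM -(real_normK (num_real a)) -(real_normK (num_real b)).
rewrite -subr_ge0; set x := `|a|; set y := `|b|.
have -> : (e^-1 * x ^+ 2 + e * y ^+ 2) / 2 - x * y = (x - e * y) ^+ 2 / (2 * e).
  by field; rewrite gt_eqF.
by rewrite divr_ge0 ?sqr_ge0// mulr_ge0// ltW.
Qed.

Let pairs (v : 'M[R]_(d, m)) i j : R := \sum_(k < m) (v i k ^+ 2 + v j k ^+ 2).

Let sum_pairs v : \sum_(i < d) \sum_(j < d) pairs v i j = 2 * (d%:R * hs_norm2 v).
Proof.
under eq_bigr do under eq_bigr do rewrite /pairs big_split /=.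
under eq_bigr do rewrite big_split /= sumr_const card_ord.
rewrite big_split /= sumrMnl -/(hs_norm2 v) sumr_const card_ord.
by rewrite -/(hs_norm2 v) -[_ *+ d]mulr_natl; ring.
Qed.

Let pairs_ge0 v i j : 0 <= pairs v i j.
Proof. by apply: sumr_ge0 => k _; rewrite addr_ge0// sqr_ge0. Qed.

Let mulmx_tr_pairs H i j : `|(H *m H^T) i j| <= pairs H i j / 2.
Proof.
rewrite mxE (le_trans (ler_norm_sum _ _ _))// /pairs mulr_suml; apply: ler_sum => k _.
by rewrite mxE (le_trans (weighted_amgm _ _ (@ltr01 R)))// invr1 !mul1r.
Qed.

Let mulmx_tr_diff e v H i j : 0 < e ->
  `|(v *m v^T) i j - (H *m H^T) i j| <=
  (1 + e^-1) * (pairs (v - H) i j / 2) + e * (pairs H i j / 2).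
Proof.
move=> e0; rewrite !mxE -sumrB (le_trans (ler_norm_sum _ _ _))//.
rewrite /pairs !mulr_suml !mulr_sumr -big_split /=; apply: ler_sum => k _.
rewrite !mxE.
have -> : v i k * v j k - H i k * H j k = (v i k - H i k) * (v j k - H j k)
    + (v i k - H i k) * H j k + (v j k - H j k) * H i k by ring.
apply: le_trans (ler_normD _ _) _; apply: le_trans (lerD (ler_normD _ _) (lexx _)) _.
have h1 := weighted_amgm (v i k - H i k) (v j k - H j k) (@ltr01 R).
have h2 := weighted_amgm (v i k - H i k) (H j k) e0.
have h3 := weighted_amgm (v j k - H j k) (H i k) e0.
rewrite invr1 !mul1r in h1.
apply: le_trans (lerD (lerD h1 h2) h3) _; rewrite le_eqVlt; apply/orP; left; apply/eqP.
by field; rewrite gt_eqF.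
Qed.

Lemma generator_integrand_growth x be H : `|generator_integrand h x be H| <=
  C * (\sum_(i < d) `|be 0 i|) + d%:R * C / 2 * hs_norm2 H.
Proof.
rewrite /generator_integrand; apply: le_trans (ler_normD _ _) _; apply: lerD.
  apply: le_trans (ler_norm_sum _ _ _) _; rewrite mulr_sumr; apply: ler_sum => i _.
  by rewrite normrM ler_wpM2r// (jet_b1 jh).
rewrite normrM ger0_norm ?invr_ge0//.
have -> : d%:R * C / 2 * hs_norm2 H =
    2^-1 * (\sum_(i < d) \sum_(j < d) C * (pairs H i j / 2)).
  under eq_bigr do rewrite -mulr_sumr -mulr_suml.
  by rewrite -mulr_sumr -mulr_suml sum_pairs; field.
rewrite ler_pM2l ?invr_gt0//; apply: le_trans (ler_norm_sum _ _ _) _.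
apply: ler_sum => i _; apply: le_trans (ler_norm_sum _ _ _) _; apply: ler_sum => j _.
by rewrite normrM; apply: ler_pM => //; exact: (jet_b2 jh).
Qed.

(** The diffusion coefficient enters quadratically: its perturbation is split
    by the weighted arithmetic-geometric inequality, so that the term without
    the small factor [e] only sees the perturbation. *)
Lemma generator_integrand_diff e x y be v H : 0 < e ->
  `|generator_integrand h y be v - generator_integrand h x be H| <=
  (C * (\sum_(i < d) `|be 0 i|) + d%:R * C / 2 * hs_norm2 H) * Num.min 1 `|y - x|
  + d%:R * C / 2 * ((1 + e^-1) * hs_norm2 (v - H) + e * hs_norm2 H).
Proof.
move=> e0; set z := Num.min 1 _.
have C0 := jet_ge0 jh.
have z0 : 0 <= z by rewrite le_min ler01 normr_ge0.
have -> : generator_integrand h y be v - generator_integrand h x be H =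
    \sum_(i < d) (partial i h y - partial i h x) * be 0 i
    + 2^-1 * \sum_(i < d) \sum_(j < d)
      (partial i (partial j h) y * ((v *m v^T) i j - (H *m H^T) i j)
       + (partial i (partial j h) y - partial i (partial j h) x) * (H *m H^T) i j).
  rewrite /generator_integrand opprD addrACA -sumrB; congr (_ + _).
    by apply: eq_bigr => i _; rewrite mulrBl.
  rewrite -mulrBr -sumrB; congr (_ * _); apply: eq_bigr => i _; rewrite -sumrB.
  apply: eq_bigr => j _; move: ((v *m v^T) i j) ((H *m H^T) i j) => p q.
  by rewrite mulrBr mulrBl addrA subrK.
have -> : (C * (\sum_(i < d) `|be 0 i|) + d%:R * C / 2 * hs_norm2 H) * z
    + d%:R * C / 2 * ((1 + e^-1) * hs_norm2 (v - H) + e * hs_norm2 H) =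
    (\sum_(i < d) C * z * `|be 0 i|) + 2^-1 * (\sum_(i < d) \sum_(j < d)
     (C * ((1 + e^-1) * (pairs (v - H) i j / 2) + e * (pairs H i j / 2))
      + C * z * (pairs H i j / 2))).
  have S q : \sum_(i < d) \sum_(j < d) (pairs q i j / 2) = d%:R * hs_norm2 q.
    by under eq_bigr do rewrite -mulr_suml; rewrite -mulr_suml sum_pairs; field.
  have lin (f g : 'I_d -> 'I_d -> R) a1 a2 : \sum_(i < d) \sum_(j < d)
      (a1 * f i j + a2 * g i j) =
      a1 * \sum_(i < d) \sum_(j < d) f i j + a2 * \sum_(i < d) \sum_(j < d) g i j.
    rewrite !mulr_sumr -big_split; apply: eq_bigr => i _ /=.
    by rewrite !mulr_sumr -big_split.
  transitivity (C * z * (\sum_(i < d) `|be 0 i|) + 2^-1 *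
      (C * (1 + e^-1) * (d%:R * hs_norm2 (v - H)) + (C * e + C * z) * (d%:R * hs_norm2 H))).
    by field; rewrite gt_eqF.
  rewrite -!S -lin mulr_sumr; congr (_ + _ * _); apply: eq_bigr => i _.
  apply: eq_bigr => j _; ring.
apply: le_trans (ler_normD _ _) _; apply: lerD.
  apply: le_trans (ler_norm_sum _ _ _) _; apply: ler_sum => i _.
  by rewrite normrM ler_wpM2r// (jet_l1 jh).
rewrite normrM ger0_norm ?invr_ge0// ler_pM2l ?invr_gt0//.
apply: le_trans (ler_norm_sum _ _ _) _; apply: ler_sum => i _.
apply: le_trans (ler_norm_sum _ _ _) _; apply: ler_sum => j _.
apply: le_trans (ler_normD _ _) _; rewrite !normrM; apply: lerD.
  by apply: ler_pM => //; [exact: (jet_b2 jh)|exact: mulmx_tr_diff].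
by apply: ler_pM => //; exact: (jet_l2 jh).
Qed.

End GeneratorPerturbation.

Lemma measurable_generator_integrand (R : realType) (d m : nat) (h : 'rV[R]_d -> R)
    d' (T : measurableType d') (y be : T -> 'rV[R]_d) (v : T -> 'M[R]_(d, m)) :
  test_function h -> measurable_fun setT y ->
  (forall i, measurable_fun setT (fun x => be x 0 i)) ->
  (forall i j, measurable_fun setT (fun x => v x i j)) ->
  measurable_fun setT (fun x => generator_integrand h (y x) (be x) (v x)).
Proof.
move=> th my mbe mv.
have mcomp (g : 'rV[R]_d -> R) : continuous g -> measurable_fun setT (fun x => g (y x)).
  by move=> cg; exact: (measurableT_comp (continuous_measurable_mx cg) my).
have ch1 i : continuous (partial i h) by have [] := th.1 [:: i].
have ch2 i j : continuous (partial i (partial j h)) by have [] := th.1 [:: i; j].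
apply: measurable_funD.
  by apply: measurable_sum => i; apply: measurable_funM => //; exact: (mcomp _ (ch1 i)).
apply: measurable_funM; first exact: measurable_cst.
apply: measurable_sum => i; apply: measurable_sum => j; apply: measurable_funM.
  exact: (mcomp _ (ch2 i j)).
have -> : (fun x => (v x *m (v x)^T) i j) = (fun x => \sum_(k < m) v x i k * v x j k).
  by apply/funext => x; rewrite mxE; apply: eq_bigr => k _; rewrite mxE.
by apply: measurable_sum => k; apply: measurable_funM; exact: mv.
Qed.

Lemma eucl_norm_sq (R : realType) (d : nat) (x : 'rV[R]_d) :
  eucl_norm x ^+ 2 = \sum_(i < d) x 0 i ^+ 2.
Proof. by rewrite sqr_sqrtr//; apply: sumr_ge0 => i _; exact: sqr_ge0. Qed.

Lemma mx_norm_le_eucl (R : realType) (d : nat) (x : 'rV[R]_d) : `|x| <= eucl_norm x.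
Proof.
apply: ler_mxnormP => [|j]; first exact: sqrtr_ge0.
rewrite -sqrtr_sqr ler_wsqrtr// (bigD1 j)//= lerDl.
by apply: sumr_ge0 => k _; exact: sqr_ge0.
Qed.

Lemma hs_norm2_sub_le (R : realType) p q (a b : 'M[R]_(p, q)) :
  hs_norm2 (a - b) <= 2 * hs_norm2 a + 2 * hs_norm2 b.
Proof.
rewrite /hs_norm2 !mulr_sumr -big_split; apply: ler_sum => i _ /=.
rewrite !mulr_sumr -big_split; apply: ler_sum => j _ /=; rewrite !mxE.
by have := sqr_ge0 (a i j + b i j); lra.
Qed.

Lemma measurable_hs_norm2 (R : realType) d (T : measurableType d) (D : set T) p q
    (f : T -> 'M[R]_(p, q)) :
  (forall i j, measurable_fun D (fun x => f x i j)) ->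
  measurable_fun D (fun x => hs_norm2 (f x)).
Proof.
move=> mf; apply: measurable_sum => i; apply: measurable_sum => j.
exact: measurable_funX.
Qed.

Section ItoLimit.
Context (R : realType) (d m : nat) disp (Omega : measurableType disp).
Variables (P : probability Omega R) (F : R -> set (set Omega)).
Variable W : R -> Omega -> 'rV[R]_m.
Hypotheses (nF : normal_filtration P F) (bW : brownian_motion P F W).
Local Notation RT := (measurableTypeR R).
Local Notation M := (time_measure P).
Local Notation mu := (@lebesgue_measure R).
Variables (s : R) (X I beta : R -> Omega -> 'rV[R]_d) (H : R -> Omega -> 'M[R]_(d, m)).
Variable S : nat -> simple_process R d m Omega.
Hypotheses (s0 : 0 <= s) (sS : forall n, simple_from F s (S n)).
Hypothesis aX : forall t, s <= t -> F_measurable F t (X t).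
Hypothesis aI : forall t, s <= t -> F_measurable F t (I t).
Hypothesis cX : forall w, {within `[s, +oo[, continuous (X ^~ w)}.
Hypothesis cI : forall w, {within `[s, +oo[, continuous (I ^~ w)}.
Hypothesis mbeta : forall i, measurable_fun setT (fun z : RT * Omega => beta z.1 z.2 0 i).
Hypothesis ibeta : forall t i, integrableR M (strip s t) (fun z => beta z.1 z.2 0 i).
Hypothesis mH : forall i j, measurable_fun setT (fun z : RT * Omega => H z.1 z.2 i j).
Hypothesis iH : forall t, integrableR M (strip s t) (fun z => hs_norm2 (H z.1 z.2)).
Hypothesis path0 : {ae P, forall w, forall t i, s <= t ->
  X t w 0 i - I t w 0 i = X s w 0 i + \int[mu]_(r in `]s, t]) beta r w 0 i}.
Hypothesis cvH : forall t, s <= t -> (fun n => \int[P]_w \int[mu]_(r in `]s, t])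
  (hs_norm2 (simple_value (S n) r w - H r w))%:E)%E @ \oo --> 0%E.
Hypothesis cvI : forall t, s <= t -> (fun n => \int[P]_w
  (eucl_norm (simple_integral W (S n) t w - I t w) ^+ 2)%:E)%E @ \oo --> 0%E.
Variables (h : 'rV[R]_d -> R) (C : R).
Hypotheses (th : test_function h) (jh : jet_bound h C).
Variables (u v : R) (xi : Omega -> R).
Hypotheses (su : s <= u) (uv : u <= v).
Hypotheses (mxi : measurable_wrt (F u) xi) (bxi : forall w, `|xi w| <= 1).

Let Xc r w := X (Num.max s r) w.
Let Y n := approx_process W s (S n) X I.
Let Z n r w := Num.min 1 `|Y n r w - Xc r w|.
Let D n (z : RT * Omega) := hs_norm2 (simple_value (S n) z.1 z.2 - H z.1 z.2).

Let cXc w : continuous (Xc ^~ w).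
Proof. exact: continuous_clamp (@cX w). Qed.

Let cY n w : continuous (Y n ^~ w).
Proof. exact: (approx_process_continuous bW s0 (sS n) cX cI). Qed.

Let mXc r : measurable_fun setT (Xc r).
Proof.
have sm : s <= Num.max s r by rewrite le_max lexx.
exact: (F_measurable_fun nF (le_trans s0 sm) (aX sm)).
Qed.

Let mY n r : measurable_fun setT (Y n r).
Proof. exact: (approx_process_measurable nF bW s0 (sS n) aX aI). Qed.

Let mjoint (V : R -> Omega -> 'rV[R]_d) :
  (forall r, measurable_fun setT (V r)) -> (forall w, continuous (V ^~ w)) ->
  measurable_fun setT (fun z : RT * Omega => V z.1 z.2).
Proof.
move=> mV cV; apply: measurable_mxP => // i j.
apply: (measurable_process (Y := fun r w => V r w i j)) => [r|w r].
  exact: measurable_fun_coord.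
apply: (@continuous_comp _ _ _ (V ^~ w) (fun x : 'rV[R]_d => x i j)); first exact: cV.
exact: coord_continuous.
Qed.

Let mZ n : measurable_fun setT (fun z : RT * Omega => Z n z.1 z.2).
Proof.
apply: (measurable_process (Y := Z n)) => [r|w r].
  apply: measurable_minr => //.
  apply: (measurableT_comp (f := fun x : 'rV[R]_d => `|x|)).
    by apply: continuous_measurable_mx; exact: norm_continuous.
  apply: measurable_mxP => // i j.
  have -> : (fun w => (Y n r w - Xc r w) i j) = (fun w => Y n r w i j - Xc r w i j).
    by apply/funext => w; rewrite mxE [X in _ + X]mxE.
  by apply: measurable_funB; apply: measurable_fun_coord; [exact: mY|exact: mXc].
apply: (@continuous_min _ _ (cst 1) (fun r => `|Y n r w - Xc r w|)); first exact: cvg_cst.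
apply: cvg_norm; apply: cvgB; [exact: cY|exact: cXc].
Qed.

Let Z01 n r w : 0 <= Z n r w <= 1.
Proof. by rewrite le_min ler01 normr_ge0 ge_min lexx. Qed.

Let mZr n r : measurable_fun setT (Z n r).
Proof. exact: (measurableT_comp (mZ n) (measurable_pair1 r)). Qed.

Let ZE n r w : s <= r -> Z n r w ^+ 2 <=
  eucl_norm (simple_integral W (S n) r w - I r w) ^+ 2.
Proof.
move=> sr; have /andP[z0 _] := Z01 n r w.
rewrite ler_pXn2r ?nnegrE ?sqrtr_ge0//; apply: le_trans (mx_norm_le_eucl _).
rewrite /Z ge_min; apply/orP; right.
rewrite /Y /Xc /approx_process (max_r sr).
by rewrite addrAC [X r w - _ - _]addrAC subrr add0r addrC.
Qed.

Let phi n r : R := \int[P]_w Z n r w ^+ 2.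

Let iZ2 n r : integrableR P setT (fun w => Z n r w ^+ 2).
Proof.
apply: (@bounded_integrableR _ _ _ P 1); first exact: measurable_funX.
by move=> w; have /andP[z0 z1] := Z01 n r w; rewrite normrX ger0_norm ?expr_le1.
Qed.

Let phi_cvg r : s <= r -> (phi ^~ r) @ \oo --> (0 : R).
Proof.
move=> sr; suff : (fun n => (phi n r)%:E) @ \oo --> (0%:E : \bar R) by move/fine_cvg.
apply: (squeeze_cvge _ (cvg_cst 0%E) (cvI sr)); apply: nearW => n; apply/andP; split.
  by rewrite lee_fin; apply: Rintegral_ge0 => w _; exact: sqr_ge0.
rewrite EFin_Rintegral//; apply: ge0_le_integral => //.
- by move=> w _; rewrite lee_fin sqr_ge0.
- by apply/measurable_EFinP; exact: measurable_funX.
- apply/measurable_EFinP; under eq_fun do rewrite eucl_norm_sq.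
  apply: measurable_sum => i; apply: measurable_funX.
  have r0 := le_trans s0 sr.
  have -> : (fun w => (simple_integral W (S n) r w - I r w) 0 i) =
      (fun w => simple_integral W (S n) r w 0 i - I r w 0 i).
    by apply/funext => w; rewrite mxE [X in _ + X]mxE.
  apply: measurable_funB; apply: measurable_fun_coord.
    exact: (F_measurable_fun nF r0 (simple_integral_adapted nF bW s0 (sS n) sr)).
  exact: (F_measurable_fun nF r0 (aI sr)).
- by move=> w _; rewrite lee_fin ZE.
Qed.

Let iS1 : integrableR M (strip u v) (fun=> 1).
Proof.
by apply: (@integrable_strip_bounded _ _ _ _ _ _ 1) => // z _; rewrite normr1.
Qed.

Let Z_strip_cvg : (fun n => \int[M]_(z in strip u v) (Z n z.1 z.2 ^+ 2)) @ \oo --> (0 : R).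
Proof.
have mI : measurable (`]u, v]%classic : set RT) by exact: measurable_itv.
have iZ n : integrableR M (strip u v) (fun z => Z n z.1 z.2 ^+ 2).
  apply: (@integrable_strip_bounded _ _ _ _ _ _ 1) => //; first exact: measurable_funX.
  by move=> z _; have /andP[z0 z1] := Z01 n z.1 z.2; rewrite normrX ger0_norm ?expr_le1.
have phi01 n r : 0 <= phi n r <= 1.
  apply/andP; split; first by apply: Rintegral_ge0 => w _; exact: sqr_ge0.
  rewrite -lee_fin EFin_Rintegral// -(@probability_setT _ _ _ P).
  rewrite -[leRHS]mul1e -integral_cst//; apply: ge0_le_integral => //.
  - by move=> w _; rewrite lee_fin sqr_ge0.
  - by apply/measurable_EFinP; exact: measurable_funX.
  - by move=> w _; rewrite lee_fin; have /andP[z0 z1] := Z01 n r w; rewrite expr_le1.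
have mphi n : measurable_fun setT (phi n : RT -> R).
  have -> : phi n = fine \o fubini_F P (fun z : RT * Omega => (Z n z.1 z.2 ^+ 2)%:E) by [].
  apply: measurableT_comp => //; apply: measurable_fun_fubini_tonelli_F => //.
    by apply/measurable_EFinP; exact: measurable_funX.
  by move=> z; rewrite lee_fin sqr_ge0.
have ione : integrableR mu (`]u, v]%classic : set RT) (fun=> 1).
  have fin : (mu (`]u, v]%classic : set RT) < +oo)%E.
    rewrite (lebesgue_measure_itv `]u, v]).
    by case: ifP => _; rewrite ?ltry// -EFinB ltry.
  apply: measurable_bounded_integrable => //.
  by exists 1; split => // x x1 y _; rewrite normr1 ltW.
have iphi n : integrableR mu (`]u, v]%classic : set RT) (phi n).
  apply: (le_integrableR mI ione); first exact: measurable_funTS.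
  by move=> r _; have /andP[p0 p1] := phi01 n r; rewrite ger0_norm.
have -> : (fun n => \int[M]_(z in strip u v) (Z n z.1 z.2 ^+ 2)) =
    (fun n => \int[mu]_(r in `]u, v]) phi n r).
  apply/funext => n; apply: EFin_inj; rewrite Rintegral_strip_time// EFin_Rintegral//.
  by apply: eq_integral => r _; rewrite /phi EFin_Rintegral.
have <- : \int[mu]_(r in `]u, v]) (0 : R) = 0 by rewrite /Rintegral integral0.
apply: (dominated_cvgR mI _ _ _ ione).
- by move=> n; apply: measurable_funTS; exact: mphi.
- exact: measurable_cst.
- move=> r; rewrite /= in_itv/= => /andP[/ltW ur _]; apply: phi_cvg; exact: le_trans ur.
- by move=> n r _; have /andP[p0 p1] := phi01 n r; rewrite ger0_norm.
Qed.

Let mS : measurable (strip u v : set (RT * Omega)). Proof. exact: measurable_strip. Qed.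

Let msv n i j : measurable_fun setT (fun z : RT * Omega => simple_value (S n) z.1 z.2 i j).
Proof. exact: (measurable_simple_value nF s0 (sS n)). Qed.

Let mD n : measurable_fun setT (D n).
Proof.
apply: measurable_hs_norm2 => i j.
have -> : (fun z : RT * Omega => (simple_value (S n) z.1 z.2 - H z.1 z.2) i j) =
    (fun z => simple_value (S n) z.1 z.2 i j - H z.1 z.2 i j).
  by apply/funext => z; rewrite mxE [X in _ + X]mxE.
by apply: measurable_funB; [exact: msv|exact: mH].
Qed.

Let iSn n t : integrableR M (strip s t) (fun z => hs_norm2 (simple_value (S n) z.1 z.2)).
Proof.
have [st|ts] := leP s t; last first.
  have -> : strip s t = set0 :> set (RT * Omega).
    rewrite -subset0 => -[r w] [/= + _]; rewrite in_itv/= => /andP[h1 h2].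
    by move: (lt_le_trans h1 h2); rewrite ltNge (ltW ts).
  exact: integrable_set0.
have [K K0 hK] := sp_val_bounded (sS n).
pose B := (sp_size (S n))%:R * K; have B0 : 0 <= B by rewrite mulr_ge0.
have hB r w i j : `|simple_value (S n) r w i j| <= B.
  rewrite /simple_value summxE (le_trans (ler_norm_sum _ _ _))//.
  rewrite /B -[sp_size (S n) in leRHS]card_ord mulr_natl -sumr_const.
  apply: ler_sum => k _; rewrite mxE normrM; case: (_ && _); last by rewrite normr0 mul0r.
  by rewrite normr1 mul1r hK.
apply: (@integrable_strip_bounded _ _ _ P s t (\sum_(i < d) \sum_(j < m) B ^+ 2)) => //.
  exact: measurable_hs_norm2.
move=> z _; rewrite ger0_norm ?hs_norm2_ge0//; apply: ler_sum => i _; apply: ler_sum => j _.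
by rewrite -real_normK ?num_real// ler_pXn2r ?nnegrE.
Qed.

Let iD n t : integrableR M (strip s t) (D n).
Proof.
have i2 : integrableR M (strip s t) (fun z =>
    2 * hs_norm2 (simple_value (S n) z.1 z.2) + 2 * hs_norm2 (H z.1 z.2)).
  have ms := @measurable_strip R _ Omega s t.
  exact: (integrableRD ms (integrableRZ _ ms (iSn n t)) (integrableRZ _ ms (iH t))).
apply: (le_integrableR (measurable_strip s t) i2); first exact: measurable_funTS.
by move=> z _; rewrite ger0_norm ?hs_norm2_ge0//; exact: hs_norm2_sub_le.
Qed.

Let D_cvg : (fun n => \int[M]_(z in strip u v) D n z) @ \oo --> (0 : R).
Proof.
have D0 n z : 0 <= D n z by exact: hs_norm2_ge0.
have cs : (fun n => \int[M]_(z in strip s v) D n z) @ \oo --> (0 : R).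
  have -> : (fun n => \int[M]_(z in strip s v) D n z) = fine \o (fun n =>
      \int[P]_w \int[mu]_(r in `]s, v]) (hs_norm2 (simple_value (S n) r w - H r w))%:E)%E.
    by apply/funext => n /=; rewrite -(ge0_integral_strip P s v (mD n) (D0 n)).
  exact: fine_cvg (cvH (le_trans su uv)).
apply: (squeeze_cvgr _ (cvg_cst 0) cs); apply: nearW => n; apply/andP; split.
  by apply: Rintegral_ge0 => z _; exact: D0.
rewrite (Rintegral_strip_setU su uv (iD n v)) lerDr.
by apply: Rintegral_ge0 => z _; exact: D0.
Qed.

Let C0 : 0 <= C. Proof. exact: jet_ge0 jh. Qed.

Let G (z : RT * Omega) := generator_integrand h (Xc z.1 z.2) (beta z.1 z.2) (H z.1 z.2).
Let Gn n (z : RT * Omega) :=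
  generator_integrand h (Y n z.1 z.2) (beta z.1 z.2) (simple_value (S n) z.1 z.2).

Let sub_strip f : integrableR M (strip s v) f -> integrableR M (strip u v) f.
Proof. exact: integrable_stripS. Qed.

Let iB1 : integrableR M (strip u v) (fun z => \sum_(i < d) `|beta z.1 z.2 0 i|).
Proof.
by apply: integrableR_sum => // i; apply: integrableR_norm; apply: sub_strip; exact: ibeta.
Qed.

Let ig : integrableR M (strip u v)
  (fun z => C * (\sum_(i < d) `|beta z.1 z.2 0 i|) + d%:R * C / 2 * hs_norm2 (H z.1 z.2)).
Proof. exact: (integrableRD mS (integrableRZ _ mS iB1) (integrableRZ _ mS (sub_strip (iH v)))). Qed.

Let mG : measurable_fun setT G.
Proof. by apply: measurable_generator_integrand => //; exact: mjoint. Qed.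

Let mGn n : measurable_fun setT (Gn n).
Proof. by apply: measurable_generator_integrand => //; exact: mjoint. Qed.

Let iG : integrableR M (strip u v) G.
Proof.
apply: (le_integrableR mS ig); first exact: measurable_funTS.
move=> z _; exact: generator_integrand_growth.
Qed.

Let iGn n : integrableR M (strip u v) (Gn n).
Proof.
have i2 : integrableR M (strip u v) (fun z => C * (\sum_(i < d) `|beta z.1 z.2 0 i|)
    + d%:R * C / 2 * hs_norm2 (simple_value (S n) z.1 z.2)).
  exact: (integrableRD mS (integrableRZ _ mS iB1) (integrableRZ _ mS (sub_strip (iSn n v)))).
apply: (le_integrableR mS i2); first exact: measurable_funTS.
by move=> z _; exact: generator_integrand_growth.
Qed.

Let G_cvg : (fun n => \int[M]_(z in strip u v) `|Gn n z - G z|) @ \oo --> (0 : R).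
Proof.
pose g z := C * (\sum_(i < d) `|beta z.1 z.2 0 i|) + d%:R * C / 2 * hs_norm2 (H z.1 z.2).
have g0 z : 0 <= g z.
  apply: addr_ge0; apply: mulr_ge0 => //; rewrite ?hs_norm2_ge0//.
  - by apply: sumr_ge0.
  - by rewrite !mulr_ge0.
have gZ := weight_cvg0 mS iS1 (fun z _ => g0 z) ig (fun n => measurable_funTS (mZ n))
  (fun n z _ => Z01 n z.1 z.2) Z_strip_cvg.
have iHs := sub_strip (iH v).
apply: small_cvg => [n|e e0]; first by apply: Rintegral_ge0.
pose c := d%:R * C / 2; have c0 : 0 <= c by rewrite !mulr_ge0.
pose q := \int[M]_(z in strip u v) hs_norm2 (H z.1 z.2).
have q0 : 0 <= q by apply: Rintegral_ge0 => z _; exact: hs_norm2_ge0.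
pose e' := e / (c * q + 1).
have e'0 : 0 < e' by rewrite divr_gt0// ltr_wpDl// mulr_ge0.
exists (fun n => \int[M]_(z in strip u v) (g z * Z n z.1 z.2)
    + c * (1 + e'^-1) * \int[M]_(z in strip u v) D n z).
  rewrite -[X in _ --> X]addr0 -[X in _ --> _ + X](mulr0 (c * (1 + e'^-1))).
  by apply: cvgD => //; apply: cvgMr.
move=> n.
have igZ : integrableR M (strip u v) (fun z => g z * Z n z.1 z.2).
  have := @integrableRM _ _ _ M (strip u v) 1 (fun z => Z n z.1 z.2) g mS ig
    (measurable_funTS (mZ n)).
  have b1 x : strip u v x -> `|Z n x.1 x.2| <= 1.
    by move=> _; have /andP[z0 z1] := Z01 n x.1 x.2; rewrite ger0_norm.
  by move=> /(_ b1); apply: eq_integrable => // x _ /=; rewrite mulrC.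
have iDn := sub_strip (iD n v).
have i2 : integrableR M (strip u v) (fun z => c * (1 + e'^-1) * D n z) by exact: integrableRZ.
have i3 : integrableR M (strip u v) (fun z => c * e' * hs_norm2 (H z.1 z.2)).
  exact: integrableRZ.
have i12 := integrableRD mS igZ i2.
apply: (@le_trans _ _ (\int[M]_(z in strip u v)
   ((g z * Z n z.1 z.2 + c * (1 + e'^-1) * D n z) + c * e' * hs_norm2 (H z.1 z.2)))).
  apply: le_RintegralR => //.
  - exact: integrableR_norm (integrableRB mS (iGn n) iG).
  - exact: integrableRD.
  move=> z _; apply: le_trans (generator_integrand_diff jh _ _ _ _ _ e'0) _.
  by rewrite -/(g z) -/(D n z) -/c mulrDr !mulrA addrA.
rewrite (RintegralD mS i12 i3) (RintegralD mS igZ i2) !RintegralZl// [leRHS]addrC lerD2l.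
rewrite -/q -mulrA [e' * q]mulrC mulrA /e' mulrA ler_pdivrMr ?ltr_wpDl ?mulr_ge0//.
by rewrite mulrC ler_pM2l// lerDl.
Qed.

Let h_cvg t : s <= t ->
  (fun n => \int[P]_w `|h (Y n t w) - h (Xc t w)|) @ \oo --> (0 : R).
Proof.
move=> st; have i1 : integrableR P setT (fun=> 1).
  by apply: (@bounded_integrableR _ _ _ P 1) => // x; rewrite normr1.
have := weight_cvg0 measurableT i1 (fun _ _ => ler01) i1 (fun n => mZr n t)
  (fun n w _ => Z01 n t w) (phi_cvg st) => cZ.
have {}cZ : (fun n => C * \int[P]_w (1 * Z n t w)) @ \oo --> (0 : R).
  by rewrite -[X in _ --> X](mulr0 C); apply: cvgMr.
apply: (squeeze_cvgr _ (cvg_cst 0) cZ); apply: nearW => n; apply/andP; split.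
  exact: Rintegral_ge0.
have iZ : integrableR P setT (fun w => 1 * Z n t w).
  apply: (@bounded_integrableR _ _ _ P 1); first exact: measurable_funM.
  by move=> w; have /andP[z0 z1] := Z01 n t w; rewrite mul1r ger0_norm.
have ch : continuous h by have [] := th.1 [::].
have mh (V : Omega -> 'rV[R]_d) : measurable_fun setT V -> measurable_fun setT (h \o V).
  by move=> mV; apply: measurableT_comp => //; exact: continuous_measurable_mx.
rewrite -RintegralZl//; apply: le_RintegralR => //.
- apply: integrableR_norm; apply: (@bounded_integrableR _ _ _ P (C + C)).
    by apply: measurable_funB; apply: mh.
  by move=> w; rewrite (le_trans (ler_normB _ _))// lerD// (jet_b0 jh).
- exact: integrableRZ.
- by move=> w _; rewrite mul1r; exact: (jet_l0 jh).
Qed.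

(** The Ito formula in expectation, tested against the information available
    at the initial time. *)
Lemma ito_formula :
  integrableR M (strip u v) (fun z => xi z.2 *
    generator_integrand h (X z.1 z.2) (beta z.1 z.2) (H z.1 z.2)) /\
  \int[P]_w (xi w * (h (X v w) - h (X u w))) = \int[M]_(z in strip u v) (xi z.2 *
    generator_integrand h (X z.1 z.2) (beta z.1 z.2) (H z.1 z.2)).
Proof.
have sv := le_trans su uv.
have GE z : strip u v z ->
    generator_integrand h (X z.1 z.2) (beta z.1 z.2) (H z.1 z.2) = G z.
  move=> [/= + _]; rewrite in_itv/= => /andP[/ltW/(le_trans su) sz _].
  by rewrite /G /Xc (max_r sz).
have mxi' := measurable_wrt_measurable (filtration_measurable nF (le_trans s0 su)) mxi.
have ixi f : integrableR M (strip u v) f -> integrableR M (strip u v) (fun z => xi z.2 * f z).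
  move=> fi; exact: (Rintegral_strip_mul mxi' bxi fi).1.
split.
  have := ixi _ iG; apply: eq_integrable; first exact: mS.
  by move=> z /set_mem zS; exact: (congr1 (fun y => (xi z.2 * y)%:E) (esym (GE z zS))).
rewrite [RHS](@eq_Rintegral _ _ _ M _ (fun z => xi z.2 * G z)); last first.
  by move=> z /set_mem zS; exact: (congr1 (fun y => xi z.2 * y) (GE z zS)).
have XE t : s <= t -> X t = Xc t by move=> st; rewrite /Xc (max_r st).
rewrite (XE _ su) (XE _ sv).
have ch : continuous h by have [] := th.1 [::].
have mh (V : Omega -> 'rV[R]_d) : measurable_fun setT V -> measurable_fun setT (h \o V).
  by move=> mV; apply: measurableT_comp => //; exact: continuous_measurable_mx.
have ih (V1 V2 : Omega -> 'rV[R]_d) : measurable_fun setT V1 -> measurable_fun setT V2 ->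
    integrableR P setT (fun w => h (V1 w) - h (V2 w)).
  move=> m1 m2; apply: (@bounded_integrableR _ _ _ P (C + C)).
    by apply: measurable_funB; apply: mh.
  by move=> w; rewrite (le_trans (ler_normB _ _))// lerD// (jet_b0 jh).
have ixh (V1 V2 : Omega -> 'rV[R]_d) : measurable_fun setT V1 -> measurable_fun setT V2 ->
    integrableR P setT (fun w => xi w * (h (V1 w) - h (V2 w))).
  move=> m1 m2; exact: (@integrableRM _ _ _ P setT 1 _ _ measurableT (ih _ _ m1 m2)).
set lhs := \int[P]_w _; set rhs := \int[M]_(z in _) _.
have bound n : `|lhs - rhs| <= (\int[P]_w `|h (Y n v w) - h (Xc v w)|
    + \int[P]_w `|h (Y n u w) - h (Xc u w)|) + \int[M]_(z in strip u v) `|Gn n z - G z|.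
  have [_ E] := ito_simple nF bW s0 (sS n) aX aI cX cI mbeta ibeta path0 th jh su uv mxi bxi.
  set lhsn := \int[P]_w (xi w * (h (Y n v w) - h (Y n u w))).
  have E' : lhsn = \int[M]_(z in strip u v) (xi z.2 * Gn n z) by exact: E.
  have -> : lhs - rhs = (lhs - lhsn) + (lhsn - rhs) by rewrite addrA subrK.
  apply: le_trans (ler_normD _ _) _; apply: lerD.
    rewrite distrC /lhs /lhsn -RintegralB//; [|exact: ixh|exact: ixh].
    have i1 := integrableR_norm (ih _ _ (mY n v) (mXc v)).
    have i2 := integrableR_norm (ih _ _ (mY n u) (mXc u)).
    rewrite -RintegralD//.
    have i3 := integrableRB measurableT (ixh _ _ (mY n v) (mY n u)) (ixh _ _ (mXc v) (mXc u)).
    apply: le_trans (le_normr_Rintegral measurableT i3) _.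
    apply: le_RintegralR => //; [exact: integrableR_norm|exact: integrableRD|].
    move=> w _; rewrite -mulrBr normrM -[leRHS]mul1r ler_pM//.
    by rewrite opprD addrACA -opprD; exact: ler_normB.
  have iE := ixi _ (iGn n); have iE2 := ixi _ iG.
  rewrite E' /rhs -RintegralB//.
  apply: le_trans (le_normr_Rintegral mS (integrableRB mS iE iE2)) _.
  apply: le_RintegralR => //.
  - exact: integrableR_norm (integrableRB mS iE iE2).
  - exact: integrableR_norm (integrableRB mS (iGn n) iG).
  - by move=> z _; rewrite -mulrBr normrM -[leRHS]mul1r ler_pM.
have cv : (fun n => (\int[P]_w `|h (Y n v w) - h (Xc v w)|
    + \int[P]_w `|h (Y n u w) - h (Xc u w)|) + \int[M]_(z in strip u v) `|Gn n z - G z|)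
    @ \oo --> (0 : R).
  by rewrite -[X in _ --> X]addr0 -[X in _ --> X + _]addr0; apply: cvgD => //;
    apply: cvgD; exact: h_cvg.
have : `|lhs - rhs| <= 0.
  by apply: (ler_cvg_to (cvg_cst `|lhs - rhs|) cv); apply: nearW => n; exact: bound.
by rewrite normr_le0 subr_eq0 => /eqP.
Qed.

End ItoLimit.

(** * Laws as points and paths in the space of probability measures *)

Section Laws.
Context (R : realType) (d : nat).
Local Notation RT := (measurableTypeR R).
Implicit Types mu nu : Pr R d.

Lemma measure_eq_integrate mu nu : measure_eq mu nu -> integrate mu = integrate nu.
Proof.
move=> E; apply/funext => f; rewrite /integrate /Rintegral; congr fine.
by apply: eq_measure_integral => B mB _; exact: E.
Qed.

(** The topology only sees the integrals of continuous functions, so that no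
    Borel set separates two measures that agree on Borel sets. *)
Lemma measure_eq_borel (B : set (Pr R d)) mu nu : measurable B -> measure_eq mu nu ->
  B mu -> B nu.
Proof.
move=> mB E; suff : (B mu <-> B nu) by move=> -[].
pose C := [set B : set (Pr R d) | B mu <-> B nu].
suff : C B by [].
apply: mB; split; last first.
  by move=> U [V oV <-]; rewrite /C /= /preimage /= (measure_eq_integrate E).
split.
- by [].
- by move=> A CA; split=> -[_ h]; split => // Ah; apply: h; exact/CA.
- move=> A CA /=; rewrite /bigcup /=; split => -[i _ Ai]; exists i => //; exact/CA.
Qed.

Lemma coef_dom_measurable : measurable
  ([set t : R | 0 <= t] `*` [set: 'rV[R]_d] `*` [set: Pr R d]).
Proof.
have -> : [set t : R | 0 <= t] = `[0, +oo[%classic.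
  by apply/seteqP; split => t /=; rewrite in_itv/= andbT.
by apply: measurableX => //; apply: measurableX.
Qed.

Lemma coef_measure_eq p q (f : R -> 'rV[R]_d -> Pr R d -> 'M[R]_(p, q)) t x mu nu :
  borel_coef f -> 0 <= t -> measure_eq mu nu -> f t x mu = f t x nu.
Proof.
move=> mf t0 E.
have mA := mf coef_dom_measurable _ (measurable_singleton_mx (f t x mu)).
have mB := measurable_xsection (t, x) mA.
have := measure_eq_borel mB E; rewrite /xsection /= !inE /=.
by move=> h; have [] := h (conj (conj (conj t0 I) I) erefl).
Qed.

Lemma continuous_measurable_Pr (lam : R -> Pr R d) : continuous lam ->
  measurable_fun setT (lam : RT -> Pr R d).
Proof.
move=> /continuousP cl; apply: (@measurability _ _ _ _ setT (lam : RT -> Pr R d) (@open (Pr R d)) erefl).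
by move=> _ [U oU <-]; rewrite setTI; apply: open_measurable; exact: cl.
Qed.

Lemma measurable_coef_process p q (f : R -> 'rV[R]_d -> Pr R d -> 'M[R]_(p, q))
    disp (Omega : measurableType disp) (tau : R -> R) (Y : R -> Omega -> 'rV[R]_d)
    (lam : R -> Pr R d) i j :
  borel_coef f -> (forall r, 0 <= tau r) -> measurable_fun setT (tau : RT -> R) ->
  measurable_fun setT (fun z : RT * Omega => Y z.1 z.2) ->
  measurable_fun setT (lam : RT -> Pr R d) ->
  measurable_fun setT (fun z : RT * Omega => f (tau z.1) (Y z.1 z.2) (lam z.1) i j).
Proof.
move=> mf tau0 mtau mY ml; apply: measurable_fun_coord.
apply: (measurable_comp coef_dom_measurable _ mf
  (g := fun z : RT * Omega => ((tau z.1, Y z.1 z.2), lam z.1))).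
  by move=> _ [z _ <-]; do 2! split => //=.
apply: measurable_fun_pair; first apply: measurable_fun_pair => //.
- exact: (measurableT_comp mtau measurable_fst).
- exact: (measurableT_comp ml measurable_fst).
Qed.

End Laws.
Section LawProcess.
Context (R : realType) (d : nat) disp (Omega : measurableType disp).
Variable P : probability Omega R.
Variable X : R -> {RV P >-> 'rV[R]_d}.

Lemma integral_law t (f : 'rV[R]_d -> R) : measurable_fun setT f ->
  (\int[law X t]_x (f x)%:E = \int[P]_w (f (X t w))%:E)%E.
Proof.
move=> mf; have mE : measurable_fun setT (EFin \o f) by exact/measurable_EFinP.
rewrite integralE [RHS]integralE; congr (_ - _)%E.
- have := @ge0_integral_distribution _ _ _ _ _ P (X t) ((EFin \o f)^\+)%E
    (measurable_funepos mE) (funepos_ge0 _).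
  by rewrite -funepos_comp.
- have := @ge0_integral_distribution _ _ _ _ _ P (X t) ((EFin \o f)^\-)%E
    (measurable_funeneg mE) (funeneg_ge0 _).
  by rewrite -funeneg_comp.
Qed.

Variable s : R.
Hypothesis cX : forall w, {within `[s, +oo[, continuous (fun t => X t w)}.

Lemma law_continuous : continuous (fun r => law X (Num.max s r)).
Proof.
apply: continuous_comp_initial => r0; apply/cvg_sup => f U /=.
move=> [?/= [[V oV <-]]] /= Vr /filterS; apply; first exact: fmap_filter.
have [cf [K [_ HK]]] := svalP f.
have mf := continuous_measurable_mx cf.
have fb x : `|sval f x| <= `|K| + 1.
  apply: (HK (`|K| + 1)) => //; have := ler_norm K; lra.
have lawE r : integrate (law X r) f = \int[P]_w (sval f (X r w)).
  by rewrite /integrate /Rintegral integral_law.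
have cv : (fun r => integrate (law X (Num.max s r)) f) @ r0 --> integrate (law X (Num.max s r0)) f.
  apply/(@cvg_nbhsP _ R^o) => u ur; rewrite lawE.
  under eq_fun do rewrite lawE.
  apply: (@dominated_cvgR _ _ _ P setT _ _ (fun=> `|K| + 1)) => //.
  - by move=> n; exact: measurableT_comp.
  - exact: measurableT_comp.
  - move=> w _; have cc : continuous (fun r => sval f (X (Num.max s r) w)).
      move=> r; apply: (@continuous_comp _ _ _ (fun r => X (Num.max s r) w) (sval f)).
        exact: (@continuous_clamp _ _ s (fun r => X r w) (@cX w) r).
      exact: cf.
    by have /(@cvg_nbhsP _ R^o)/(_ u ur) := cc r0.
  - apply: (@bounded_integrableR _ _ _ P (`|K| + 1)) => // x.
    by rewrite ger0_norm ?addr_ge0.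
exact: (cv V (open_nbhs_nbhs (conj oV Vr))).
Qed.

Lemma law_cpath u : s <= u -> cpath u setT (law X).
Proof.
move=> su; split => //.
have c := continuous_subspaceT (A := `[u, +oo[%classic) law_continuous.
apply: subspace_eq_continuous c => t; rewrite inE /= in_itv/= andbT => ut.
by transitivity (law X (Num.max s t)) => //; rewrite max_r// (le_trans su).
Qed.

End LawProcess.

(** Conditioning on an event of positive probability *)
Section Conditioning.
Context (R : realType) disp (Omega : measurableType disp).
Variables (P : probability Omega R) (G : set Omega) (mG : measurable G).

Definition conditioned : probability Omega R := mnormalize (mrestr P mG) P.

Hypothesis PG0 : (0 < P G)%E.
Local Notation c := ((fine (P G))^-1).

Let finG : P G \is a fin_num. Proof. exact: fin_num_measure. Qed.

Lemma conditioning_factor_gt0 : 0 < c.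
Proof. by rewrite invr_gt0 fine_gt0// PG0 ltey_eq finG. Qed.
Local Notation c0 := conditioning_factor_gt0.

Lemma conditionedE B : conditioned B = (P (B `&` G) * c%:E)%E.
Proof.
rewrite /conditioned /= /mnormalize /= /mrestr setTI.
have Goo : (P G == +oo)%E = false by move: finG; case: (P G).
by rewrite gt_eqF//= Goo.
Qed.

Lemma conditioned_le B : measurable B -> (conditioned B <= c%:E * P B)%E.
Proof.
move=> mB; rewrite conditionedE muleC lee_pmul2l//; last by rewrite lte_fin c0.
by apply: le_measure; rewrite ?inE//; exact: measurableI.
Qed.

Lemma integral_conditioned (f : Omega -> R) : measurable_fun setT f ->
  (\int[conditioned]_w (f w)%:E = \int[P]_w (c * (\1_G w * f w))%:E)%E.
Proof.
move=> mf.
have ge0 (g : Omega -> R) : measurable_fun setT g -> (forall w, 0 <= g w) ->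
    (\int[conditioned]_w (g w)%:E = \int[P]_w (c * (\1_G w * g w))%:E)%E.
  move=> mg g0; have mgE : measurable_fun setT (EFin \o g) by exact/measurable_EFinP.
  have cge0 := ltW c0.
  transitivity (\int[mscale (NngNum cge0) (mrestr P mG)]_w (g w)%:E)%E.
    by apply: eq_measure_integral => B mB _; rewrite [LHS]conditionedE /= /mscale /= muleC.
  rewrite ge0_integral_mscale//; last by move=> w _; rewrite lee_fin.
  rewrite ge0_integral_mrestr//.
  have mr : measurable_fun setT ((EFin \o g) \_ G).
    by apply/(measurable_restrictT _ mG); exact: measurable_funTS.
  have r0 w : setT w -> (0 <= ((EFin \o g) \_ G) w)%E.
    by rewrite patchE; case: ifP => _; rewrite ?lee_fin.
  rewrite integral_mkcond; rewrite -(ge0_integralZl P measurableT mr r0)//=.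
  apply: eq_integral => w _; rewrite patchE indicE; case: ifP => _.
    by rewrite mul1r -EFinM.
  by rewrite mul0r mulr0 mule0.
have c1 w : 0 <= c * \1_G w by rewrite mulr_ge0 ?(ltW c0)// indicE.
rewrite integralE [RHS]integralE; congr (_ - _)%E.
- rewrite [LHS](_ : _ = \int[conditioned]_w (Num.max (f w) 0)%:E)%E; last first.
    by apply: eq_integral => w _; rewrite funeposE EFin_max.
  rewrite ge0; [|exact: measurable_maxr|by move=> w; rewrite le_max lexx orbT].
  apply: eq_integral => w _; rewrite funeposE -EFin_max !mulrA.
  by rewrite maxr_pMr ?mulr0.
- rewrite [LHS](_ : _ = \int[conditioned]_w (Num.max (- f w) 0)%:E)%E; last first.
    by apply: eq_integral => w _; rewrite funenegE EFin_max EFinN.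
  rewrite ge0; [|by apply: measurable_maxr => //; exact: measurableT_comp
    |by move=> w; rewrite le_max lexx orbT].
  apply: eq_integral => w _; rewrite funenegE -EFinN -EFin_max !mulrA -mulrN.
  by rewrite maxr_pMr ?mulr0.
Qed.

End Conditioning.

(** * Laws of weak solutions solve the Fokker-Planck equation *)

Section SectionMeasurability.
Context (R : realType) disp (Omega : measurableType disp) (P : probability Omega R).
Local Notation RT := (measurableTypeR R).

Lemma measurable_time_expectation (f : RT * Omega -> R) : measurable_fun setT f ->
  measurable_fun setT (fun r : RT => \int[P]_w (f (r, w))%:E)%E.
Proof.
move=> mf; have mE : measurable_fun setT (EFin \o f) by exact/measurable_EFinP.
have -> : (fun r : RT => \int[P]_w (f (r, w))%:E)%E = (fun r : RT =>
    fubini_F P ((EFin \o f)^\+)%E r - fubini_F P ((EFin \o f)^\-)%E r)%E.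
  apply/funext => r; rewrite integralE /fubini_F; congr (_ - _)%E.
    by apply: eq_integral => w _; rewrite !funeposE.
  by apply: eq_integral => w _; rewrite !funenegE.
apply: emeasurable_funB; apply: measurable_fun_fubini_tonelli_F => //.
- exact: measurable_funepos.
- exact: measurable_funeneg.
Qed.

Lemma measurable_section_fst (f : RT * Omega -> R) w : measurable_fun setT f ->
  measurable_fun setT (fun r : RT => f (r, w)).
Proof. by move=> mf; apply: (measurableT_comp mf); exact: measurable_pair2. Qed.

End SectionMeasurability.

Lemma measurable_coef_section (R : realType) (d p q : nat)
    (f : R -> 'rV[R]_d -> Pr R d -> 'M[R]_(p, q)) t mu i j :
  borel_coef f -> 0 <= t -> measurable_fun setT (fun x => f t x mu i j).
Proof.
move=> mf t0; apply: measurable_fun_coord.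
pose g (x : 'rV[R]_d) : R * 'rV[R]_d * Pr R d := (t, x, mu).
have mg : measurable_fun setT g.
  by apply: measurable_fun_pair => //; apply: measurable_fun_pair.
have sub : g @` setT `<=` [set t : R | 0 <= t] `*` [set: 'rV[R]_d] `*` [set: Pr R d].
  by move=> _ [z _ <-]; do 2! split => //=.
exact: (measurable_comp (@coef_dom_measurable R d) sub mf mg).
Qed.

Lemma measurable_eucl_norm (R : realType) (d : nat) d' (T : measurableType d') (D : set T)
    (f : T -> 'rV[R]_d) :
  (forall i, measurable_fun D (fun x => f x 0 i)) ->
  measurable_fun D (fun x => eucl_norm (f x)).
Proof.
move=> mf; apply: (measurableT_comp (f := @Num.sqrt R)).
  by apply: continuous_measurable_fun; exact: sqrt_continuous.
by apply: measurable_sum => i; exact: measurable_funX.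
Qed.

Lemma generator_integrandE (R : realType) (d m : nat)
    (b : R -> 'rV[R]_d -> Pr R d -> 'rV[R]_d)
    (sigma : R -> 'rV[R]_d -> Pr R d -> 'M[R]_(d, m)) t mu h x :
  generator_integrand h x (b t x mu) (sigma t x mu) = generator b sigma t mu h x.
Proof.
rewrite /generator /generator_integrand addrC; congr (_ * _ + _).
  by apply: eq_bigr => i _; apply: eq_bigr => j _; rewrite mulrC.
by apply: eq_bigr => i _; rewrite mulrC.
Qed.

Section WeakSolutionLaw.
Context (R : realType) (d m : nat).
Variable b : R -> 'rV[R]_d -> Pr R d -> 'rV[R]_d.
Variable sigma : R -> 'rV[R]_d -> Pr R d -> 'M[R]_(d, m).
Hypotheses (bb : borel_coef b) (bsigma : borel_coef sigma).
Context (disp : measure_display) (Omega : measurableType disp).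
Variables (P : probability Omega R) (F : R -> set (set Omega)).
Variables (W : R -> Omega -> 'rV[R]_m) (X : R -> {RV P >-> 'rV[R]_d}).
Variables (s : R) (zeta : Pr R d).
Hypotheses (s0 : 0 <= s) (ws : weak_solution b sigma F W X s zeta).
Local Notation RT := (measurableTypeR R).
Local Notation M := (time_measure P).
Local Notation mu := (@lebesgue_measure R).

Let nF : normal_filtration P F. Proof. by case: ws => [[]]. Qed.
Let bW : brownian_motion P F W. Proof. by case: ws => [[]]. Qed.
Let cX w : {within `[s, +oo[, continuous (fun t => X t w)}.
Proof. by case: ws => _ [h _] _ _ _; exact: h. Qed.
Let aX t : s <= t -> F_measurable F t (X t).
Proof. by case: ws => _ [_ h] _ _ _; exact: h. Qed.

(* the coefficients along the path, frozen before the initial time in order to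
   be measurable on the whole line *)
Let time r := Num.max s r.
Let Xs r w : 'rV[R]_d := X (time r) w.
Let drift r w : 'rV[R]_d := b (time r) (Xs r w) (law X (time r)).
Let diff r w : 'M[R]_(d, m) := sigma (time r) (Xs r w) (law X (time r)).

Let timeE r : s <= r -> time r = r. Proof. by move=> sr; rewrite /time max_r. Qed.
Let time0 r : 0 <= time r. Proof. by rewrite /time le_max s0. Qed.

Let mtime : measurable_fun setT (time : RT -> R).
Proof. exact: measurable_maxr. Qed.

Let mXs : measurable_fun setT (fun z : RT * Omega => Xs z.1 z.2).
Proof.
apply: measurable_mxP => // i j.
apply: (measurable_process (Y := fun r w => Xs r w i j)) => [r|w r].
  by apply: measurable_fun_coord; exact: measurable_funPT.
apply: (@continuous_comp _ _ _ (fun r => Xs r w) (fun x : 'rV[R]_d => x i j)).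
  exact: (@continuous_clamp _ _ s (fun r => X r w) (@cX w) r).
exact: coord_continuous.
Qed.

Let mlaw : measurable_fun setT ((fun r => law X (time r)) : RT -> Pr R d).
Proof. by apply: continuous_measurable_Pr; exact: law_continuous. Qed.

Let mdrift i : measurable_fun setT (fun z : RT * Omega => drift z.1 z.2 0 i).
Proof. exact: (measurable_coef_process _ _ bb time0 mtime mXs mlaw). Qed.

Let mdiff i j : measurable_fun setT (fun z : RT * Omega => diff z.1 z.2 i j).
Proof. exact: (measurable_coef_process _ _ bsigma time0 mtime mXs mlaw). Qed.

Let size z : R := eucl_norm (drift z.1 z.2) + hs_norm2 (diff z.1 z.2).

Let size_ge0 z : 0 <= size z.
Proof. by rewrite addr_ge0 ?sqrtr_ge0 ?hs_norm2_ge0. Qed.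

Let msize : measurable_fun setT (size : RT * Omega -> R).
Proof.
by apply: measurable_funD; [exact: measurable_eucl_norm|exact: measurable_hs_norm2].
Qed.

Let coef_size r x : R := eucl_norm (b r x (law X r)) + hs_norm2 (sigma r x (law X r)).

Let mcoef_size r : 0 <= r -> measurable_fun setT (coef_size r).
Proof.
move=> r0; apply: measurable_funD.
  by apply: measurable_eucl_norm => i; exact: measurable_coef_section.
by apply: measurable_hs_norm2 => i j; exact: measurable_coef_section.
Qed.

Let sizeE r w : s <= r -> size (r, w) = coef_size r (X r w).
Proof. by move=> sr; rewrite /size /drift /diff /Xs /= timeE. Qed.

(* the initial time does not contribute *)
Let closed_open a t (f : RT -> \bar R) : measurable_fun setT f ->
  (\int[mu]_(r in `[a, t]) f r = \int[mu]_(r in `]a, t]) f r)%E.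
Proof. by move=> mf; rewrite integral_itv_obnd_cbnd//; exact: measurable_funTS. Qed.

Let isize t : integrableR M (strip s t) size.
Proof.
have [st|/ltW ts] := leP s t; last first.
  apply: (integrable_stripS (lexx s) ts).
  apply: strip_integrable_crit => //.
  by rewrite set_itvE integral_set0 ltry.
apply: strip_integrable_crit => //.
have [_ _ _ /(_ _ st) fin _] := ws; apply: le_lt_trans fin.
rewrite [leRHS](_ : _ = \int[mu]_(r in `[s, t]) \int[P]_w (size (r, w))%:E)%E; last first.
  apply: eq_integral => r; rewrite inE /= in_itv/= => /andP[sr _].
  rewrite (integral_law X r (mcoef_size (le_trans s0 sr))).
  by apply: eq_integral => w _; rewrite sizeE.
rewrite closed_open; last exact: measurable_time_expectation.
rewrite le_eqVlt; apply/orP; left; apply/eqP; apply: eq_integral => r _.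
by apply: eq_integral => w _; rewrite ger0_norm.
Qed.

Let mS a t : measurable (strip a t : set (RT * Omega)). Proof. exact: measurable_strip. Qed.

Let idrift t i : integrableR M (strip s t) (fun z => drift z.1 z.2 0 i).
Proof.
apply: (le_integrableR (mS s t) (isize t)); first exact: measurable_funTS.
move=> z _; apply: le_trans (_ : eucl_norm (drift z.1 z.2) <= _); last first.
  by rewrite lerDl hs_norm2_ge0.
by apply: le_trans (mx_norm_le_eucl _); exact: ler_coord.
Qed.

Let idiff t : integrableR M (strip s t) (fun z => hs_norm2 (diff z.1 z.2)).
Proof.
apply: (le_integrableR (mS s t) (isize t)).
  by apply: measurable_funTS; exact: measurable_hs_norm2.
by move=> z _; rewrite ger0_norm ?hs_norm2_ge0// lerDr sqrtr_ge0.
Qed.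

Let L h z := generator b sigma (time z.1) (law X (time z.1)) h (Xs z.1 z.2).

Let LE h z : generator_integrand h (Xs z.1 z.2) (drift z.1 z.2) (diff z.1 z.2) = L h z.
Proof. exact: generator_integrandE. Qed.

Lemma weak_solution_ito h u v (xi : Omega -> R) : test_function h -> s <= u -> u <= v ->
  measurable_wrt (F u) xi -> (forall w, `|xi w| <= 1) ->
  integrableR M (strip u v) (fun z => xi z.2 * L h z) /\
  \int[P]_w (xi w * (h (X v w) - h (X u w))) =
  \int[M]_(z in strip u v) (xi z.2 * L h z).
Proof.
move=> th su uv mxi bxi.
have [_ _ _ _ [I [[cI aI [Sn [sS cv]]] path]]] := ws.
have [C jh] := test_function_jet th.
have path0 : {ae P, forall w, forall t i, s <= t ->
    X t w 0 i - I t w 0 i = X s w 0 i + \int[mu]_(r in `]s, t]) drift r w 0 i}.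
  apply: filterS path => w hw t i st; rewrite (hw t st) !mxE addrK; congr (_ + _).
  rewrite /Rintegral; congr fine.
  have mf := measurable_section_fst w (mdrift i).
  rewrite -(closed_open s t (f := fun r => (drift r w 0 i)%:E)); last exact/measurable_EFinP.
  apply: eq_integral => r; rewrite inE /= in_itv/= => /andP[sr _].
  by rewrite /drift /Xs timeE.
have cvH t : s <= t -> (fun n => \int[P]_w \int[mu]_(r in `]s, t])
    (hs_norm2 (simple_value (Sn n) r w - diff r w))%:E)%E @ \oo --> 0%E.
  move=> st; have [h1 _] := cv t st; apply: cvg_trans h1.
  apply: near_eq_cvg; apply: nearW => n; apply: eq_integral => w _.
  have mf : measurable_fun setT (fun r : RT =>
      (hs_norm2 (simple_value (Sn n) r w - diff r w))%:E).
    apply/measurable_EFinP; apply: measurable_hs_norm2 => i j.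
    have -> : (fun r : RT => (simple_value (Sn n) r w - diff r w) i j) =
        (fun r => simple_value (Sn n) r w i j - diff r w i j).
      by apply/funext => r; rewrite mxE [X in _ + X]mxE.
    apply: measurable_funB; last exact: (measurable_section_fst w (mdiff i j)).
    exact: (measurable_section_fst w (measurable_simple_value nF s0 (sS n) i j)).
  rewrite -closed_open//; apply: eq_integral => r.
  by rewrite inE /= in_itv/= => /andP[sr _]; rewrite /diff /Xs timeE.
have cvI t : s <= t -> (fun n => \int[P]_w
    (eucl_norm (simple_integral W (Sn n) t w - I t w) ^+ 2)%:E)%E @ \oo --> 0%E.
  by move=> st; have [] := cv t st.
have [i1 e1] := ito_formula nF bW s0 sS aX aI (@cX) cI mdrift idrift mdiff idiff path0 cvH cvI
  th jh su uv mxi bxi.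
have E (z : RT * Omega) : strip u v z ->
    generator_integrand h (X z.1 z.2) (drift z.1 z.2) (diff z.1 z.2) = L h z.
  move=> [/= + _]; rewrite in_itv/= => /andP[/ltW/(le_trans su) sz _].
  by rewrite -LE /Xs (timeE sz).
split.
  move: i1; apply: eq_integrable; first exact: mS.
  by move=> z /set_mem zS; exact: (congr1 (fun y => (xi z.2 * y)%:E) (E z zS)).
rewrite e1; apply: eq_Rintegral => z /set_mem zS.
exact: (congr1 (fun y => xi z.2 * y) (E z zS)).
Qed.

(** Under a probability with an F_u-measurable density, the marginal laws still
    solve the equation from time u on, with the coefficients evaluated along the
    original laws. *)
Lemma weighted_law_solution (Q : probability Omega R) u (c : R) (xi : Omega -> R) :
  s <= u -> measurable_wrt (F u) xi -> (forall w, 0 <= xi w <= 1) -> 0 <= c ->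
  (forall f : Omega -> R, measurable_fun setT f ->
    \int[Q]_w (f w)%:E = \int[P]_w (c * (xi w * f w))%:E)%E ->
  FP2_solution b sigma u (law X) (law (P := Q) X).
Proof.
move=> su mxi xi01 c0 QE.
have u0 := le_trans s0 su.
have bxi w : `|xi w| <= 1 by have /andP[x0 x1] := xi01 w; rewrite ger0_norm.
have mxi' := measurable_wrt_measurable (filtration_measurable nF u0) mxi.
have mx2 : measurable_fun setT (fun z : RT * Omega => xi z.2).
  by apply: (measurableT_comp mxi'); exact: measurable_snd.
have weight (f : RT * Omega -> R) t : integrableR M (strip u t) f ->
    integrableR M (strip u t) (fun z => c * (xi z.2 * f z)).
  by move=> fi; apply: integrableRZ => //; exact: (Rintegral_strip_mul mxi' bxi fi).1.
have mweight (f : RT * Omega -> R) : measurable_fun setT f ->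
    measurable_fun setT (fun z => c * (xi z.2 * f z)).
  by move=> mf; apply: measurable_funM => //; exact: measurable_funM.
split.
- exact: (law_cpath (P := Q) (X := X) (@cX)).
- move=> t ut.
  rewrite [ltLHS](_ : _ = \int[mu]_(r in `[u, t])
      \int[P]_w (c * (xi w * size (r, w)))%:E)%E; last first.
    apply: eq_integral => r; rewrite inE /= in_itv/= => /andP[/(le_trans su) sr _].
    have mc := mcoef_size (le_trans s0 sr).
    rewrite (integral_law (P := Q) X r mc) QE; last first.
      exact: (measurableT_comp mc (measurable_funPT (X r))).
    by apply: eq_integral => w _; rewrite sizeE.
  rewrite closed_open; last exact: (measurable_time_expectation P (mweight _ msize)).
  have := strip_integrable_lty (weight _ t (integrable_stripS su (lexx t) (isize t))).
  apply: le_lt_trans; rewrite le_eqVlt; apply/orP; left; apply/eqP.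
  apply: eq_integral => r _; apply: eq_integral => w _ /=.
  by rewrite ger0_norm// !mulr_ge0//; have /andP[] := xi01 w.
- move=> t h ut th; have st := le_trans su ut.
  have [C jh] := test_function_jet th.
  have ch : continuous h by have [] := th.1 [::].
  have mh := continuous_measurable_mx ch.
  have mhX r : measurable_fun setT (fun w => h (X r w)).
    exact: (measurableT_comp mh (measurable_funPT (X r))).
  have ihX r : integrableR P setT (fun w => xi w * h (X r w)).
    apply: (@bounded_integrableR _ _ _ P (1 * C)); first exact: measurable_funM.
    by move=> w; rewrite normrM ler_pM// (jet_b0 jh).
  have lawh r : (\int[law (P := Q) X r]_x (h x)%:E = (c * \int[P]_w (xi w * h (X r w)))%:E)%E.
    rewrite (integral_law (P := Q) X r mh) (QE _ (mhX r)).
    rewrite -EFin_Rintegral//; last exact: integrableRZ.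
    by rewrite RintegralZl//; exact: ihX.
  have [iL eL] := weak_solution_ito th su ut mxi bxi.
  have mL : measurable_fun setT (L h).
    rewrite [X in measurable_fun _ X](_ : _ = fun z : RT * Omega =>
      generator_integrand h (Xs z.1 z.2) (drift z.1 z.2) (diff z.1 z.2)); last first.
      by apply/funext => z; rewrite LE.
    exact: measurable_generator_integrand.
  rewrite !lawh [X in (_ + X)%E](_ : _ = \int[mu]_(r in `[u, t])
      \int[P]_w (c * (xi w * L h (r, w)))%:E)%E; last first.
    apply: eq_integral => r; rewrite inE /= in_itv/= => /andP[/(le_trans su) sr _].
    have r0 := le_trans s0 sr.
    have mg : measurable_fun setT (generator b sigma r (law X r) h).
      rewrite [X in measurable_fun _ X](_ : _ = fun x =>
        generator_integrand h x (b r x (law X r)) (sigma r x (law X r))); last first.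
        by apply/funext => x; rewrite generator_integrandE.
      apply: measurable_generator_integrand => //.
      - by move=> i; exact: measurable_coef_section.
      - by move=> i j; exact: measurable_coef_section.
    rewrite (integral_law (P := Q) X r mg) QE; last first.
      exact: (measurableT_comp mg (measurable_funPT (X r))).
    by apply: eq_integral => w _; rewrite /L /Xs /= (timeE sr).
  rewrite closed_open; last exact: (measurable_time_expectation P (mweight _ mL)).
  have icL : integrableR M (strip u t) (fun z => c * (xi z.2 * L h z)).
    exact: integrableRZ.
  rewrite -(Rintegral_strip_time icL) RintegralZl// -eL -EFinD -mulrDr.
  have -> : \int[P]_w (xi w * (h (X t w) - h (X u w))) =
      \int[P]_w (xi w * h (X t w)) - \int[P]_w (xi w * h (X u w)).
    rewrite -RintegralB//; [|exact: ihX|exact: ihX].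
    by apply: eq_Rintegral => w _; rewrite mulrBr.
  by rewrite addrC subrK.
Qed.

End WeakSolutionLaw.

(** * Uniqueness of the finite dimensional distributions *)

Section FrozenEquation.
Context (R : realType) (d m : nat).
Variable b : R -> 'rV[R]_d -> Pr R d -> 'rV[R]_d.
Variable sigma : R -> 'rV[R]_d -> Pr R d -> 'M[R]_(d, m).
Hypotheses (bb : borel_coef b) (bsigma : borel_coef sigma).

Lemma FP2_measure_eq u (mu mu' nu : R -> Pr R d) : 0 <= u ->
  (forall t, u <= t -> measure_eq (mu t) (mu' t)) ->
  FP2_solution b sigma u mu nu -> FP2_solution b sigma u mu' nu.
Proof.
move=> u0 E [cnu ci eqn]; split; first exact: cnu.
- move=> t ut; apply: le_lt_trans (ci t ut); rewrite le_eqVlt; apply/orP; left; apply/eqP.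
  apply: eq_integral => r; rewrite inE /= in_itv/= => /andP[ur _].
  have r0 := le_trans u0 ur; apply: eq_integral => x _.
  by rewrite (coef_measure_eq x bb r0 (E r ur)) (coef_measure_eq x bsigma r0 (E r ur)).
- move=> t h ut th; rewrite (eqn t h ut th).
  apply: (congr1 (fun y => \int[nu u]_x (h x)%:E + y)%E).
  apply: eq_integral => r; rewrite inE /= in_itv/= => /andP[ur _].
  have r0 := le_trans u0 ur; apply: eq_integral => x _.
  by rewrite /generator (coef_measure_eq x bb r0 (E r ur))
    (coef_measure_eq x bsigma r0 (E r ur)).
Qed.

Context (disp : measure_display) (Omega : measurableType disp).
Variables (P : probability Omega R) (F : R -> set (set Omega)).
Variables (W : R -> Omega -> 'rV[R]_m) (X : R -> {RV P >-> 'rV[R]_d}).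
Variables (s : R) (zeta : Pr R d).
Hypotheses (s0 : 0 <= s) (ws : weak_solution b sigma F W X s zeta).

Lemma law_solution u : s <= u -> FP1_solution b sigma u (law X).
Proof.
move=> su; apply: (weighted_law_solution bb bsigma s0 ws su (xi := cst 1) (c := 1)) => //.
- exact: measurable_cst.
- by move=> w; rewrite ler01 lexx.
- by move=> f mf; apply: eq_integral => w _; rewrite !mul1r.
Qed.

Lemma conditioned_law_solution u G (mG : measurable G) : s <= u -> F u G -> (0 < P G)%E ->
  FP2_solution b sigma u (law X) (law (P := conditioned P mG) X).
Proof.
move=> su FG PG0.
apply: (weighted_law_solution bb bsigma s0 ws su (xi := \1_G) (c := (fine (P G))^-1)).
- have mG' : measurable (G : set (g_sigma_algebraType (F u))) by exact: sub_sigma_algebra.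
  exact: (measurable_indic (R := R) mG').
- by move=> w; rewrite indicE; case: (_ \in _); rewrite ler01 lexx.
- exact/ltW/conditioning_factor_gt0.
- by move=> f mf; exact: integral_conditioned.
Qed.

End FrozenEquation.

Lemma measure_eqC (R : realType) d (mu nu : Pr R d) : measure_eq mu nu -> measure_eq nu mu.
Proof. by move=> E B mB; rewrite E. Qed.

Lemma measure_eq_trans (R : realType) d (mu nu la : Pr R d) :
  measure_eq mu nu -> measure_eq nu la -> measure_eq mu la.
Proof. by move=> E1 E2 B mB; rewrite E1// E2. Qed.

Section FddEvents.
Context (R : realType) (d : nat) (Omega : Type) (X : R -> Omega -> 'rV[R]_d).
Implicit Types (t : nat -> R) (B : nat -> set 'rV[R]_d).

Definition fdd_event t B n : set Omega :=
  [set w | forall k, (k <= n)%N -> B k (X (t k) w)].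

Lemma fdd_event0 t B : fdd_event t B 0 = X (t 0%N) @^-1` B 0%N.
Proof.
apply/seteqP; split => w /=; first by move/(_ 0%N (leqnn _)).
by move=> h k; rewrite leqn0 => /eqP ->.
Qed.

Lemma fdd_eventS t B n :
  fdd_event t B n.+1 = fdd_event t B n `&` X (t n.+1) @^-1` B n.+1.
Proof.
apply/seteqP; split => w /=.
  by move=> h; split => [k kn|]; apply: h => //; exact: leqW.
by move=> [h1 h2] k; rewrite leq_eqVlt => /predU1P[-> //|]; rewrite ltnS; exact: h1.
Qed.

Lemma fdd_event_last t B n D : X (t n) @^-1` D `&` fdd_event t B n =
  fdd_event t (fun k => if k == n then B n `&` D else B k) n.
Proof.
apply/seteqP; split => w /=.
  by move=> [hD h] k kn; case: eqP => [->|_]; [split => //; exact: h|exact: h].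
move=> h; split; first by have := h n (leqnn n); rewrite eqxx => -[].
by move=> k kn; have := h k kn; case: eqP => [-> []|].
Qed.

End FddEvents.

Lemma fdd_event_F (R : realType) (d : nat) disp (Omega : measurableType disp)
    (P : probability Omega R) (F : R -> set (set Omega)) (X : R -> Omega -> 'rV[R]_d)
    (s : R) n (t : nat -> R) (B : nat -> set 'rV[R]_d) : normal_filtration P F -> 0 <= s ->
  (forall r, s <= r -> F_measurable F r (X r)) -> (forall k, s <= t k) ->
  (forall k, (k < n)%N -> t k <= t k.+1) -> (forall k, measurable (B k)) ->
  F (t n) (fdd_event X t B n).
Proof.
move=> nF s0 aX st; elim: n => [|n IH] tm mB; first by rewrite fdd_event0; exact: aX.
have t0 k : 0 <= t k by exact: le_trans (st k).
have FI u G1 G2 : 0 <= u -> F u G1 -> F u G2 -> F u (G1 `&` G2).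
  move=> u0 h1 h2; have : measurable ((G1 `&` G2) : set (g_sigma_algebraType (F u))).
    by apply: measurableI; exact: sub_sigma_algebra.
  by rewrite /measurable /= sigma_algebra_id//; exact: filtration_sigma nF _ u0.
rewrite fdd_eventS; apply: FI => //; last exact: aX.
apply: (filtration_le nF (t0 n) (tm n (leqnn _))).
by apply: IH => // k kn; apply: tm; exact: ltnW.
Qed.

Section MarginalLaws.
Context (R : realType) (d m : nat).
Variable b : R -> 'rV[R]_d -> Pr R d -> 'rV[R]_d.
Variable sigma : R -> 'rV[R]_d -> Pr R d -> 'M[R]_(d, m).
Variable P0 : set (Pr R d).
Variable A : set (`[0%R : R, +oo[%classic -> Pr R d).
Hypotheses (bb : borel_coef b) (bsigma : borel_coef sigma) (PP : propertyP P0 A).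
Variables (mu : R -> Pr R d -> R -> Pr R d) (nu : R -> Pr R d -> Pr R d -> R -> Pr R d).
Hypothesis mu_unique : forall s zeta, 0 <= s -> P0 zeta ->
  unique_in A s zeta (FP1_solution b sigma s) (mu s zeta).
Hypothesis nu_unique : forall s theta zeta, 0 <= s -> P0 theta -> P0 zeta ->
  unique_in A s theta (FP2_solution b sigma s (mu s zeta)) (nu s zeta theta).

Section OneSolution.
Context (disp : measure_display) (Omega : measurableType disp).
Variables (P : probability Omega R) (F : R -> set (set Omega)).
Variables (W : R -> Omega -> 'rV[R]_m) (X : R -> {RV P >-> 'rV[R]_d}).
Variables (s : R) (zeta : Pr R d).
Hypotheses (s0 : 0 <= s) (ws : weak_solution b sigma F W X s zeta).
Hypothesis AX : A (from 0 (fun t => law X (s + t))).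

Lemma shifted_law_in u : s <= u -> A (from 0 (fun t => law X (u + t))).
Proof.
move=> su; have [_ _ _ shift _] := PP.
have us : 0 <= u - s by rewrite subr_ge0.
have := shift _ _ us AX; congr (A (from 0 _)); apply/funext => t.
by rewrite addrA [s + _]addrC subrK.
Qed.

Lemma law_in_P0 u : s <= u -> P0 (law X u).
Proof.
move=> su; have [_ cp _ _ _] := PP.
by have [_ /(_ 0 (lexx _))] := cp _ (shifted_law_in su); rewrite addr0.
Qed.

Lemma law_eq_marginal u zeta' : s <= u -> P0 zeta' -> measure_eq (law X u) zeta' ->
  forall t, u <= t -> measure_eq (law X t) (mu u zeta' t).
Proof.
move=> su Pz E t ut; have [_ /(_ (law X))] := mu_unique (le_trans s0 su) Pz.
apply => //; split => //; last exact: shifted_law_in.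
exact: (law_solution bb bsigma s0 ws su).
Qed.

(** A conditional law is dominated by a multiple of the law, hence remains in
    the class where uniqueness holds. *)
Lemma conditioned_law_eq u G (mG : measurable G) zeta' theta : s <= u -> F u G ->
  (0 < P G)%E -> P0 zeta' -> P0 theta -> measure_eq (law X u) zeta' ->
  measure_eq (law (P := conditioned P mG) X u) theta ->
  forall t, u <= t -> measure_eq (law (P := conditioned P mG) X t) (nu u zeta' theta t).
Proof.
move=> su FG PG0 Pz Pt Ez Et t ut; have u0 := le_trans s0 su.
have [_ cp dom _ domA] := PP.
have [_ /(_ (law (P := conditioned P mG) X))] := nu_unique u0 Pt Pz.
have c0 := conditioning_factor_gt0 mG PG0.
have le_law r : measure_le (law (P := conditioned P mG) X r) (fine (P G))^-1 (law X r).
  move=> B mB; apply: (conditioned_le mG PG0).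
  by rewrite -[X in measurable X]setTI; exact: measurable_funPT.
have cX w : {within `[s, +oo[, continuous (fun t => X t w)} by case: ws => _ [h _] _ _ _.
apply => //; split => //.
  apply: (FP2_measure_eq bb bsigma u0 (law_eq_marginal su Pz Ez)).
  exact: (conditioned_law_solution bb bsigma s0 ws mG su FG PG0).
apply: (domA (fun t => law X (u + t)) _ _ (shifted_law_in su) c0) => //.
split.
  have lc := law_continuous (P := conditioned P mG) (X := X) cX.
  have c : continuous (fun r => law (P := conditioned P mG) X (Num.max s (u + r))).
    move=> r; apply: (@continuous_comp _ _ _ (fun r => u + r)
      (fun r => law (P := conditioned P mG) X (Num.max s r))); last exact: lc.
    by apply: cvgD; [exact: cvg_cst|exact: cvg_id].
  have cw := continuous_subspaceT (A := (`[0, +oo[%classic : set R)) c.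
  apply: subspace_eq_continuous cw => r; rewrite inE /= in_itv/= andbT => r0.
  have ur : s <= u + r by rewrite (le_trans su)// lerDl.
  transitivity (law (P := conditioned P mG) X (Num.max s (u + r))) => //.
  by rewrite (max_r ur).
move=> r r0; apply: (dom (law X (u + r)) _ _ _ c0 (le_law _)).
by apply: law_in_P0; rewrite (le_trans su)// lerDl.
Qed.

Lemma conditioned_law_in_P0 u G (mG : measurable G) : s <= u -> (0 < P G)%E ->
  P0 (law (P := conditioned P mG) X u).
Proof.
move=> su PG0; have [_ _ dom _ _] := PP.
apply: (dom (law X u) _ _ (law_in_P0 su) (conditioning_factor_gt0 mG PG0)).
move=> B mB; apply: (conditioned_le mG PG0).
by rewrite -[X in measurable X]setTI; exact: measurable_funPT.
Qed.

End OneSolution.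

Section TwoSolutions.
Context (d1 d2 : measure_display) (O1 : measurableType d1) (O2 : measurableType d2).
Variables (P1 : probability O1 R) (P2 : probability O2 R).
Variables (F1 : R -> set (set O1)) (F2 : R -> set (set O2)).
Variables (W1 : R -> O1 -> 'rV[R]_m) (W2 : R -> O2 -> 'rV[R]_m).
Variables (X1 : R -> {RV P1 >-> 'rV[R]_d}) (X2 : R -> {RV P2 >-> 'rV[R]_d}).
Variables (s : R) (zeta : Pr R d).
Hypotheses (s0 : 0 <= s) (Pzeta : P0 zeta).
Hypotheses (ws1 : weak_solution b sigma F1 W1 X1 s zeta)
  (ws2 : weak_solution b sigma F2 W2 X2 s zeta).
Hypotheses (AX1 : A (from 0 (fun t => law X1 (s + t))))
  (AX2 : A (from 0 (fun t => law X2 (s + t)))).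

Lemma marginal_laws_eq t : s <= t -> measure_eq (law X1 t) (law X2 t).
Proof.
move=> st.
have E1 : measure_eq (law X1 s) zeta by case: ws1.
have E2 : measure_eq (law X2 s) zeta by case: ws2.
apply: measure_eq_trans (law_eq_marginal s0 ws1 AX1 (lexx s) Pzeta E1 st) _.
exact/measure_eqC/(law_eq_marginal s0 ws2 AX2 (lexx s) Pzeta E2 st).
Qed.

(** Conditioning on the past reduces the law of one more coordinate to the
    uniqueness of the frozen linear equation started from the conditional law
    at the last time. *)
Lemma fdd_eq n (t : nat -> R) (B : nat -> set 'rV[R]_d) : (forall k, s <= t k) ->
  (forall k, (k < n)%N -> t k <= t k.+1) -> (forall k, measurable (B k)) ->
  P1 (fdd_event X1 t B n) = P2 (fdd_event X2 t B n).
Proof.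
move=> st; elim: n B => [|n IH] B tm mB.
  by rewrite !fdd_event0; exact: (marginal_laws_eq (st _) (mB _)).
have tn : t n <= t n.+1 by exact: tm.
have {}tm k : (k < n)%N -> t k <= t k.+1 by move=> kn; apply: tm; exact: ltnW.
have [[nF1 _] [_ a1] _ _ _] := ws1; have [[nF2 _] [_ a2] _ _ _] := ws2.
have F1G := fdd_event_F nF1 s0 a1 st tm mB; have F2G := fdd_event_F nF2 s0 a2 st tm mB.
have mG1 := filtration_measurable nF1 (le_trans s0 (st n)) F1G.
have mG2 := filtration_measurable nF2 (le_trans s0 (st n)) F2G.
have PG := IH B tm mB.
have mX1 r D : measurable D -> measurable (X1 r @^-1` D).
  by move=> mD; rewrite -[X in measurable X]setTI; exact: measurable_funPT.
have mX2 r D : measurable D -> measurable (X2 r @^-1` D).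
  by move=> mD; rewrite -[X in measurable X]setTI; exact: measurable_funPT.
rewrite !fdd_eventS.
have [PG0|] := eqVneq (P1 (fdd_event X1 t B n)) 0%E.
  have mI1 := measurableI _ _ mG1 (mX1 (t n.+1) _ (mB n.+1)).
  have mI2 := measurableI _ _ mG2 (mX2 (t n.+1) _ (mB n.+1)).
  transitivity (0 : \bar R)%E; [|apply: esym]; apply/eqP; rewrite -measure_le0.
    by rewrite -[leRHS]PG0; apply: le_measure; rewrite ?inE//; exact: subIsetl.
  have PG0' := etrans (esym PG) PG0.
  by rewrite -[leRHS]PG0'; apply: le_measure; rewrite ?inE//; exact: subIsetl.
rewrite -measure_gt0 => PG1; have PG2 : (0 < P2 (fdd_event X2 t B n))%E by rewrite -PG.
have c1 := conditioning_factor_gt0 mG1 PG1.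
set Q1 := conditioned P1 mG1; set Q2 := conditioned P2 mG2.
have law1 r D : law (P := Q1) X1 r D =
    (P1 (X1 r @^-1` D `&` fdd_event X1 t B n) * ((fine (P1 (fdd_event X1 t B n)))^-1)%:E)%E.
  exact: conditionedE.
have law2 r D : law (P := Q2) X2 r D =
    (P2 (X2 r @^-1` D `&` fdd_event X2 t B n) * ((fine (P1 (fdd_event X1 t B n)))^-1)%:E)%E.
  by rewrite PG; exact: conditionedE.
have same : measure_eq (law (P := Q2) X2 (t n)) (law (P := Q1) X1 (t n)).
  move=> D mD; rewrite law1 law2; congr (_ * _)%E.
  pose B' k := if k == n then B n `&` D else B k.
  have mB' k : measurable (B' k) by rewrite /B'; case: ifP => // _; exact: measurableI.
  have := IH B' tm mB'; rewrite !fdd_event_last; exact: esym.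
have Pt : P0 (law (P := Q1) X1 (t n)).
  exact: (conditioned_law_in_P0 AX1 mG1 (st n) PG1).
have Pz := law_in_P0 AX1 (st n).
have E1 := conditioned_law_eq (mG := mG1) s0 ws1 AX1 (st n) F1G PG1 Pz Pt (fun _ _ => erefl)
  (fun _ _ => erefl) tn.
have E2 := conditioned_law_eq (mG := mG2) s0 ws2 AX2 (st n) F2G PG2 Pz Pt
  (measure_eqC (marginal_laws_eq (st n))) same tn.
have := E1 (B n.+1) (mB _); rewrite -(E2 (B n.+1) (mB _)) law1 law2.
move/(congr1 (fun y => y * (fine (P1 (fdd_event X1 t B n)))%:E)%E).
have f0 : fine (P1 (fdd_event X1 t B n)) != 0.
  by rewrite -invr_eq0 gt_eqF.
by rewrite -!muleA -!EFinM mulVf// !mule1 ![_ `&` fdd_event _ _ _ _]setIC.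
Qed.

End TwoSolutions.
End MarginalLaws.

(** * Laws on path space *)

Section PathLaw.
Context (R : realType) (d : nat) (s : R).
Local Notation T := (`[s, +oo[%classic).
Local Notation E := (path_space d s).

Definition path_event (t : nat -> T) (B : nat -> set 'rV[R]_d) n : set E :=
  [set x | forall k, (k <= n)%N -> B k (sval x (t k))].

Definition path_events : set (set E) :=
  [set D | exists n t B, (forall k, measurable (B k)) /\ D = path_event t B n].

Lemma path_event_setT (t : nat -> T) : path_event t (fun=> setT) 0 = setT.
Proof. by apply/seteqP; split. Qed.

Lemma path_events_setI : setI_closed path_events.
Proof.
move=> _ _ [n1 [t1 [B1 [mB1 ->]]]] [n2 [t2 [B2 [mB2 ->]]]].
exists (n1 + n2).+1, (fun k => if (k <= n1)%N then t1 k else t2 (k - n1.+1)%N),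
  (fun k => if (k <= n1)%N then B1 k else B2 (k - n1.+1)%N).
split; first by move=> k; case: ifP.
apply/seteqP; split => x.
  move=> [h1 h2] k kn; case: ifP => [kn1|/negbT]; first exact: h1.
  by rewrite -ltnNge => n1k; apply: h2; rewrite leq_subLR addSn.
move=> h; split => k kn.
  have := h k (leq_trans kn (leqW (leq_addr _ _))).
  by rewrite kn.
have := h (n1.+1 + k)%N; rewrite addSn ltnS leq_add2l => /(_ kn).
by rewrite ltnNge leq_addr /= -addSn addKn.
Qed.

Lemma path_measurableE : @measurable _ E = <<s path_events >>.
Proof.
apply/seteqP; split.
  apply: smallest_sub; first exact: smallest_sigma_algebra.
  move=> _ [t [B [mB ->]]]; apply: sub_sigma_algebra.
  exists 0%N, (fun=> t), (fun=> B); split => //.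
  by apply/seteqP; split => x /=; [move=> Bx k _|move/(_ 0%N (leqnn _))].
apply: smallest_sub; first exact: sigma_algebra_measurable.
move=> _ [n [t [B [mB ->]]]].
have -> : path_event t B n = \big[setI/setT]_(k < n.+1) [set x : E | B k (sval x (t k))].
  rewrite -(bigcap_mkord n.+1 (fun k => [set x : E | B k (sval x (t k))])).
  by apply/seteqP; split => x h k kn; apply: h.
apply: bigsetI_measurable => k _; apply: sub_sigma_algebra.
by exists (t k), (B k).
Qed.

Context disp (Omega : measurableType disp) (P : probability Omega R).
Variable X : R -> {RV P >-> 'rV[R]_d}.
Hypothesis cX : forall w, {within `[s, +oo[, continuous (fun t => X t w)}.

Lemma measurable_path_of : measurable_fun setT (path_of cX).
Proof.
apply: (@measurability _ _ _ _ setT (path_of cX) (@cylinders R d s) erefl).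
move=> _ [_ [t [B [mB ->]]] <-].
have -> : path_of cX @^-1` [set x | B (sval x t)] = X (val t) @^-1` B by [].
by apply: measurable_funPT.
Qed.

(** Finite dimensional events involve finitely many times in any order; the
    Markov-type induction needs them sorted. *)
Lemma path_event_sorted (t : nat -> T) (B : nat -> set 'rV[R]_d) n :
  exists t' B', [/\ forall k, s <= t' k, forall k, (k < n)%N -> t' k <= t' k.+1,
    (forall k, measurable (B k)) -> forall k, measurable (B' k)
    & forall disp' (O : measurableType disp') (Q : probability O R)
        (Y : R -> {RV Q >-> 'rV[R]_d})
        (cY : forall w, {within `[s, +oo[, continuous (fun t => Y t w)}),
        path_of cY @^-1` path_event t B n = fdd_event Y t' B' n].
Proof.
pose le i j := val (t i) <= val (t j).
pose l := sort le (iota 0 n.+1).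
have sl : seq.size l = n.+1 by rewrite size_sort size_iota.
have ml k : (k \in l) = (k <= n)%N by rewrite mem_sort mem_iota.
have /(sortedP 0%N) ol : sorted le l.
  by apply: sort_sorted => i j; exact: le_total.
exists (fun k => val (t (nth 0%N l k))), (fun k => B (nth 0%N l k)); split.
- by move=> k; have := valP (t (nth 0%N l k)); rewrite inE /= in_itv/= andbT.
- by move=> k kn; apply: ol; rewrite sl ltnS.
- by move=> mB k; exact: mB.
- move=> disp' O Q Y cY; apply/seteqP; split => w h k kn.
    by apply: h; rewrite -ml mem_nth// sl ltnS.
  have kl : k \in l by rewrite ml.
  have := h (index k l); rewrite nth_index//; apply.
  by rewrite -ltnS -sl index_mem.
Qed.

End PathLaw.

Lemma path_law_unique (R : realType) (d : nat) (s : R) (d1 d2 : measure_display)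
    (O1 : measurableType d1) (O2 : measurableType d2)
    (P1 : probability O1 R) (P2 : probability O2 R)
    (X1 : R -> {RV P1 >-> 'rV[R]_d}) (X2 : R -> {RV P2 >-> 'rV[R]_d})
    (cX1 : forall w, {within `[s, +oo[, continuous (fun t => X1 t w)})
    (cX2 : forall w, {within `[s, +oo[, continuous (fun t => X2 t w)}) :
  (forall n (t : nat -> R) B, (forall k, s <= t k) ->
    (forall k, (k < n)%N -> t k <= t k.+1) -> (forall k, measurable (B k)) ->
    P1 (fdd_event X1 t B n) = P2 (fdd_event X2 t B n)) ->
  forall C : set (path_space d s), measurable C ->
    pushforward P1 (path_of cX1) C = pushforward P2 (path_of cX2) C.
Proof.
move=> fdd C mC.
pose Y1 : {mfun O1 >-> path_space d s} := mfun_Sub (mem_set (measurable_path_of cX1)).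
pose Y2 : {mfun O2 >-> path_space d s} := mfun_Sub (mem_set (measurable_path_of cX2)).
apply: (@measure_unique _ _ _ (@path_events R d s) (fun=> setT) _ _ _ _
  (distribution P1 Y1) (distribution P2 Y2)) => //.
- exact: path_measurableE.
- exact: path_events_setI.
- move=> _; have sS : s \in `[s, +oo[%classic by rewrite inE /= in_itv/= lexx.
  pose x0 : `[s, +oo[%classic := exist _ s sS; exists 0%N, (fun=> x0), (fun=> setT); split => //.
  by rewrite path_event_setT.
- by rewrite bigcup_const.
- move=> _ [n [t [B [mB ->]]]].
  have [t' [B' [st' tm mB' E]]] := path_event_sorted t B n.
  transitivity (P1 (fdd_event X1 t' B' n)); first by rewrite -E.
  by rewrite (fdd n t' B' st' tm (mB' mB)) -(E _ _ _ _ cX2).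
- by move=> _; apply: le_lt_trans (probability_le1 _ measurableT) (ltry 1).
Qed.

Theorem corollary4p2 (R : realType) (d m : nat)
    (b : R -> 'rV[R]_d -> Pr R d -> 'rV[R]_d)
    (sigma : R -> 'rV[R]_d -> Pr R d -> 'M[R]_(d, m))
    (P0 : set (Pr R d))
    (A : set (`[0%R : R, +oo[%classic -> Pr R d)) :
  borel_coef b -> borel_coef sigma -> propertyP P0 A ->
  FP_wellposed b sigma P0 A ->
  MV_weakly_wellposed b sigma P0 A.
Proof.
move=> bb bsigma PP [mu [nu [mu_unique _ nu_unique _]]].
move=> s zeta s0 Pzeta d1 d2 O1 O2 P1 P2 F1 F2 W1 W2 X1 X2 cX1 cX2 ws1 ws2 AX1 AX2.
apply: path_law_unique => n t B st tm mB.
exact: (fdd_eq bb bsigma PP mu_unique nu_unique s0 Pzeta ws1 ws2 AX1 AX2 st tm mB).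
Qed.
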